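(* Let $z$ range over the set $\{z\in\mathbb C\setminus\mathbb Z:\Im z\ge0\}$, and let $\sigma_z$ be the spectral measure of the character $\chi_z$. (i) The measures $\sigma_z$ are pairwise disjoint (mutually singular). (ii) Each of the faces $\Omega(p,q)\subset\Omega$ (where $p,q$ are nonnegative integers, $(p,q)\neq(0,0)$) is a null set with respect to $\sigma_z$.
   Context: $S(n)$ is the group of permutations of $\{1,\dots,n\}$, identified with the stabilizer of $n+1$ in $S(n+1)$; $S(\infty)=\bigcup_n S(n)$; $G=S(\infty)\times S(\infty)$, $G(n)=S(n)\times S(n)$. The canonical projection $p_{n,n+1}:S(n+1)\to S(n)$ removes $n+1$ from its cycle: for $1\le i\le n$, $(p_{n,n+1}(x))(i)=x(i)$ if $x(i)\le n$, and $=x(n+1)$ if $x(i)=n+1$. $\mathfrak S=\varprojlim S(n)$ is the compact space of sequences $x=(x_n)$, $x_n\in S(n)$, with $p_{n,n+1}(x_{n+1})=x_n$. $G$ acts on $\mathfrak S$ on the right: for $g=(g_1,g_2)$, $x\cdot g=y$ where $y_n=g_2^{-1}x_ng_1$ for all $n$ with $g\in G(n)$. For $s\in S(n)$, $[s]$ is the number of cycles of $s$. $c(x,g)=[(x\cdot g)_n]-[x_n]\in\mathbb Z$ for any $n$ with $g\in G(n)$ (independent of such $n$). For $t>0$, $\mu_t$ is the Borel probability measure on $\mathfrak S$ whose image on each $S(n)$ has weights $\dfrac{t^{[s]}}{t(t+1)\cdots(t+n-1)}$. For $z\in\mathbb C\setminus\{0\}$ and $t=|z|^2$, the unitary representation $T_z$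 of $G$ acts in $L^2(\mathfrak S,\mu_t)$ by $(T_z(g)f)(x)=f(x\cdot g)z^{c(x,g)}$; with $f_0\equiv1$, the character $\chi_z$ of $S(\infty)$ is $\chi_z(s)=(T_z(s,e)f_0,f_0)$, $s\in S(\infty)$. Thoma simplex: $\Omega$ is the compact set (product topology) of pairs $\omega=(\alpha,\beta)$ of real sequences $\alpha_1\ge\alpha_2\ge\dots\ge0$, $\beta_1\ge\beta_2\ge\dots\ge0$ with $\sum_i\alpha_i+\sum_j\beta_j\le1$. $\Omega(p,q)\subset\Omega$ is the subset with $\alpha_i=0$ for $i>p$, $\beta_j=0$ for $j>q$, and $\sum_{i\le p}\alpha_i+\sum_{j\le q}\beta_j=1$. Spectral measure: for $\omega\in\Omega$ let $\chi^{(\omega)}(s)=\prod_{k\ge2}\big(\sum_i\alpha_i^k+(-1)^{k-1}\sum_j\beta_j^k\big)^{m_k(s)}$, $s\in S(\infty)$, where $m_k(s)$ is the number of $k$-cycles of $s$ and $0^0=1$. Every character $\chi$ of $S(\infty)$ (central positive definite function with $\chi(e)=1$) has the form $\chi(s)=\int_\Omega\chi^{(\omega)}(s)\,\sigma(d\omega)$ for a unique probability measure $\sigma$ on $\Omega$, called the spectral measure of $\chi$. *)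

(* Defs.v *)
From HB Require Import structures.
From mathcomp Require Import all_boot all_order all_algebra all_fingroup.
From mathcomp Require Import all_classical all_reals all_analysis.
From mathcomp Require Import complex.

Set Implicit Arguments.
Unset Strict Implicit.
Unset Printing Implicit Defensive.

Import Order.TTheory GRing.Theory Num.Theory.
Import numFieldNormedType.Exports.

Local Open Scope classical_set_scope.
Local Open Scope ring_scope.

(* Indices are shifted by one: {1, ..., n} is 'I_n = {0, ..., n-1}, the point *)
(* n+1 is [ord_max : 'I_n.+1], and [lift ord_max : 'I_n -> 'I_n.+1] is the    *)
(* inclusion.  The product of 'S_n composes from left to right,               *)
(* (s * t)%g i = t (s i), whereas the formulas for the action below come from *)
(* the composition of maps; hence g_2^-1 x g_1 is written g_1 * x * g_2^-1.   *)

(* The inner default [i] is never reached; see [canproj_funE]. *)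
Definition canproj_fun n (x : 'S_n.+1) (i : 'I_n) : 'I_n :=
  odflt (odflt i (unlift ord_max (x ord_max)))
        (unlift ord_max (x (lift ord_max i))).

Lemma lift_max_neq n (i : 'I_n) : (lift (@ord_max n) i == ord_max) = false.
Proof. by rewrite eq_sym; apply/negbTE/neq_lift. Qed.

Lemma canproj_funE n (x : 'S_n.+1) (i : 'I_n) :
  lift ord_max (canproj_fun x i) =
    if x (lift ord_max i) == ord_max then x ord_max else x (lift ord_max i).
Proof.
rewrite /canproj_fun; case: (unliftP _ (x (lift ord_max i))) => [j ->|E] /=.
  by rewrite lift_max_neq.
rewrite E eqxx; case: unliftP => [k -> //|E'].
by have /eqP := perm_inj (etrans E (esym E')); rewrite lift_max_neq.
Qed.

Lemma canproj_inj n (x : 'S_n.+1) : injective (canproj_fun x).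
Proof.
move=> i j /(congr1 (lift ord_max)); rewrite !canproj_funE.
case: eqP => [Ei|_]; case: eqP => [Ej|_].
- by move=> _; apply: (@lift_inj _ ord_max); apply: (@perm_inj _ x); rewrite Ei.
- by move=> /esym /perm_inj /eqP; rewrite lift_max_neq.
- by move=> /perm_inj /eqP; rewrite lift_max_neq.
- by move=> /perm_inj /lift_inj.
Qed.

Definition canproj n (x : 'S_n.+1) : 'S_n := perm (@canproj_inj n x).

Lemma canprojE n (x : 'S_n.+1) (i : 'I_n) :
  lift ord_max (canproj x i) =
    if x (lift ord_max i) == ord_max then x ord_max else x (lift ord_max i).
Proof. by rewrite permE canproj_funE. Qed.

Definition vperm_set : set (prod_topology (fun n => discrete_topology 'S_n)) :=
  [set x : forall n, 'S_n | forall n, canproj (x n.+1) = x n].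

Definition vperm : Type := set_type vperm_set.

HB.instance Definition _ := Topological.on vperm.

Lemma canproj1 n : canproj (1%g : 'S_n.+1) = 1%g.
Proof.
apply/permP => i; apply: (@lift_inj _ ord_max); rewrite canprojE !perm1.
by rewrite lift_max_neq.
Qed.

Lemma vperm1_subproof : (fun n => 1%g : 'S_n) \in vperm_set.
Proof. by apply/mem_set => n; exact: canproj1. Qed.

Definition vperm1 : vperm := exist _ (fun n => 1%g : 'S_n) vperm1_subproof.

HB.instance Definition _ := isPointed.Build vperm vperm1.

Definition vperm_borel := g_sigma_algebraType (@open vperm).

Definition vp (x : vperm) (n : nat) : 'S_n := (val x : forall n, 'S_n) n.

Definition emb n (u : 'S_n) : nat -> nat :=
  fun k => if insub k is Some i then val (u i) else k.

Definition Sinf : Type := set_type (\bigcup_n range (@emb n)).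

Definition inS n (s : Sinf) : Prop := range (@emb n) (val s).

Lemma inS_ex (s : Sinf) : exists n, inS n s.
Proof. by have [n _ sn] := set_mem (valP s); exists n. Qed.

(* Meaningful only when [inS n s]; see [restrP]. *)
Definition restr n (s : Sinf) : 'S_n := xget 1%g [set u | emb u = val s].

Lemma restrP n (s : Sinf) : inS n s -> emb (restr n s) = val s.
Proof.
case=> u _ us.
exact: (@xgetPex _ 1%g [set u | emb u = val s] (ex_intro _ u us)).
Qed.

Lemma emb_lt n (u : 'S_n) (i : 'I_n) : emb u i = u i.
Proof. by rewrite /emb valK. Qed.

Lemma emb_ge n (u : 'S_n) k : (n <= k)%N -> emb u k = k.
Proof. by move=> nk; rewrite /emb insubF // ltnNge nk. Qed.

Lemma emb_inj n : injective (@emb n).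
Proof.
move=> u v uv; apply/permP => i; apply: val_inj.
by rewrite /= -!emb_lt uv.
Qed.

Lemma emb_lift n (u : 'S_n) : emb (lift_perm ord_max ord_max u) = emb u.
Proof.
apply/funext => k; case: (ltnP k n) => [kn|].
  rewrite -[k]/(val (Ordinal kn)) emb_lt.
  have -> : val (Ordinal kn) = val (lift ord_max (Ordinal kn)).
    by rewrite /= /bump leqNgt kn.
  by rewrite emb_lt lift_perm_lift /= /bump leqNgt ltn_ord.
rewrite leq_eqVlt => /orP[/eqP <-|nk]; last by rewrite !emb_ge // ltnW.
by rewrite (emb_ge u) // -[n in LHS]/(val (@ord_max n)) emb_lt lift_perm_id.
Qed.

Lemma inSS n s : inS n s -> inS n.+1 s.
Proof. by case=> u _ us; exists (lift_perm ord_max ord_max u); rewrite ?emb_lift. Qed.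

Lemma inSW n m s : (n <= m)%N -> inS n s -> inS m s.
Proof.
move=> /subnK <-; elim: (m - n)%N => [//|k IH] /IH.
by rewrite addSn; exact: inSS.
Qed.

Lemma restrS n s : inS n s ->
  restr n.+1 s = lift_perm ord_max ord_max (restr n s).
Proof.
by move=> sn; apply: emb_inj; rewrite emb_lift !restrP //; exact: inSS.
Qed.

Lemma emb1 n : emb (1%g : 'S_n) = id.
Proof.
apply/funext => k; case: (ltnP k n) => [kn|nk]; last by rewrite emb_ge.
by rewrite -[k]/(val (Ordinal kn)) emb_lt perm1.
Qed.

Lemma Sinf1_subproof : (id : nat -> nat) \in \bigcup_n range (@emb n).
Proof. by apply/mem_set; exists 0%N => //; exists 1%g; rewrite ?emb1. Qed.

Definition Sinf1 : Sinf := exist _ (id : nat -> nat) Sinf1_subproof.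

Definition inG n (g : Sinf * Sinf) : Prop := inS n g.1 /\ inS n g.2.

Lemma inG_ex (g : Sinf * Sinf) : exists n, inG n g.
Proof.
have [n gn] := inS_ex g.1; have [m gm] := inS_ex g.2; exists (maxn n m).
by split; [apply: inSW gn; rewrite leq_maxl|apply: inSW gm; rewrite leq_maxr].
Qed.

Lemma inGS n g : inG n g -> inG n.+1 g.
Proof. by case=> ? ?; split; exact: inSS. Qed.

Lemma inGW n m g : (n <= m)%N -> inG n g -> inG m g.
Proof. by move=> nm [? ?]; split; exact: (inSW nm). Qed.

Lemma canproj_equiv n (u v : 'S_n) (x : 'S_n.+1) :
  canproj (lift_perm ord_max ord_max u * x * lift_perm ord_max ord_max v)%g
  = (u * canproj x * v)%g.
Proof.
apply/permP => i; apply: (@lift_inj _ ord_max).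
rewrite canprojE !permM lift_perm_lift lift_perm_id.
rewrite -(lift_perm_lift ord_max ord_max v) canprojE.
set y := x (lift _ _).
have -> : (lift_perm ord_max ord_max v y == ord_max) = (y == ord_max).
  by rewrite -(inj_eq (@perm_inj _ (lift_perm ord_max ord_max v)) y) lift_perm_id.
by case: ifP.
Qed.

Definition vact_level (x : vperm) (g : Sinf * Sinf) n : 'S_n :=
  (restr n g.1 * vp x n * (restr n g.2)^-1)%g.

Lemma vact_levelS x g n :
  inG n g -> canproj (vact_level x g n.+1) = vact_level x g n.
Proof.
move=> [g1 g2]; rewrite /vact_level !restrS // lift_permV canproj_equiv.
by congr (_ * _ * _)%g; exact: (set_mem (valP x)).
Qed.

Lemma canproj_extend N (a : 'S_N) : exists y : forall n, 'S_n,
  y N = a /\ forall n, (n < N)%N -> canproj (y n.+1) = y n.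
Proof.
elim: N a => [|N IH] a.
  by exists (eqtype.dfwith (fun n => 1%g : 'S_n) a); split=> //; rewrite dfwith_in.
have [y [yN yP]] := IH (canproj a).
exists (eqtype.dfwith y a); split; first by rewrite dfwith_in.
move=> n; rewrite ltnS leq_eqVlt => /orP[/eqP ->|nN].
  by rewrite dfwith_in dfwith_out // gtn_eqF.
by rewrite !dfwith_out ?yP // ?eqSS gtn_eqF // ltnS ltnW.
Qed.

Lemma vact_ex (x : vperm) (g : Sinf * Sinf) :
  exists y : vperm, forall n, inG n g -> vp y n = vact_level x g n.
Proof.
have eL : exists n, `[< inG n g >].
  by have [n gn] := inG_ex g; exists n; apply/asboolP.
case: (ex_minnP eL) => L /asboolP gL minL.
have [y [yL yP]] := canproj_extend (vact_level x g L).
pose w : forall n, 'S_n := fun n => if (n <= L)%N then y n else vact_level x g n.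
have wge n : (L <= n)%N -> w n = vact_level x g n.
  rewrite /w => Ln; case: ifP => // nL.
  by have -> : n = L by apply/eqP; rewrite eqn_leq nL.
have wP : vperm_set w.
  move=> n; case: (ltnP n L) => [nL|Ln].
    by rewrite /w nL (ltnW nL); exact: yP.
  by rewrite !wge ?(leqW Ln) // vact_levelS //; exact: inGW gL.
exists (exist (fun x => x \in vperm_set) w (mem_set wP)) => n gn.
by apply: wge; apply: minL; apply/asboolP.
Qed.

Definition vact (x : vperm) (g : Sinf * Sinf) : vperm := sval (cid (vact_ex x g)).

Lemma vactP x g n : inG n g ->
  vp (vact x g) n = (restr n g.1 * vp x n * (restr n g.2)^-1)%g.
Proof. exact: (svalP (cid (vact_ex x g))). Qed.

Definition ncycles n (s : 'S_n) : nat := #|porbits s|.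

(* The value does not depend on the level n, which is chosen arbitrarily. *)
Definition cocycle (x : vperm) (g : Sinf * Sinf) : int :=
  let n := sval (cid (inG_ex g)) in
  (ncycles (vp (vact x g) n))%:Z - (ncycles (vp x n))%:Z.

Section Characters.
Variable R : realType.

Definition ewens (t : R) (mu : probability vperm_borel R) : Prop :=
  forall n (s : 'S_n), mu [set x : vperm | vp x n = s] =
    (t ^+ ncycles s / \prod_(i < n) (t + i%:R))%:E.

Definition cintegral (mu : probability vperm_borel R)
    (f : vperm_borel -> R[i]) : R[i] :=
  Complex (\int[mu]_x complex.Re (f x)) (\int[mu]_x complex.Im (f x)).

Definition inner mu (f h : vperm_borel -> R[i]) : R[i] :=
  cintegral mu (fun x => f x * (h x)^*%C).

(* Acts on representatives of classes in L^2. *)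
Definition Tz (z : R[i]) (g : Sinf * Sinf) (f : vperm_borel -> R[i]) :
  vperm_borel -> R[i] := fun x => f (vact x g) * z ^ cocycle x g.

Definition chi_ (mu : probability vperm_borel R) (z : R[i]) (s : Sinf) : R[i] :=
  inner mu (Tz z (s, Sinf1) (fun=> 1)) (fun=> 1).

Definition sqmod (z : R[i]) : R := Normc.normc z ^+ 2.

(* alpha_(i+1) and beta_(j+1) are [w.1 i] and [w.2 j]. *)
Definition Omega_set : set ({ptws nat -> R} * {ptws nat -> R}) :=
  [set w | [/\ (forall i, 0 <= w.1 i.+1 <= w.1 i),
               (forall j, 0 <= w.2 j.+1 <= w.2 j) &
               (\sum_(0 <= i <oo) (w.1 i)%:E
                + \sum_(0 <= j <oo) (w.2 j)%:E <= 1)%E]].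

Definition Omega : Type := set_type Omega_set.

HB.instance Definition _ := Topological.on Omega.

Lemma Omega0_subproof :
  ((fun=> 0) : nat -> R, (fun=> 0) : nat -> R) \in Omega_set.
Proof.
apply/mem_set; split=> [i|i|] /=; rewrite ?lexx //.
by rewrite !eseries0 // adde0.
Qed.

HB.instance Definition _ := isPointed.Build Omega
  (exist (fun w => w \in Omega_set) _ Omega0_subproof).

Definition Omega_borel := g_sigma_algebraType (@open Omega).

Definition alpha (w : Omega) (i : nat) : R := (val w).1 i.
Definition beta (w : Omega) (j : nat) : R := (val w).2 j.

Definition face (p q : nat) : set Omega :=
  [set w | [/\ (forall i, (p <= i)%N -> alpha w i = 0),
               (forall j, (q <= j)%N -> beta w j = 0) &
               \sum_(i < p) alpha w i + \sum_(j < q) beta w j = 1]].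

Definition kcycles n (s : 'S_n) (k : nat) : nat :=
  #|[set A in porbits s | #|A| == k]|.

(* For s in S(n) there is no k-cycle with k > n, and the numbers of k-cycles  *)
(* with k >= 2 do not depend on n.                                            *)
Definition chi_Omega (w : Omega) (s : Sinf) : R :=
  let n := sval (cid (inS_ex s)) in
  \prod_(2 <= k < n.+1)
    (limn (series (fun i => alpha w i ^+ k))
     + (-1) ^+ k.-1 * limn (series (fun j => beta w j ^+ k)))
    ^+ kcycles (restr n s) k.

Definition is_spectral_measure (chi : Sinf -> R[i])
    (sigma : probability Omega_borel R) : Prop :=
  forall s, chi s = (\int[sigma]_w chi_Omega w s)%:C%C.

End Characters.

Definition mutually_singular (d : measure_display) (T : measurableType d)
    (R : realType) (mu nu : set T -> \bar R) : Prop :=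
  exists A : set T, [/\ measurable A, mu A = 0%E & nu (~` A) = 0%E].

Definition nonint_upper (R : realType) : set R[i] :=
  [set z | (forall m : int, z <> m%:~R) /\ 0 <= complex.Im z].

(* Main.v *)
Require Import Defs.
From HB Require Import structures.
From mathcomp Require Import all_boot all_order all_algebra all_fingroup.
From mathcomp Require Import all_classical all_reals all_analysis.
From mathcomp Require Import measurable_realfun complex.
From mathcomp Require Import zify ring lra.

Set Implicit Arguments.
Unset Strict Implicit.
Unset Printing Implicit Defensive.

Import Order.TTheory GRing.Theory Num.Theory.
Import numFieldNormedType.Exports.

(* The Jucys-Murphy elements J_k = sum_(i < k) (i k) of the group algebra of  *)
(* S(n) commute and have integral spectra; let P_a be the projection onto     *)
(* their joint eigenspace with eigenvalues a = (a_0, ..., a_(n-1)), the       *)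
(* content vector of a standard tableau, and w_a >= 0 the coefficient of the  *)
(* identity in P_a.  For omega in the Thoma simplex, chi^(omega) is a state   *)
(* of the group algebra, whence a probability on content vectors.  Since      *)
(* prod_k (z + J_k) = sum_x z^[x] x, its average over sigma_z is              *)
(*   M_z(a) = w_a prod_k |z + a_k|^2 / (t (t + 1) ... (t + n - 1)),           *)
(* while sum_a w_a prod_k (a_k^2 + p a_k + q) = q (q + 1) ... (q + n - 1).    *)
(* Let N_c be the number of k with a_k = c; then N_c <= N_0 and N_0 <= N_1+1. *)
(* (i) Let A(c) = |z + c|^2, B(c) = |z' + c|^2 and Q = (A + B) / 2 - delta.   *)
(* By AM-GM A B / Q^2 <= 1 + O(delta / (1 + c^2)) for all integers c, with a  *)
(* gain at c = 0 or c = 1, where A and B differ; as N_c <= N_0 the gain wins  *)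
(* and prod_k A B / Q^2 (a_k) is bounded.  Hence sum_a sqrt (M_z M_z') is at  *)
(* most a constant times prod_k (q + k) / sqrt ((t + k) (t' + k)), where      *)
(* q = (t + t') / 2 - delta, which tends to 0.                                *)
(* (ii) On the face Omega(p, q) the state is carried by the a with            *)
(* N_0 <= p + q, because a symmetric or antisymmetric block of positions      *)
(* contains at most one content 0.  Comparison with Q = A - delta, which is   *)
(* positive on the integers, shows that the M_z-mass of these a tends to 0.   *)

Local Open Scope ring_scope.

(** * The group algebra of a finite group *)

(** Both claims are read off from finite levels. The states [thoma_state w] are positive
    ([thoma_state_ge0]), being limits of mixtures of characters induced from one-dimensional
    characters of Young subgroups, so a point of the Thoma simplex distributes the mass 1 among the
    commuting projections [path_proj]. Jucys' formula [prod_JM] makes chi_z a trace against the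
    product of the |z + J_k|^2, and [integral_path] gives the sigma_z-average M_z(a) as a closed
    product.

    These products are compared with another one. By [sum_path_weights] the total weight is known
    for every monic quadratic, whether or not it comes from some z, and it does not depend on the
    linear coefficient. Lowering the constant term by delta makes the rising factorial smaller by a
    power of N ([gamma_ratio]), while the product over the contents loses at most a factor
    exp(O(N_0)), because no content is more frequent than 0 ([path_count_le], [sum_lorentz_path]).

    For (i) the loss is absorbed by strictness in the AM-GM inequality at the content 0 or 1
    ([disjoint_estimate]). The Hellinger affinity of M_z and M_z' thus becomes arbitrarily small,
    and some set of content vectors is nearly full for one and nearly null for the other
    ([separating_paths]). Markov's inequality turns it into a subset of the simplex, and a
    Borel-Cantelli argument ([singular_of_separating]) yields singularity. For (ii) the loss is
    bounded, since on Omega(p, q) at most p + q contents vanish ([thoma_state_face], resting on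
    [wchar_path_count]), and [face_estimate] applies.

    The contents themselves are controlled through the relations between [JM] and [adj_transp],
    together with the positivity [gstar_faithful]. *)

Definition galg (K : comNzRingType) (gT : finGroupType) : Type :=
  {ffun gT -> K}.

HB.instance Definition _ K gT := GRing.Zmodule.on (galg K gT).

Section GroupAlgebra.
Variables (K : comNzRingType) (gT : finGroupType).
Implicit Types (x y : galg K gT) (g h : gT).

Definition gcoef x g : K := (x : {ffun gT -> K}) g.
Definition gmake (F : gT -> K) : galg K gT := [ffun g => F g].

Lemma gmakeE F g : gcoef (gmake F) g = F g.
Proof. exact: ffunE. Qed.

Lemma galgP x y : (forall g, gcoef x g = gcoef y g) -> x = y.
Proof. by move=> xy; apply/ffunP => g; exact: xy. Qed.

Lemma gcoefD x y g : gcoef (x + y) g = gcoef x g + gcoef y g.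
Proof. exact: ffunE. Qed.

Lemma gcoef0 g : gcoef 0 g = 0.
Proof. exact: ffunE. Qed.

Lemma gcoefN x g : gcoef (- x) g = - gcoef x g.
Proof. exact: ffunE. Qed.

Lemma gcoef_sum I (r : seq I) (P : pred I) (F : I -> galg K gT) g :
  gcoef (\sum_(i <- r | P i) F i) g = \sum_(i <- r | P i) gcoef (F i) g.
Proof.
elim/big_rec2: _ => [|i y1 y2 _ <-]; first exact: gcoef0.
by rewrite gcoefD.
Qed.

Definition gmul x y := gmake (fun g => \sum_h gcoef x h * gcoef y (h^-1 * g)%g).
Definition gone := gmake (fun g => (g == 1%g)%:R).

Lemma gmulA : associative gmul.
Proof.
move=> x y z; apply: galgP => g; rewrite !gmakeE.
under eq_bigr => h _ do rewrite gmakeE mulr_sumr.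
under [RHS]eq_bigr => h _ do rewrite gmakeE mulr_suml.
rewrite [RHS]exchange_big; apply: eq_bigr => h _ /=.
rewrite (reindex_inj (mulgI h^-1%g)); apply: eq_bigr => k _ /=.
by rewrite mulrA invMg invgK -!mulgA mulKVg.
Qed.

Lemma gmul1l : left_id gone gmul.
Proof.
move=> x; apply: galgP => g; rewrite gmakeE (bigD1 1%g) //= gmakeE eqxx mul1r.
rewrite invg1 mul1g big1 ?addr0 // => h /negbTE h1.
by rewrite gmakeE h1 mul0r.
Qed.

Lemma gmul1r : right_id gone gmul.
Proof.
move=> x; apply: galgP => g; rewrite gmakeE (bigD1 g) //= gmakeE.
rewrite mulVg eqxx mulr1 big1 ?addr0 // => h /negbTE hg.
by rewrite gmakeE -eq_mulVg1 hg mulr0.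
Qed.

Lemma gmulDl : left_distributive gmul +%R.
Proof.
move=> x y z; apply: galgP => g; rewrite gcoefD !gmakeE -big_split /=.
by apply: eq_bigr => h _; rewrite gcoefD mulrDl.
Qed.

Lemma gmulDr : right_distributive gmul +%R.
Proof.
move=> x y z; apply: galgP => g; rewrite gcoefD !gmakeE -big_split /=.
by apply: eq_bigr => h _; rewrite gcoefD mulrDr.
Qed.

Lemma gone_neq0 : gone != 0.
Proof.
apply/eqP => /(congr1 (fun x => gcoef x 1%g)) /eqP.
by rewrite gmakeE gcoef0 eqxx oner_eq0.
Qed.

HB.instance Definition _ := GRing.Zmodule_isNzRing.Build (galg K gT)
  gmulA gmul1l gmul1r gmulDl gmulDr gone_neq0.

Definition gscale (c : K) x := gmake (fun g => c * gcoef x g).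

Fact gscaleA a b x : gscale a (gscale b x) = gscale (a * b) x.
Proof. by apply: galgP => g; rewrite !gmakeE mulrA. Qed.
Fact gscale1 : left_id 1 gscale.
Proof. by move=> x; apply: galgP => g; rewrite gmakeE mul1r. Qed.
Fact gscaleDr : right_distributive gscale +%R.
Proof.
move=> a x y; apply: galgP => g; rewrite [LHS]gmakeE !gcoefD mulrDr.
by congr (_ + _); rewrite [RHS]gmakeE.
Qed.
Fact gscaleDl x : {morph gscale^~ x : a b / a + b}.
Proof.
move=> a b; apply: galgP => g; rewrite [LHS]gmakeE gcoefD mulrDl.
by congr (_ + _); rewrite [RHS]gmakeE.
Qed.

HB.instance Definition _ := GRing.Zmodule_isLmodule.Build K (galg K gT)
  gscaleA gscale1 gscaleDr gscaleDl.

Lemma gcoefM x y g : gcoef (x * y) g = \sum_h gcoef x h * gcoef y (h^-1 * g)%g.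
Proof. exact: gmakeE. Qed.

Lemma gcoef1 g : gcoef 1 g = (g == 1%g)%:R.
Proof. exact: gmakeE. Qed.

Lemma gcoefZ c x g : gcoef (c *: x) g = c * gcoef x g.
Proof. exact: gmakeE. Qed.

Fact gscaleAl c x y : c *: (x * y) = (c *: x) * y.
Proof.
apply: galgP => g; rewrite gcoefZ !gcoefM mulr_sumr.
by apply: eq_bigr => h _; rewrite gcoefZ mulrA.
Qed.
HB.instance Definition _ := GRing.Lmodule_isLalgebra.Build K (galg K gT) gscaleAl.

Fact gscaleAr c x y : c *: (x * y) = x * (c *: y).
Proof.
apply: galgP => g; rewrite gcoefZ !gcoefM mulr_sumr.
by apply: eq_bigr => h _; rewrite gcoefZ mulrCA.
Qed.
HB.instance Definition _ := GRing.Lalgebra_isAlgebra.Build K (galg K gT) gscaleAr.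

Definition gbasis g : galg K gT := gmake (fun h => (h == g)%:R).

Lemma gcoef_gbasis g h : gcoef (gbasis g) h = (h == g)%:R.
Proof. exact: gmakeE. Qed.

Lemma gbasis1 : gbasis 1 = 1. Proof. by []. Qed.

Lemma gcoef_gbasisM g x h : gcoef (gbasis g * x) h = gcoef x (g^-1 * h)%g.
Proof.
rewrite gcoefM (bigD1 g) //= gcoef_gbasis eqxx mul1r big1 ?addr0 // => k /negbTE kg.
by rewrite gcoef_gbasis kg mul0r.
Qed.

Lemma gcoef_Mgbasis g x h : gcoef (x * gbasis g) h = gcoef x (h * g^-1)%g.
Proof.
rewrite gcoefM (bigD1 (h * g^-1)%g) //= gcoef_gbasis invMg invgK mulgKV eqxx mulr1.
rewrite big1 ?addr0 // => k kg; rewrite gcoef_gbasis -[g in (_ == g)]mulg1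
  -(inj_eq (mulgI k)).
rewrite mulKVg mulg1; case: eqP => [E|_]; last by rewrite mulr0.
by move: kg; rewrite E mulgK eqxx.
Qed.

Lemma gbasisM g h : gbasis (g * h) = gbasis g * gbasis h.
Proof.
apply: galgP => k; rewrite gcoef_gbasisM !gcoef_gbasis.
by rewrite -(inj_eq (mulgI g^-1%g) k) mulKg.
Qed.

Lemma gexpand x : x = \sum_g gcoef x g *: gbasis g.
Proof.
apply: galgP => h; rewrite gcoef_sum (bigD1 h) //= gcoefZ gcoef_gbasis eqxx mulr1.
rewrite big1 ?addr0 // => g /negbTE gh.
by rewrite gcoefZ gcoef_gbasis eq_sym gh mulr0.
Qed.

(** The normalized trace of the regular representation. The map [gstar] below is the adjoint,
    without conjugation because positivity is only used over real fields. *)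
Definition gtau x := gcoef x 1%g.
Definition gstar x := gmake (fun g => gcoef x g^-1%g).

Lemma gcoef_star x g : gcoef (gstar x) g = gcoef x g^-1%g.
Proof. exact: gmakeE. Qed.

Lemma gstarD : {morph gstar : x y / x + y}.
Proof. by move=> x y; apply: galgP => g; rewrite gcoefD !gcoef_star gcoefD. Qed.

Lemma gstarN : {morph gstar : x / - x}.
Proof. by move=> x; apply: galgP => g; rewrite gcoefN !gcoef_star gcoefN. Qed.

Lemma gstarZ c x : gstar (c *: x) = c *: gstar x.
Proof. by apply: galgP => g; rewrite gcoefZ !gcoef_star gcoefZ. Qed.

Lemma gstarM x y : gstar (x * y) = gstar y * gstar x.
Proof.
apply: galgP => g; rewrite gcoef_star !gcoefM.
rewrite (reindex_inj (mulgI g^-1%g)) /=; apply: eq_bigr => h _.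
by rewrite !gcoef_star mulrC invMg !invgK mulgK invMg invgK.
Qed.

Lemma gstarK : involutive gstar.
Proof. by move=> x; apply: galgP => g; rewrite !gcoef_star invgK. Qed.

Lemma gstar0 : gstar 0 = 0.
Proof. by apply: galgP => g; rewrite gcoef_star !gcoef0. Qed.

Lemma gstar_gbasis g : gstar (gbasis g) = gbasis g^-1%g.
Proof.
apply: galgP => h; rewrite gcoef_star !gcoef_gbasis.
by rewrite -(inj_eq (@invg_inj _)) invgK.
Qed.

Lemma gstar1 : gstar 1 = 1.
Proof. by rewrite -gbasis1 gstar_gbasis invg1. Qed.

Lemma gstar_sum I (r : seq I) (P : pred I) (F : I -> galg K gT) :
  gstar (\sum_(i <- r | P i) F i) = \sum_(i <- r | P i) gstar (F i).
Proof. by apply: (big_morph gstar gstarD gstar0). Qed.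

Lemma gtau1 : gtau 1 = 1. Proof. by rewrite /gtau gcoef1 eqxx. Qed.
Lemma gtauZ c x : gtau (c *: x) = c * gtau x.
Proof. exact: gcoefZ. Qed.
Lemma gtau_sum I (r : seq I) (P : pred I) (F : I -> galg K gT) :
  gtau (\sum_(i <- r | P i) F i) = \sum_(i <- r | P i) gtau (F i).
Proof. exact: gcoef_sum. Qed.

Lemma gtauE x y : gtau (x * y) = \sum_g gcoef x g * gcoef y g^-1%g.
Proof. by rewrite /gtau gcoefM; apply: eq_bigr => g _; rewrite mulg1. Qed.

Lemma gtauC x y : gtau (x * y) = gtau (y * x).
Proof.
rewrite !gtauE (reindex_inj invg_inj); apply: eq_bigr => g _ /=.
by rewrite invgK mulrC.
Qed.

End GroupAlgebra.

Section RealGroupAlgebra.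
Variables (K : realFieldType) (gT : finGroupType).
Implicit Types (x y : galg K gT).

Lemma gtau_starM x : gtau (gstar x * x) = \sum_g gcoef x g ^+ 2.
Proof.
rewrite gtauC gtauE; apply: eq_bigr => g _.
by rewrite gcoef_star invgK expr2.
Qed.

Lemma gtau_starM_ge0 x : 0 <= gtau (gstar x * x).
Proof. by rewrite gtau_starM sumr_ge0 // => g _; rewrite sqr_ge0. Qed.

(** The identity coefficient of [gstar x * x] is the sum of the squares of the coefficients of x.
    This positivity replaces a Hilbert space structure in all that follows. *)
Lemma gstar_faithful x : gstar x * x = 0 -> x = 0.
Proof.
move=> /(congr1 (@gtau _ _)); rewrite gtau_starM /gtau gcoef0 => /eqP.
rewrite psumr_eq0 => [/allP xx|g _]; last exact: sqr_ge0.
apply: galgP => g; rewrite gcoef0; apply/eqP; rewrite -sqrf_eq0.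
exact: xx (mem_index_enum _).
Qed.

Lemma gsym_sqr0 x : gstar x = x -> x * x = 0 -> x = 0.
Proof. by move=> sx xx; apply: gstar_faithful; rewrite sx. Qed.

End RealGroupAlgebra.

Section GMap.
Variables (K K' : comNzRingType) (f : {rmorphism K -> K'}) (gT : finGroupType).

Definition gmap (x : galg K gT) : galg K' gT := gmake (fun g => f (gcoef x g)).

Lemma gcoef_map x g : gcoef (gmap x) g = f (gcoef x g).
Proof. exact: gmakeE. Qed.

Fact gmap_zmod : zmod_morphism gmap.
Proof.
move=> x y; apply: galgP => g; rewrite gcoefD gcoefN !gcoef_map gcoefD gcoefN.
exact: rmorphB.
Qed.
HB.instance Definition _ := GRing.isZmodMorphism.Build _ _ gmap gmap_zmod.

Fact gmap_monoid : monoid_morphism gmap.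
Proof.
split=> [|x y]; apply: galgP => g; rewrite gcoef_map.
  by rewrite !gcoef1 rmorph_nat.
rewrite !gcoefM rmorph_sum; apply: eq_bigr => h _.
by rewrite rmorphM !gcoef_map.
Qed.
HB.instance Definition _ := GRing.isMonoidMorphism.Build _ _ gmap gmap_monoid.

Lemma gmap_gbasis g : gmap (gbasis K g) = gbasis K' g.
Proof. by apply: galgP => h; rewrite gcoef_map !gcoef_gbasis rmorph_nat. Qed.

Lemma gmapZ c x : gmap (c *: x) = f c *: gmap x.
Proof. by apply: galgP => h; rewrite gcoef_map !gcoefZ rmorphM gcoef_map. Qed.

End GMap.

(** * Jucys-Murphy elements *)

Section Lagrange.
Variables (F : fieldType) (A : algType F).
Implicit Types (r : seq F) (c d : F) (x y v : A) (p : {poly F}).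

Lemma comm_horner_alg x y p : GRing.comm x y -> GRing.comm x (horner_alg y p).
Proof.
move=> xy; elim/poly_ind: p => [|p c IH]; first by rewrite rmorph0; exact: commr0.
rewrite rmorphD rmorphM /= horner_algX horner_algC; apply: commrD.
  exact: commrM.
by rewrite /GRing.comm -scalerAl -scalerAr mul1r mulr1.
Qed.

Lemma horner_alg_eigen x v c p : x * v = c *: v -> horner_alg x p * v = p.[c] *: v.
Proof.
move=> xv; elim/poly_ind: p => [|p d IH].
  by rewrite rmorph0 mul0r horner0 scale0r.
rewrite rmorphD rmorphM /= horner_algX horner_algC mulrDl -mulrA xv -scalerAr IH.
by rewrite hornerMXaddC scalerDl scalerA mulrC -scalerAl mul1r.
Qed.

Definition nodal r : {poly F} := \prod_(d <- r) ('X - d%:P).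

Definition lagrange r c : {poly F} := \prod_(d <- r | d != c) ((c - d)^-1 *: ('X
  - d%:P)).

Lemma lagrange_self r c : (lagrange r c).[c] = 1.
Proof.
rewrite /lagrange horner_prod big1 // => d dc; rewrite hornerZ hornerXsubC mulVf //.
by rewrite subr_eq0 eq_sym.
Qed.

Lemma lagrange_other r c d : d \in r -> d != c -> (lagrange r c).[d] = 0.
Proof.
move=> dr dc; rewrite /lagrange horner_prod (big_rem d) //= dc hornerZ hornerXsubC.
by rewrite subrr mulr0 mul0r.
Qed.

Lemma nodal_lagrange r c : uniq r -> c \in r ->
  exists k : F, ('X - c%:P) * lagrange r c = k *: nodal r.
Proof.
move=> ur cr; exists (\prod_(d <- r | d != c) (c - d)^-1).
rewrite /lagrange scaler_prod -scalerAr; congr (_ *: _).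
by rewrite /nodal (bigD1_seq c).
Qed.

Lemma size_lagrange r c : c \in r -> (size (lagrange r c) <= size r)%N.
Proof.
move=> cr; rewrite /lagrange scaler_prod.
apply: leq_trans (size_scale_leq _ _) _.
rewrite -big_filter size_prod_XsubC size_filter -(count_predC (pred1 c) r).
by rewrite -addn1 addnC leq_add2r -has_count has_pred1.
Qed.

(** The sum minus 1 vanishes on all of r, and its size is at most that of r, so it is 0. For empty r
    the sum is 0, whence the second alternative. *)
Lemma sum_lagrange r : uniq r -> \sum_(c <- r) lagrange r c = 1 \/ r = [::].
Proof.
case: r => [|c0 r]; first by right.
set s := c0 :: r => us; left.
apply/eqP; rewrite -subr_eq0; apply/negPn/negP => nz.
suff [sr sz] : all (root (\sum_(c <- s) lagrange s c - 1)) s /\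
    (size (\sum_(c <- s) lagrange s c - 1)%R <= size s)%N.
  by have := max_poly_roots nz sr us; rewrite ltnNge sz.
split.
  apply/allP => d ds; rewrite rootE !hornerE horner_sum (bigD1_seq d) //= lagrange_self.
  rewrite big1 ?addr0 ?subrr // => c cd; rewrite lagrange_other //; by rewrite eq_sym.
apply: leq_trans (size_polyD _ _) _; rewrite geq_max size_polyN size_poly1 /= andbT.
apply: (leq_trans (size_sum _ _ _)); apply/bigmax_leqP_seq => c cs _.
exact: size_lagrange.
Qed.

Lemma lagrange_eigen r x c : uniq r -> c \in r -> horner_alg x (nodal r) = 0 ->
  x * horner_alg x (lagrange r c) = c *: horner_alg x (lagrange r c).
Proof.
move=> ur cr x0; have [k] := nodal_lagrange ur cr.
move=> /(congr1 (horner_alg x)); rewrite linearZ /= x0 mulr0 rmorphM rmorphB /=.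
rewrite horner_algX horner_algC mulrBl -scalerAl mul1r => /eqP.
by rewrite subr_eq0 => /eqP.
Qed.

Lemma sum_lagrange_alg r x : uniq r -> horner_alg x (nodal r) = 0 ->
  \sum_(c <- r) horner_alg x (lagrange r c) = 1.
Proof.
move=> ur x0; case: (sum_lagrange ur) => [s1|r0].
  by rewrite -(rmorph1 (horner_alg x)) -s1 rmorph_sum.
(* For empty r the hypothesis reads 1 = 0. *)
by move: x0; rewrite r0 /nodal !big_nil rmorph1 => ->.
Qed.

End Lagrange.

Definition irange (n : nat) : seq int := [seq Posz i - Posz n | i <- iota 0 n.*2.+1].

Lemma mem_irange n c : (c \in irange n) = (`|c| <= n)%N.
Proof.
apply/mapP/idP => [[j + ->]|cn]; first by rewrite mem_iota; lia.
by exists (absz (c + Posz n)); rewrite ?mem_iota; lia.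
Qed.

Lemma irange_uniq n : uniq (irange n).
Proof. by rewrite map_inj_uniq ?iota_uniq // => i j; lia. Qed.

Section JucysMurphy.
Variables (K : comNzRingType) (N : nat).
Local Notation A := (galg K 'S_N.+1).
Local Notation o k := (inord k : 'I_N.+1).

(** [inord] sends indices beyond N to 0, so this is the Jucys-Murphy element only for k <= N. *)
Definition JM (k : nat) : A := \sum_(i < N.+1 | (i < k)%N) gbasis K (tperm i (o k)).

Definition adj_transp (k : nat) : A := gbasis K (tperm (o k) (o k.+1)).

Lemma JM0 : JM 0 = 0.
Proof. by rewrite /JM big_pred0. Qed.

Lemma gstar_JM k : gstar (JM k) = JM k.
Proof.
by rewrite gstar_sum; apply: eq_bigr => i _; rewrite gstar_gbasis tpermV.
Qed.

Lemma adj_star k : gstar (adj_transp k) = adj_transp k.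
Proof. by rewrite gstar_gbasis tpermV. Qed.

Lemma adjK k : adj_transp k * adj_transp k = 1.
Proof. by rewrite -gbasisM tperm2. Qed.

Lemma gbasis_conj (g h : 'S_N.+1) : gbasis K h * gbasis K g =
  gbasis K g * gbasis K (h ^ g)%g.
Proof. by rewrite -!gbasisM -conjgC. Qed.

(** Conjugation by such a g permutes the transpositions (i k) with i < k. *)
Lemma JM_comm (g : 'S_N.+1) k : g (o k) = o k ->
  (forall i, (g i < k)%N = (i < k)%N) -> JM k * gbasis K g = gbasis K g * JM k.
Proof.
move=> gk gi; rewrite /JM mulr_suml mulr_sumr.
rewrite [RHS](reindex_inj (@perm_inj _ g)) /=.
by apply: eq_big => [i|i ik]; rewrite ?gi // gbasis_conj tpermJ gk.
Qed.

Lemma JM_tperm_comm k (i j : 'I_N.+1) : (k <= N)%N -> (i < k)%N -> (j < k)%N ->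
  JM k * gbasis K (tperm i j) = gbasis K (tperm i j) * JM k.
Proof.
move=> kN ik jk; apply: JM_comm.
  by rewrite tpermD // -val_eqE /= inordK // neq_ltn ?ik ?jk.
by move=> l; case: tpermP => [->|->|//]; rewrite ik jk.
Qed.

Lemma JMC j k : (j <= N)%N -> (k <= N)%N -> JM j * JM k = JM k * JM j.
Proof.
wlog jk : j k / (j < k)%N => [W jN kN|jN kN].
  by case: (ltngtP j k) => [h|h|->//]; [|symmetry]; apply: W.
rewrite {1 3}/JM mulr_suml mulr_sumr; apply: eq_bigr => i ij.
by rewrite JM_tperm_comm ?inordK // (leq_trans _ jk) // ltnW.
Qed.

Lemma adj_JM_comm i k : (i < N)%N -> (k <= N)%N -> k != i -> k != i.+1 ->
  adj_transp i * JM k = JM k * adj_transp i.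
Proof.
move=> iN kN ki ki1; symmetry; apply: JM_comm.
  by rewrite tpermD // -val_eqE /= !inordK // 1?ltnW // eq_sym.
have i1 : val (o i) = i by rewrite /= inordK // ltnW.
have i2 : val (o i.+1) = i.+1 by rewrite /= inordK.
move=> l; case: tpermP => [->|->|//]; rewrite i1 i2; lia.
Qed.

(** This is s J_i s = J_(i+1) - s multiplied by s on the right: conjugation by s = (i i+1) turns (l
    i) into (l i+1), and the one term of J_(i+1) not obtained is s itself. *)
Lemma adj_JM i : (i < N)%N -> adj_transp i * JM i + 1 = JM i.+1 * adj_transp i.
Proof.
move=> iN; have i1 : val (o i) = i by rewrite /= inordK // ltnW.
rewrite {2}/JM (bigD1 (o i)) /=; last by rewrite i1.
rewrite mulrDl adjK addrC; congr (_ + _).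
rewrite /JM mulr_suml mulr_sumr; apply: eq_big => [l|l li].
  by rewrite -(inj_eq val_inj) i1 ltn_neqAle andbC.
rewrite [RHS]gbasis_conj tpermJ tpermR tpermD // -(inj_eq val_inj) /= ?i1 ?inordK
  //; lia.
Qed.

Lemma JM_adj i : (i < N)%N -> JM i * adj_transp i + 1 = adj_transp i * JM i.+1.
Proof.
move=> iN; have /(congr1 (fun x => adj_transp i * x * adj_transp i)) := adj_JM iN.
by rewrite mulrDr mulrDl mulr1 adjK !mulrA adjK mul1r -!mulrA adjK mulr1 => ->.
Qed.

Lemma adj_braid i : (i.+1 < N)%N ->
  adj_transp i * adj_transp i.+1 * adj_transp i =
    adj_transp i.+1 * adj_transp i * adj_transp i.+1.
Proof.
move=> iN; rewrite -!gbasisM; congr (gbasis K _).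
have E (x y z : 'I_N.+1) : x != y -> y != z -> z != x ->
    (tperm x y * tperm y z * tperm x y = tperm x z)%g.
  move=> xy yz zx; rewrite -{1}tpermV -mulgA -[(_^-1 * _)%g]/(conjg _ _) tpermJ.
  by rewrite tpermR tpermD // eq_sym.
have n1 : o i != o i.+1 by rewrite -val_eqE /= !inordK //; lia.
have n2 : o i.+1 != o i.+2 by rewrite -val_eqE /= !inordK //; lia.
have n3 : o i.+2 != o i by rewrite -val_eqE /= !inordK //; lia.
rewrite E // [tperm (o i) (o i.+1)]tpermC [tperm (o i.+1) (o i.+2)]tpermC E //.
- by rewrite tpermC.
- by rewrite eq_sym.
- by rewrite eq_sym.
by rewrite eq_sym.
Qed.

End JucysMurphy.

Lemma gmap_JM (K K' : comNzRingType) (f : {rmorphism K -> K'}) N k :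
  gmap f (JM K N k) = JM K' N k.
Proof. by rewrite /JM rmorph_sum; apply: eq_bigr => i _; exact: gmap_gbasis. Qed.

(** * Integrality of the spectra of the Jucys-Murphy elements *)

Section Spectrum.
Variables (K : realFieldType) (N : nat).
Local Notation A := (galg K 'S_N.+1).
Local Notation J := (JM K N).
Local Notation s_ := (adj_transp K N).
Implicit Types (x y v w : A) (c d : int) (a b : nat -> int).

Definition kint c : K := c%:~R.

Definition nodes k : seq K := map kint (irange k).

Lemma nodes_uniq k : uniq (nodes k).
Proof. by rewrite map_inj_uniq ?irange_uniq //; exact: intr_inj. Qed.

Lemma mem_nodes k c : (kint c \in nodes k) = (`|c| <= k)%N.
Proof. by rewrite mem_map ?mem_irange //; exact: intr_inj. Qed.

Lemma nodal_dvdp (r : seq K) (p : {poly K}) : uniq r ->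
  {in r, forall e, root p e} -> nodal r %| p.
Proof.
by move=> ur rp; apply: uniq_roots_dvdp; rewrite ?uniq_rootsE //; apply/allP.
Qed.

Lemma root_nodal (r : seq K) (d : K) : root (nodal r) d = (d \in r).
Proof. exact: root_prod_XsubC. Qed.

Lemma gstar_horner_alg x (p : {poly K}) : gstar x = x ->
  gstar (horner_alg x p) = horner_alg x p.
Proof.
move=> sx; elim/poly_ind: p => [|p c IH]; first by rewrite rmorph0 gstar0.
rewrite rmorphD rmorphM /= horner_algX horner_algC gstarD gstarM gstarZ gstar1 IH sx.
by congr (_ + _); apply: comm_horner_alg.
Qed.

(* The operator u |-> s (T - a) u - u carries T to J_k on the a-eigenspace of *)
(* J_k; where it vanishes, (T - a)^2 = 1.                                     *)
Lemma JM_step k (a : K) v : (k < N)%N -> horner_alg (J k) (nodal (nodes k)) = 0 ->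
    J k * v = a *: v ->
  horner_alg (J k.+1) ((('X - a%:P) ^+ 2 - 1) * nodal (nodes k)) * v = 0.
Proof.
move=> kN Jk0 Jv; set T := J k.+1; set s := s_ k; set m := nodal _.
have TJ : T * J k = J k * T by apply: JMC => //; exact: ltnW.
have TJp p : horner_alg T p * J k = J k * horner_alg T p.
  by symmetry; apply: comm_horner_alg.
have Jp p : J k * (horner_alg T p * v) = a *: (horner_alg T p * v).
  by rewrite mulrA -TJp -mulrA Jv -scalerAr.
pose Phi (u : A) : A := s * (T * u - a *: u) - u.
have PhiT (u : A) : J k * u = a *: u -> J k * Phi u = Phi (T * u).
  move=> Ju; have JTu : J k * (T * u) = a *: (T * u) by rewrite mulrA -TJ -mulrA
    Ju -scalerAr.
  have Jsw (w : A) : J k * (s * w) = s * (T * w) - w.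
    apply/eqP; rewrite eq_sym subr_eq; apply/eqP.
    by rewrite !mulrA -[X in _ = _ + X]mul1r -mulrDl (JM_adj K kN).
  rewrite /Phi [LHS]mulrBr Jsw Ju mulrBr -scalerAr.
  by rewrite opprB -!addrA; congr (_ + _); rewrite addrCA subrr addr0.
have Phip p : horner_alg (J k) p * Phi v = Phi (horner_alg T p * v).
  elim/poly_ind: p => [|p c IH].
    by rewrite !rmorph0 !mul0r /Phi mulr0 scaler0 subrr mulr0 subrr.
  have PhiD (u w : A) : Phi (u + w) = Phi u + Phi w.
    by rewrite /Phi (mulrDr T) scalerDr !opprD (addrACA (T * u)) (mulrDr s) addrACA.
  have PhiZ (e : K) (u : A) : Phi (e *: u) = e *: Phi u.
    by rewrite /Phi -scalerAr scalerA (mulrC a) -scalerA -scalerBr -scalerAr -scalerBr.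
  rewrite !rmorphD !rmorphM /= !horner_algX !horner_algC !mulrDl -!scalerAl !mul1r.
  rewrite PhiD PhiZ; congr (_ + _).
  have -> : horner_alg (J k) p * J k = J k * horner_alg (J k) p.
    by symmetry; apply: comm_horner_alg.
  have -> : horner_alg T p * T = T * horner_alg T p.
    by symmetry; apply: comm_horner_alg.
  by rewrite -!mulrA IH PhiT.
set u := horner_alg T m * v.
(* Since [m] annihilates J_k, [Phi] kills u = m(T) v, that is (T - a) u = s u; by [adj_JM] a second
   application of T - a gives u back. *)
have Phiu : Phi u = 0 by rewrite -Phip Jk0 mul0r.
have Ju : J k * u = a *: u by exact: Jp.
have su : T * u - a *: u = s * u.
  rewrite -[LHS]mul1r -(adjK K N k) -mulrA -/s; congr (_ * _).
  by apply/eqP; rewrite -subr_eq0; exact/eqP.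
rewrite rmorphM rmorphB rmorphXn rmorphB /= horner_algX horner_algC rmorph1.
have Ta (w : A) : (T - a%:A) * w = T * w - a *: w.
  by rewrite mulrBl -scalerAl mul1r.
rewrite -mulrA -/u mulrBl expr2 mul1r -mulrA !Ta su.
rewrite mulrA -(adj_JM K kN) mulrDl mul1r -mulrA Ju -scalerAr.
by rewrite addrAC addrK subrr.
Qed.

(** On the c-eigenspace of J_k, [JM_step] confines J_(k+1) to c - 1, c + 1 and the nodes of level k.
    These may coincide, so only the square of the nodal polynomial is known to vanish at J_(k+1); a
    self-adjoint element with square 0 is 0. *)
Lemma JM_nodal k : (k <= N)%N -> horner_alg (J k) (nodal (nodes k)) = 0.
Proof.
elim: k => [|k IH] kN.
  rewrite /nodes /irange /= /nodal big_seq1 rmorphB /= horner_algX horner_algC.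
  by rewrite JM0 subrr scale0r subrr.
have {}IH := IH (ltnW kN); set M := nodal _.
have sT : gstar (horner_alg (J k.+1) M) = horner_alg (J k.+1) M.
  by apply: gstar_horner_alg; exact: gstar_JM.
apply: gsym_sqr0 => //; rewrite -[LHS]mulr1 -(sum_lagrange_alg (nodes_uniq k) IH).
rewrite mulr_sumr big_seq big1 // => _ /mapP[c + ->]; rewrite mem_irange => ck.
have cn : kint c \in nodes k by rewrite mem_nodes.
have eig := lagrange_eigen (nodes_uniq k) cn IH.
have /dvdpP[q qE] : (('X - (kint c)%:P) ^+ 2 - 1) * nodal (nodes k) %| M * M.
  apply: dvdp_mul; last first.
    apply: nodal_dvdp; first exact: nodes_uniq.
    move=> _ /mapP[d + ->]; rewrite mem_irange => dk.
    by rewrite root_nodal mem_nodes leqW.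
  have -> : ('X - (kint c)%:P) ^+ 2 - 1 = nodal [:: kint (c - 1); kint (c + 1)].
    rewrite /nodal !big_cons big_nil mulr1 /kint intrB intrD -[1%:~R]/(1 : K).
    by rewrite polyCB polyCD; ring.
  apply: nodal_dvdp => [|e /=].
    rewrite /= inE andbT; apply/eqP => /intr_inj; lia.
  by rewrite !inE => /orP[] /eqP ->; rewrite root_nodal mem_nodes; lia.
by rewrite -rmorphM qE rmorphM -mulrA JM_step ?mulr0.
Qed.

End Spectrum.

(** * Projections onto joint eigenspaces *)

Definition swap (i : nat) (a : nat -> int) : nat -> int :=
  fun k => if k == i then a i.+1 else if k == i.+1 then a i else a k.

Section Projections.
Variables (K : realFieldType) (N : nat).
Local Notation A := (galg K 'S_N.+1).
Local Notation J := (JM K N).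
Local Notation s_ := (adj_transp K N).
Implicit Types (x y v w : A) (c d : int) (a b : nat -> int) (i j k m : nat).

Lemma JM_nodalN k : (k <= N)%N -> horner_alg (J k) (nodal (nodes K N)) = 0.
Proof.
move=> kN; have /dvdpP[q ->] : nodal (nodes K k) %| nodal (nodes K N).
  apply: nodal_dvdp; first exact: nodes_uniq.
  move=> e /mapP[d + ->]; rewrite mem_irange => dk.
  by rewrite root_nodal mem_nodes (leq_trans dk).
by rewrite rmorphM /= JM_nodal // mulr0.
Qed.

(* The test makes J_k * proj c k = c *: proj c k hold for all integers c. *)
Definition proj c k : A :=
  if (`|c| <= N)%N then horner_alg (J k) (lagrange (nodes K N) (kint K c)) else 0.

Lemma proj_eigen c k : (k <= N)%N -> J k * proj c k = kint K c *: proj c k.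
Proof.
move=> kN; rewrite /proj; case: ifP => [cN|_]; last by rewrite mulr0 scaler0.
by rewrite lagrange_eigen ?nodes_uniq ?mem_nodes // JM_nodalN.
Qed.

Lemma sum_proj k : (k <= N)%N -> \sum_(c <- irange N) proj c k = 1.
Proof.
move=> kN; rewrite -(sum_lagrange_alg (nodes_uniq K N) (JM_nodalN kN)).
rewrite [RHS]big_map; apply: eq_big_seq => c; rewrite mem_irange => cN.
by rewrite /proj cN.
Qed.

Lemma gstar_proj c k : gstar (proj c k) = proj c k.
Proof.
rewrite /proj; case: ifP => _; last exact: gstar0.
by apply: gstar_horner_alg; exact: gstar_JM.
Qed.

Lemma comm_proj x c k : GRing.comm x (J k) -> GRing.comm x (proj c k).
Proof.
move=> xJ; rewrite /proj; case: ifP => _; last exact: commr0.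
exact: comm_horner_alg.
Qed.

Lemma proj_comm c k d j : (j <= N)%N -> (k <= N)%N ->
  proj c k * proj d j = proj d j * proj c k.
Proof.
move=> jN kN; apply: comm_proj; apply: commr_sym; apply: comm_proj.
exact: JMC.
Qed.

Lemma proj_fix c k w : (`|c| <= N)%N -> J k * w = kint K c *: w -> proj c k * w = w.
Proof.
by move=> cN Jw; rewrite /proj cN (horner_alg_eigen _ Jw) lagrange_self scale1r.
Qed.

(** The factors commute, so the product is the projection onto the joint eigenspace of J_0, ...,
    J_(m-1). *)
Definition pathproj a m : A := \prod_(k < m) proj (a k) k.

Lemma pathprojS a m : pathproj a m.+1 = pathproj a m * proj (a m) m.
Proof. exact: big_ord_recr. Qed.

Lemma pathproj_eigen a m k : (m <= N.+1)%N -> (k < m)%N ->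
  J k * pathproj a m = kint K (a k) *: pathproj a m.
Proof.
elim: m => // m IH mN; rewrite ltnS leq_eqVlt pathprojS => /orP[/eqP ->|km].
  have -> : pathproj a m * proj (a m) m = proj (a m) m * pathproj a m.
    apply: commr_sym; apply: commr_prod => i _; apply: proj_comm => //.
    by rewrite -ltnS (leq_trans (ltn_ord i)) // ltnW.
  by rewrite mulrA proj_eigen // -scalerAl.
by rewrite mulrA IH ?(ltnW mN) // -scalerAl.
Qed.

Lemma gstar_pathproj a m : (m <= N.+1)%N -> gstar (pathproj a m) = pathproj a m.
Proof.
elim: m => [|m IH] mN; first by rewrite /pathproj big_ord0 gstar1.
rewrite pathprojS gstarM gstar_proj IH; last exact: ltnW.
apply: commr_prod => i _; apply: proj_comm => //.
by rewrite -ltnS (leq_trans (ltn_ord i)) // ltnW.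
Qed.

Lemma pathproj_fix a m w : (forall k, (k < m)%N -> (`|a k| <= N)%N) ->
  (forall k, (k < m)%N -> J k * w = kint K (a k) *: w) -> pathproj a m * w = w.
Proof.
elim: m => [|m IH] aN Jw; first by rewrite /pathproj big_ord0 mul1r.
rewrite pathprojS -mulrA proj_fix ?aN ?Jw // IH // => k km.
  by rewrite aN // ltnW.
by rewrite Jw // ltnW.
Qed.

Definition path_proj a := pathproj a N.+1.
Local Notation P := path_proj.

Lemma JM_path_proj a k : (k <= N)%N -> J k * P a = kint K (a k) *: P a.
Proof. by move=> kN; apply: pathproj_eigen. Qed.

Lemma gstar_path_proj a : gstar (P a) = P a.
Proof. exact: gstar_pathproj. Qed.

Lemma path_proj_JM a k : (k <= N)%N -> P a * J k = kint K (a k) *: P a.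
Proof.
move=> kN; apply: (can_inj (@gstarK _ _)).
by rewrite gstarM gstarZ gstar_path_proj gstar_JM JM_path_proj.
Qed.

Lemma path_proj_range a : P a != 0 -> forall k, (k < N.+1)%N -> (`|a k| <= N)%N.
Proof.
move=> Pa k kN; apply/negPn/negP => ak; move/eqP: Pa; apply.
suff H m : (k < m)%N -> pathproj a m = 0 by exact: H.
elim: m => // m IH; rewrite pathprojS ltnS leq_eqVlt => /orP[/eqP <-|/IH ->].
  by rewrite /proj (negbTE ak) mulr0.
by rewrite mul0r.
Qed.

Lemma path_proj_fix a w : P a != 0 -> (forall k, (k <= N)%N ->
  J k * w = kint K (a k) *: w) ->
  P a * w = w.
Proof. by move=> Pa Jw; apply: pathproj_fix => //; exact: path_proj_range. Qed.

Lemma path_proj_idem a : P a * P a = P a.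
Proof.
have [->|Pa] := eqVneq (P a) 0; first by rewrite mulr0.
by apply: path_proj_fix => // k; exact: JM_path_proj.
Qed.

Lemma path_proj_adj_JM a i : (i < N)%N ->
  kint K (a i) *: (P a * s_ i * P a) + P a = kint K (a i.+1) *: (P a * s_ i * P a).
Proof.
move=> iN; have /(congr1 (fun x => P a * x * P a)) := adj_JM K iN.
rewrite mulrDr mulrDl mulr1 path_proj_idem !mulrA path_proj_JM // -!mulrA
  JM_path_proj ?(ltnW iN) //.
by rewrite -!scalerAr -!scalerAl.
Qed.

(** Sandwiching [adj_JM] between two copies of P_a gives P_a = (a_(i+1) - a_i) P_a s_i P_a. *)
Lemma path_proj_eq0 a i : (i < N)%N -> a i = a i.+1 -> P a = 0.
Proof.
move=> iN ai; have := path_proj_adj_JM a iN; rewrite ai => /eqP.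
by rewrite -[X in _ == X]addr0 (inj_eq (addrI _)) => /eqP.
Qed.

Lemma path_proj_adjE a i : (i < N)%N ->
  P a = kint K (a i.+1 - a i) *: (P a * s_ i * P a).
Proof.
move=> iN; rewrite /kint intrB scalerBl -/(kint K _) -(path_proj_adj_JM a iN).
by rewrite addrC addKr.
Qed.

(** As d = 1 or -1, the sandwiched relation gives P s P = d P. Expanding, s P - d P times its
    adjoint is 0, and faithfulness applies. *)
Lemma adj_path_proj a i d : (i < N)%N -> a i.+1 = a i + d -> `|d| = 1 ->
  s_ i * P a = kint K d *: P a.
Proof.
move=> iN ad d1; apply/eqP; rewrite -subr_eq0; apply/eqP; apply: gstar_faithful.
have e2 : kint K d * kint K d = 1.
  rewrite /kint -intrM; have -> : d * d = 1 by lia.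
  by [].
have E : P a * s_ i * P a = kint K d *: P a.
  rewrite [in RHS](path_proj_adjE a iN) ad addrAC subrr add0r scalerA e2.
  by rewrite scale1r.
rewrite gstarD gstarN gstarZ gstarM adj_star gstar_path_proj mulrBl !mulrBr.
rewrite -scalerAl -scalerAr -scalerAl [P a * s_ i * (s_ i * _)]mulrA.
rewrite -[P a * s_ i * s_ i]mulrA adjK mulr1 path_proj_idem -scalerAr path_proj_idem E.
rewrite [P a * (s_ i * P a)]mulrA E !scalerA e2 scale1r.
by rewrite !subrr.
Qed.

(** The intertwiner of Young's orthogonal form: the correction of s_i P_a that makes it a joint
    eigenvector for the exchanged contents ([twist_eigen]). *)
Definition twist a i : A := s_ i * P a - (kint K (a i.+1 - a i))^-1 *: P a.

Lemma twist_eigen a i k : (i < N)%N -> (k <= N)%N -> a i != a i.+1 ->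
  J k * twist a i = kint K (swap i a k) *: twist a i.
Proof.
move=> iN kN ai; rewrite /twist /swap; set d := kint K _.
have d0 : d != 0 by rewrite /d /kint intr_eq0 subr_eq0 eq_sym.
have dE : d = kint K (a i.+1) - kint K (a i) by rewrite /d /kint intrB.
have cancel (x : K) (y : A) : d * x = 1 -> (d * x) *: y = y.
  by move=> ->; rewrite scale1r.
case: eqVneq => [->|ki].
  have -> : J i * (s_ i * P a - d^-1 *: P a) =
            s_ i * (J i.+1 * P a) - P a - d^-1 *: (J i * P a).
    rewrite mulrBr -scalerAr; congr (_ - _).
    by rewrite mulrA [in RHS]mulrA -(JM_adj K iN) mulrDl mul1r addrK.
  rewrite !JM_path_proj ?(ltnW iN) // -scalerAr -addrA -opprD scalerBr; congr (_ - _).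
  rewrite !scalerA -{1}[P a]scale1r -scalerDl; congr (_ *: _).
  by rewrite dE; field; rewrite -dE.
case: eqVneq => [->|ki1].
  have -> : J i.+1 * (s_ i * P a - d^-1 *: P a) =
            s_ i * (J i * P a) + P a - d^-1 *: (J i.+1 * P a).
    rewrite mulrBr -scalerAr; congr (_ - _).
    by rewrite mulrA -(adj_JM K iN) mulrDl mul1r mulrA.
  rewrite !JM_path_proj ?(ltnW iN) // -scalerAr -addrA scalerBr; congr (_ + _).
  rewrite !scalerA -{1}[P a]scale1r -scalerBl -scaleNr; congr (_ *: _).
  by rewrite dE; field; rewrite -dE.
rewrite mulrBr mulrA -adj_JM_comm // -mulrA -scalerAr JM_path_proj // scalerBr
  -scalerAr.
by rewrite !scalerA [_^-1 * _]mulrC.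
Qed.

Lemma twist_fix a i : (i < N)%N -> P a != 0 -> a i != a i.+1 ->
  P (swap i a) * twist a i = twist a i.
Proof.
move=> iN Pa ai; apply: pathproj_fix => k kN; last exact: twist_eigen.
have R := path_proj_range Pa; rewrite /swap; case: eqP => [_|_]; first exact: R.
by case: eqP => [_|_]; apply: R => //; rewrite ltnS ltnW.
Qed.

(** If the swapped projection vanished, so would [twist], whence s P_a = d^-1 P_a with d = a_(i+1) -
    a_i. Applying s again gives d^2 = 1, against |d| >= 2. *)
Lemma path_proj_swap a i : (i < N)%N -> P a != 0 -> (2 <= `|a i - a i.+1|)%N ->
  P (swap i a) != 0.
Proof.
move=> iN Pa ai2; apply/eqP => Ps0.
have ai : a i != a i.+1 by apply/eqP => E; move: ai2; rewrite E subrr.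
have w0 : twist a i = 0 by rewrite -(twist_fix iN Pa ai) Ps0 mul0r.
have := congr1 (fun x => s_ i * x) w0; rewrite /twist mulrBr mulrA adjK mul1r mulr0.
move/eqP; rewrite subr_eq0 -scalerAr; set d := kint K _ => /eqP E1.
have /eqP := w0; rewrite /twist subr_eq0 => /eqP E2.
move: E1; rewrite E2 scalerA => /eqP.
rewrite -{1}[P a]scale1r -subr_eq0 -scalerBl.
suff dn : 1 - d^-1 * d^-1 != 0.
  move=> /eqP /(congr1 (fun x => (1 - d^-1 * d^-1)^-1 *: x)).
  by rewrite scalerA mulVf // scale1r scaler0; exact/eqP.
have d0 : d != 0 by rewrite /d /kint intr_eq0; lia.
apply/eqP => /(congr1 (fun e : K => e * (d * d))).
rewrite mul0r mulrBl mul1r mulrACA mulVf // mul1r => /eqP.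
rewrite subr_eq0 /d /kint -intrM -[X in _ == X]/(1%:~R) eqr_int; nia.
Qed.

(** By [adj_path_proj], s_i acts on P_a by d and s_(i+1) by -d; the two sides of the braid relation
    then act by -d and d. *)
Lemma path_proj_braid a i d : (i.+1 < N)%N -> `|d| = 1 -> a i.+1 = a i + d ->
  a i.+2 = a i -> P a = 0.
Proof.
move=> iN d1 a1 a2.
have S1 := adj_path_proj (ltnW iN) a1 d1.
have S2 : s_ i.+1 * P a = kint K (- d) *: P a.
  by apply: adj_path_proj => //; [rewrite a2 a1 addrK|rewrite normrN].
have := congr1 (fun x => x * P a) (adj_braid K iN).
rewrite -!mulrA S1 -!scalerAr S2 -!scalerAr S1 -!scalerAr S2 !scalerA.
rewrite /kint -!intrM => /eqP; rewrite -subr_eq0 -scalerBl -intrB.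
rewrite scaler_eq0 intr_eq0 => /orP[|/eqP //]; lia.
Qed.

Lemma path_proj_start a : P a != 0 -> a 0%N = 0.
Proof.
move=> Pa; have := JM_path_proj a (leq0n N); rewrite JM0 mul0r => /eqP.
by rewrite eq_sym scaler_eq0 (negbTE Pa) orbF intr_eq0 => /eqP.
Qed.

Lemma gtau_path_proj_ge0 a : 0 <= gtau (P a).
Proof. by rewrite -path_proj_idem -{1}gstar_path_proj gtau_starM_ge0. Qed.

(** The shift by N indexes the sequences of length N + 1 with entries in [-N, N] by a finite
    type. *)
Definition content_seq (f : {ffun 'I_N.+1 -> 'I_N.*2.+1}) : nat -> int :=
  fun k => Posz (f (inord k)) - Posz N.

Lemma sum_path_proj : \sum_f P (content_seq f) = 1.
Proof.
transitivity (\prod_(k < N.+1) (\sum_(j < N.*2.+1) proj (Posz j - Posz N) k)).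
  rewrite bigA_distr_bigA; apply: eq_bigr => f _; apply: eq_bigr => k _.
  by rewrite /content_seq inord_val.
rewrite big1 // => k _.
rewrite -[RHS](sum_proj (k := k)) -1?ltnS // big_map.
rewrite -(big_mkord xpredT (fun j => proj (Posz j - Posz N) k)).
by rewrite /index_iota subn0.
Qed.

End Projections.

(** * Combinatorics of content sequences *)

Lemma swapL i a : swap i a i = a i.+1.
Proof. by rewrite /swap eqxx. Qed.

Lemma swapR i a : swap i a i.+1 = a i.
Proof. by rewrite /swap eqxx; case: eqP => // E; lia. Qed.

Lemma swap_out i a k : k != i -> k != i.+1 -> swap i a k = a k.
Proof. by rewrite /swap => /negbTE-> /negbTE->. Qed.

Definition content_count (a : nat -> int) (c : int) (m : nat) : nat :=
  (\sum_(k < m) (a k == c))%N.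

Lemma content_countS a c m : content_count a c m.+1 =
  (content_count a c m + (a m == c))%N.
Proof. exact: big_ord_recr. Qed.

Section ContentSequences.
Variables (n : nat) (S : (nat -> int) -> Prop).
(** The four hypotheses are what the relations above supply for S a := P_a <> 0 and n = N + 1; they
    are familiar properties of content vectors of standard tableaux. *)
Hypothesis S_neq : forall a i, S a -> (i.+1 < n)%N -> a i <> a i.+1.
Hypothesis S_swap : forall a i, S a -> (i.+1 < n)%N ->
  (2 <= `|a i - a i.+1|)%N -> S (swap i a).
Hypothesis S_braid : forall a i, S a -> (i.+2 < n)%N -> a i.+2 = a i ->
  `|a i.+1 - a i|%N = 1%N -> False.
Hypothesis S_start : forall a, S a -> a 0%N = 0.

(** Induction on j - i. An end that differs by at least 2 from its inner neighbour is swapped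
    inwards. Otherwise each inner neighbour is a_i + e, as wanted, or a_i - e. *)
Lemma S_between a i j (e : int) : S a -> `|e|%N = 1%N -> (i < j < n)%N -> a i = a j ->
  exists2 k, (i < k < j)%N & a k = a i + e.
Proof.
move=> Sa e1; have [m] := ubnP (j - i)%N.
elim: m a i j Sa => // m IH a i j Sa jim /andP[ij jn] aij.
have i1j : (i.+1 < j)%N.
  by rewrite ltn_neqAle ij andbT; apply/eqP => E; apply: (S_neq Sa (i := i)); rewrite E.
have [j' jE] : exists j', j = j'.+1 by case: (j) i1j => // j' _; exists j'.
subst j; rename j' into j.
have [E|/eqP nx] := eqVneq (a i.+1) (a i + e); first by exists i.+1 => //; lia.
have [E|/eqP ny] := eqVneq (a j) (a i + e); first by exists j => //; lia.
have [x2|x2] := leqP 2 `|a i - a i.+1|.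
  have [||||k /andP[k1 k2]] := IH (swap i a) i.+1 j.+1; rewrite ?swapR.
  - by apply: S_swap => //; lia.
  - by lia.
  - by lia.
  - by rewrite swap_out //; lia.
  by rewrite swap_out; [move=> E; exists k => //; lia|lia|lia].
have [y2|y2] := leqP 2 `|a j - a j.+1|.
  have [||||k /andP[k1 k2]] := IH (swap j a) i j; rewrite ?swapL.
  - by apply: S_swap.
  - by lia.
  - by lia.
  - by rewrite swap_out //; lia.
  by rewrite !swap_out; [move=> E; exists k => //; lia|lia|lia|lia|lia].
have xE : a i.+1 = a i - e.
  by have := S_neq Sa (i := i); lia.
have yE : a j = a i - e.
  by have := S_neq Sa (i := j); lia.
have [ji|ji] := leqP j i.+1.
  have jE : j = i.+1 by lia.
  by subst j; case: (S_braid Sa (i := i)) => //; lia.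
(* Both inner neighbours are a_i - e; between them a_i occurs again, at a position k to which the
   induction hypothesis applies together with i. *)
have [|||k /andP[k1 k2] kE] := IH a i.+1 j Sa; [lia|lia|lia|].
have [|||l /andP[l1 l2] lE] := IH a i k Sa; [lia|lia|lia|].
by exists l => //; lia.
Qed.

(** The entry is swapped leftwards past entries differing from it by at least 2. It cannot get to
    position 0, since this would force a_0 = a_1 = 0. *)
Lemma S_neighbour a q : S a -> (0 < q < n)%N ->
  exists2 k, (k < q)%N & `|a k - a q|%N = 1%N.
Proof.
elim: q a => // q IH a Sa /andP[_ qn].
have nq := S_neq Sa qn.
have [q2|q2] := leqP 2 `|a q - a q.+1|; last by exists q => //; lia.
have Ss := S_swap Sa qn q2.
case: (posnP q) => [q0|q0].
  have := S_start Ss; have := S_start Sa; subst q; rewrite swapL => a0 a1.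
  by move: nq; rewrite a0 a1.
have [|k kq] := IH _ Ss; first by rewrite q0 ltnW.
by rewrite swapL swap_out; [move=> E; exists k => //; lia|lia|lia].
Qed.

(** An earlier neighbour is either a_m - e, as wanted, or a_m + e. In the latter case the induction
    hypothesis, used twice, descends to a_m and then to a_m - e. *)
Lemma S_previous a m (e : int) : S a -> `|e|%N = 1%N -> (m < n)%N -> 0 < e * a m ->
  exists2 k, (k < m)%N & a k = a m - e.
Proof.
move=> Sa e1; elim/ltn_ind: m => m IH mn am.
have m0 : (0 < m)%N by rewrite lt0n; apply/eqP => E; move: am;
  rewrite E S_start // mulr0.
have [|k km kE] := @S_neighbour a m Sa; first by rewrite m0.
have [E|ne] := eqVneq (a k) (a m - e); first by exists k.
have {ne}kE : a k = a m + e by lia.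
have [||k' kk' E'] := IH k km; [lia|rewrite kE; nia|].
have [|||k'' kk'' E''] := IH k'; [lia|lia|rewrite E' kE; nia|].
by exists k''; [lia|rewrite E'' E' kE; lia].
Qed.

(* The contents c - e and c alternate along the sequence, starting with c - e. *)
Lemma S_interlace a (c e : int) m : S a -> `|e|%N = 1%N -> 0 < e * c -> (m <= n)%N ->
  (content_count a (c - e) m = content_count a c m /\
     forall k, (k < m)%N -> a k = c - e -> exists2 j, (k < j < m)%N & a j = c) \/
  (content_count a (c - e) m = (content_count a c m).+1 /\
     exists2 k, (k < m)%N & a k = c - e /\ forall j, (k < j < m)%N -> a j <> c).
Proof.
move=> Sa e1 ec; elim: m => [|m IH] mn; first by left; rewrite /content_count !big_ord0.
have {}IH := IH (ltnW mn).
have [am|am] := eqVneq (a m) c.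
  have cm : a m <> c - e by lia.
  case: IH => -[E H]; last first.
    left; rewrite !content_countS am eqxx; split; first by case: eqP; lia.
    move=> k; rewrite ltnS leq_eqVlt => /orP[/eqP -> //|km] _.
    by exists m => //; rewrite km ltnSn.
  exfalso; have [||k km kE] := S_previous Sa e1 (m := m); [lia|by rewrite am|].
  have {}kE : a k = c - e by lia.
  (* Each c - e at k is followed by a c at some j < m, and between j and m there is again a c - e,
     further right; m - k cannot decrease forever. *)
  have [l lE] := ubnP (m - k)%N; elim: l k lE km kE => // l IHl k lE km kE.
  have [j /andP[j1 j2] jE] := H k km kE.
  have [|||k' /andP[k1 k2] kE'] := @S_between a j m (- e) Sa; [lia|lia|lia|].
  by apply: (IHl k'); lia.
have [am'|am'] := eqVneq (a m) (c - e).
  rewrite !content_countS am' eqxx; have -> : (c - e == c) = false by apply/eqP; lia.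
  rewrite !addn0 addn1; case: IH => -[E H].
    by right; split; [lia|exists m => //; split=> // j; lia].
  (* Two entries c - e have a c between them, against the choice of k. *)
  exfalso; case: H => k km [kE H].
  have [|||j /andP[j1 j2] jE] := @S_between a k m e Sa; [lia|lia|lia|].
  by apply: (H j); lia.
rewrite !content_countS (negbTE am) (negbTE am') !addn0.
case: IH => -[E H]; [left|right]; split=> //.
  move=> k; rewrite ltnS leq_eqVlt => /orP[/eqP ->|km] kE.
    by rewrite kE eqxx in am'.
  by have [j jk jE] := H k km kE; exists j => //; lia.
case: H => k km [kE H]; exists k; first lia.
split=> // j /andP[kj]; rewrite ltnS leq_eqVlt => /orP[/eqP ->|jm].
  exact/eqP.
by apply: H; rewrite kj.
Qed.

(** Interlacing shows that the counts do not increase when moving away from 0 by one step. *)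
Lemma S_count_le a c : S a -> (content_count a c n <= content_count a 0 n)%N.
Proof.
move=> Sa; have [m] := ubnP `|c|; elim: m c => // m IH c cm.
have [->//|c0] := eqVneq c 0.
pose e : int := if 0 < c then 1 else -1.
have e1 : `|e|%N = 1%N by rewrite /e; case: ifP.
have ec : 0 < e * c by rewrite /e; case: ifP; lia.
have IHc : (content_count a (c - e) n <= content_count a 0 n)%N.
  by apply: IH; move: cm; rewrite /e; case: ifP; lia.
by case: (S_interlace Sa e1 ec (leqnn n)) => -[E _]; lia.
Qed.

Lemma S_count01 a : S a -> (content_count a 0 n <= (content_count a 1 n).+1)%N.
Proof.
move=> Sa; have := @S_interlace a 1 1 n Sa erefl isT (leqnn n).
by rewrite subrr => -[[-> _]|[-> _]].
Qed.

End ContentSequences.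

(** * Contents inside a block on which adjacent transpositions act by a sign *)

Section Blocks.
Variables (l r : nat) (e : int) (S : (nat -> int) -> Prop).
Hypothesis e1 : `|e|%N = 1%N.
Hypothesis S_neq : forall a i, S a -> (l <= i)%N -> (i.+1 < r)%N -> a i <> a i.+1.
Hypothesis S_swap : forall a i, S a -> (l <= i)%N -> (i.+1 < r)%N ->
  (2 <= `|a i - a i.+1|)%N -> S (swap i a).
Hypothesis S_step : forall a i, S a -> (l <= i)%N -> (i.+1 < r)%N ->
  a i.+1 <> a i - e.

(** Swaps that bring the two positions closer reduce the claim to adjacent positions, where [S_step]
    forbids it. The case that resists direct swapping is a_i - 2 e standing just before the final
    a_i - e. *)
Lemma block_no_step a i j : S a -> (l <= i)%N -> (i < j < r)%N -> a j <> a i - e.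
Proof.
have [m] := ubnP (j - i)%N; elim: m a i j => // m IH a i j jim Sa li /andP[ij jr] E.
have i1j : (i.+1 < j)%N.
  by rewrite ltn_neqAle ij andbT; apply/eqP => F; subst j; exact: S_step Sa li jr E.
have [j' jE] : exists j', j = j'.+1 by case: (j) i1j => // j' _; exists j'.
subst j; rename j' into j.
(* A low entry at p, at least two steps below b_i in the direction e, migrates left past entries
   that it differs from by at least 2, until it stands next to i and is exchanged with b_i; this
   shortens the distance. *)
suff H p : forall b, S b -> b j.+1 = b i - e -> (i < p <= j)%N ->
  e * (b p - b i) <= - 2 ->
    False.
  have [y2|y2] := leqP 2 `|a j - a j.+1|.
    have Ss := S_swap Sa (leq_trans li (ltnW i1j)) jr y2.
    apply: (IH _ i j _ Ss li); [lia|lia|].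
    by rewrite swapL swap_out; [lia|lia|lia].
  have yn : a j <> a j.+1 by apply: S_neq => //; lia.
  have yi : a j <> a i by move=> F; apply: (S_step Sa (i := j)); lia.
  have ye : a j = a i - 2%:Z * e by lia.
  by apply: (H j a Sa E); [lia|rewrite ye; nia].
elim: p => [//|p IHp] b Sb bE /andP[ip pj] bp.
have no k : (i < k < j.+1)%N -> b k <> b i - e /\ b k <> b i.
  move=> kij; split; first by apply: IH => //; lia.
  by move=> F; apply: (IH b k j.+1 _ Sb _ _ _); lia.
have [pi|pi] := eqVneq p i.
  subst p; have [b1 b2] := no i.+1 ltac:(lia).
  have [x2|x2] := leqP 2 `|b i - b i.+1|; last by nia.
  have Ss := S_swap Sb li ltac:(lia) x2.
  apply: (IH _ i.+1 j.+1 _ Ss); [lia|lia|lia|].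
  by rewrite swapR swap_out; [lia|lia|lia].
have [b1 b2] := no p ltac:(lia).
have [low|high] := leP (e * (b p - b i)) (- 2); first by apply: (IHp b) => //; lia.
have Ss : S (swap p b) by apply: S_swap => //; [lia|lia|nia].
by apply: (IHp _ Ss); rewrite ?swapL ?(@swap_out _ _ i) ?(@swap_out _ _ j.+1) //; lia.
Qed.

End Blocks.

(** * Products over the Jucys-Murphy elements *)

Section ContentCounts.
Variables (K : realFieldType) (N : nat).
Local Notation S := (fun a => path_proj K N a != 0).

Lemma path_proj_neq a i : path_proj K N a != 0 -> (i.+1 < N.+1)%N -> a i <> a i.+1.
Proof. by move=> Pa iN E; move: Pa; rewrite (@path_proj_eq0 K N a i iN E) eqxx. Qed.

Lemma path_proj_swapS a i : path_proj K N a != 0 -> (i.+1 < N.+1)%N ->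
  (2 <= `|a i - a i.+1|)%N ->
  path_proj K N (swap i a) != 0.
Proof. by move=> Pa iN; exact: path_proj_swap. Qed.

Lemma path_proj_no_braid a i : path_proj K N a != 0 -> (i.+2 < N.+1)%N ->
  a i.+2 = a i ->
  `|a i.+1 - a i|%N = 1%N -> False.
Proof.
move=> Pa iN a2 a1; have /eqP := Pa; apply.
by apply: (@path_proj_braid _ _ _ i (a i.+1 - a i)) => //; lia.
Qed.

Lemma path_count_le a c : path_proj K N a != 0 ->
  (content_count a c N.+1 <= content_count a 0 N.+1)%N.
Proof.
exact: (S_count_le path_proj_neq path_proj_swapS path_proj_no_braid
  (@path_proj_start K N)).
Qed.

Lemma path_count01 a : path_proj K N a != 0 ->
  (content_count a 0 N.+1 <= (content_count a 1 N.+1).+1)%N.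
Proof.
exact: (S_count01 path_proj_neq path_proj_swapS path_proj_no_braid
  (@path_proj_start K N)).
Qed.

End ContentCounts.

(** * Jucys' formula and traces of products of quadratics *)

Section JucysMurphyProducts.
Variables (K : comNzRingType) (N : nat).
Local Notation A := (galg K 'S_N.+1).
Local Notation J := (JM K N).
Implicit Types (g h : 'S_N.+1) (m : nat) (X : A).

Definition fixfrom m g : bool := [forall i : 'I_N.+1, (m <= i)%N ==> (g i == i)].

Lemma fixfromP m g :
  reflect (forall i : 'I_N.+1, (m <= i)%N -> g i = i) (fixfrom m g).
Proof.
apply: (iffP forallP) => H i; first by move=> mi; apply/eqP; have := H i; rewrite mi.
by apply/implyP => /H ->.
Qed.

Lemma fixfrom_max g : fixfrom N.+1 g.
Proof. by apply/fixfromP => i; rewrite leqNgt ltn_ord. Qed.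

Lemma fixfrom0 g : fixfrom 0 g = (g == 1%g).
Proof.
apply/fixfromP/eqP => [H|-> i _]; last by rewrite perm1.
by apply/permP => i; rewrite perm1 H.
Qed.

Lemma fixfromW m g : fixfrom m g -> fixfrom m.+1 g.
Proof. by move/fixfromP => H; apply/fixfromP => i mi; apply: H; exact: ltnW. Qed.

Lemma fixfrom_tpermM m g (i k : 'I_N.+1) : val k = m -> (i < m)%N ->
  fixfrom m (g * tperm i k) = fixfrom m.+1 g && (g k == i).
Proof.
move=> km im; have ik : i != k by rewrite -(inj_eq val_inj) km ltn_eqF.
apply/fixfromP/andP => [H|[/fixfromP H /eqP gk] j mj].
  split.
    apply/fixfromP => j mj; have := H j (ltnW mj); rewrite permM.
    move=> /(congr1 (tperm i k)); rewrite tpermK => ->.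
    by rewrite tpermD // -(inj_eq val_inj) ?km ltn_eqF // (ltn_trans im).
  have := H k; rewrite km leqnn permM => /(_ isT) /(congr1 (tperm i k)).
  by rewrite tpermK tpermR => ->.
rewrite permM; have [->|jk] := eqVneq j k; first by rewrite gk tpermL.
have mj' : (m < j)%N by rewrite ltn_neqAle mj andbT eq_sym -km (inj_eq val_inj).
by rewrite H // tpermD // -(inj_eq val_inj) ?km ltn_eqF // (ltn_trans im).
Qed.

Lemma gcoef_MJM X m h : gcoef (X * J m) h =
  \sum_(i < N.+1 | (i < m)%N) gcoef X (h * tperm i (inord m))%g.
Proof.
rewrite /JM mulr_sumr gcoef_sum; apply: eq_bigr => i _.
by rewrite gcoef_Mgbasis tpermV.
Qed.

(** X lies in the group algebra of S(m), seen inside that of S(N+1). *)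
Definition supported m X := forall g, ~~ fixfrom m g -> gcoef X g = 0.

Lemma supported_MJM m X : (m <= N)%N -> supported m.+1 X -> supported m.+1 (X * J m).
Proof.
move=> mN sX g ng; rewrite gcoef_MJM big1 // => i im; apply: sX.
apply: contra ng => /fixfromP H; apply/fixfromP => j mj.
have km : val (inord m : 'I_N.+1) = m by rewrite /= inordK.
have ijk : tperm i (inord m) j = j.
  by rewrite tpermD // -(inj_eq val_inj) ?km ltn_eqF // (ltn_trans im).
have := H j mj; rewrite permM => /(congr1 (tperm i (inord m))).
by rewrite tpermK ijk.
Qed.

Lemma supportedD m X Y : supported m X -> supported m Y -> supported m (X + Y).
Proof. by move=> sX sY g ng; rewrite gcoefD sX // sY // addr0. Qed.

Lemma supportedZ m c X : supported m X -> supported m (c *: X).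
Proof. by move=> sX g ng; rewrite gcoefZ sX // mulr0. Qed.

Lemma supportedW m X : supported m X -> supported m.+1 X.
Proof. by move=> sX g ng; apply: sX; apply: contra ng; exact: fixfromW. Qed.

Lemma gtau_MJM m X : (m <= N)%N -> supported m X -> gtau (X * J m) = 0.
Proof.
move=> mN sX; rewrite /gtau gcoef_MJM big1 // => i im; apply: sX.
have km : val (inord m : 'I_N.+1) = m by rewrite /= inordK.
rewrite (fixfrom_tpermM 1 km im) perm1 negb_and orbC.
by rewrite -(inj_eq val_inj) km gtn_eqF.
Qed.

Lemma card_ord_lt m : (m <= N.+1)%N -> #|[pred i : 'I_N.+1 | (i < m)%N]| = m.
Proof.
move=> mN; rewrite -sum1_card -(big_ord_widen N.+1 (fun=> 1%N) mN).
by rewrite sum1_card card_ord.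
Qed.

(** The conditional expectation of J_m^2 onto the group algebra of S(m) is m: the product (i m)(j m)
    lies in S(m) only for i = j. *)
Lemma gtau_MJM2 m X : (m <= N)%N -> supported m X ->
  gtau (X * J m * J m) = m%:R * gtau X.
Proof.
move=> mN sX; rewrite /gtau gcoef_MJM.
transitivity (\sum_(i < N.+1 | (i < m)%N) gcoef X 1%g); last first.
  by rewrite sumr_const card_ord_lt ?mulr_natl // ltnW.
have km : val (inord m : 'I_N.+1) = m by rewrite /= inordK.
apply: eq_bigr => i im; rewrite gcoef_MJM (bigD1 i) //= mul1g tperm2 big1 ?addr0 //.
move=> j /andP[jm ji]; apply: sX; rewrite (fixfrom_tpermM _ km jm).
by rewrite negb_and tpermR eq_sym ji orbT.
Qed.

Definition jmquad (p q : K) m : A := J m * J m + p *: J m + q%:A.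

Lemma supported_jmquad p q m : (m <= N.+1)%N ->
  supported m (\prod_(k < m) jmquad p q k).
Proof.
elim: m => [|m IH] mN.
  by rewrite big_ord0 => g; rewrite fixfrom0 gcoef1 => /negbTE ->.
rewrite big_ord_recr /= /jmquad !mulrDr -!scalerAr mulr1 mulrA.
have sX := supportedW (IH (ltnW mN)).
have sXJ := supported_MJM mN sX.
do 2?apply: supportedD; [|exact: supportedZ|exact: supportedZ].
exact: supported_MJM.
Qed.

(** Peeling off the last factor, J_k^2, J_k and 1 contribute k, 0 and 1 respectively. The linear
    coefficient drops out, which frees the choice of the comparison quadratics. *)
Lemma gtau_jmquad p q m : (m <= N.+1)%N ->
  gtau (\prod_(k < m) jmquad p q k) = \prod_(k < m) (q + k%:R).
Proof.
elim: m => [|m IH] mN; first by rewrite !big_ord0 gtau1.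
rewrite !big_ord_recr /= -(IH (ltnW mN)).
set X := \prod_(k < m) jmquad p q k.
have sX : supported m X by apply: supported_jmquad; exact: ltnW.
rewrite /jmquad !mulrDr -!scalerAr mulr1 mulrA.
rewrite {1}/gtau !gcoefD !gcoefZ -!/(gtau _) gtau_MJM2 // gtau_MJM // mulr0 addr0.
by rewrite addrC mulrC [m%:R * _]mulrC.
Qed.

Lemma porbit_fix g (i : 'I_N.+1) : g i = i -> porbit g i = [set i].
Proof.
move=> gi; apply/setP => j; rewrite inE; apply/porbitP/eqP => [[k ->]|->].
  by elim: k => [|k IH]; rewrite ?expg0 ?perm1 // expgSr permM IH.
by exists 0%N; rewrite expg0 perm1.
Qed.

Lemma fixfrom_porbits m g : fixfrom m g -> (N.+1 - m <= #|porbits g|)%N.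
Proof.
move/fixfromP => H; pose D := [set i : 'I_N.+1 | (m <= i)%N].
have -> : (N.+1 - m)%N = #|D|.
  have [mN|Nm] := leqP m N.+1; last first.
    rewrite (_ : D = finset.set0) ?cards0; first by apply/eqP; rewrite subn_eq0 ltnW.
    by apply/setP => i; rewrite !inE leqNgt (ltn_trans (ltn_ord i)).
  rewrite -{1}(card_ord N.+1) -(cardC [pred i : 'I_N.+1 | (i < m)%N]) card_ord_lt //.
  by rewrite addKn; apply: eq_card => i; rewrite !inE -leqNgt.
rewrite -(card_in_imset (f := porbit g)) => [|i j].
  by apply: subset_leq_card; apply/fintype.subsetP => _ /imsetP[i _ ->]; exact: imset_f.
by rewrite !inE => mi mj; rewrite !porbit_fix ?H // => /set1_inj.
Qed.

Lemma porbits_Mtperm m g (i k : 'I_N.+1) : val k = m -> (i < m)%N -> fixfrom m g ->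
  #|porbits g| = (#|porbits (g * tperm i k)|).+1.
Proof.
move=> km im /fixfromP gm; have := porbits_mul_tperm g^-1 i k.
have gk : (g^-1)%g k = k.
  by rewrite -{1}(gm k) ?km // permK.
have ik : i != k by rewrite -(inj_eq val_inj) km ltn_eqF.
rewrite /= porbit_fix // inE ik -[(tperm i k)]tpermV -invMg !porbitsV tpermV.
by rewrite addn1 addn2 => -[->].
Qed.

(** An h in S(m+1) either fixes m, a new cycle and a factor z, or is g (i m) for exactly one g in
    S(m) and i < m, where m joins an existing cycle. Cycles are counted in S(N+1), whence the
    subtraction of the N + 1 - m fixed points. *)
Lemma gcoef_prod_JM z m h : (m <= N.+1)%N ->
  gcoef (\prod_(k < m) (z%:A + J k)) h =
  if fixfrom m h then z ^+ (#|porbits h| - (N.+1 - m)) else 0.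
Proof.
elim: m h => [|m IH] h mN.
  rewrite big_ord0 gcoef1 fixfrom0 subn0; case: eqP => // ->.
  have := fixfrom_porbits (m := 0) (g := 1%g); rewrite fixfrom0 eqxx subn0 => /(_ isT).
  have : (#|porbits (1%g : 'S_N.+1)| <= N.+1)%N.
    by rewrite -[X in (_ <= X)%N]card_ord leq_imset_card.
  by move=> ? ?; have -> : (#|porbits (1%g : 'S_N.+1)| - N.+1 = 0)%N by lia.
have {}IH g := IH g (ltnW mN).
rewrite big_ord_recr /= mulrDr -scalerAr mulr1 gcoefD gcoefZ gcoef_MJM IH.
rewrite (eq_bigr _ (fun i _ => IH _)).
have km : val (inord m : 'I_N.+1) = m by rewrite /= inordK.
have [hm|hm] := boolP (fixfrom m h).
  rewrite fixfromW // -exprS big1 ?addr0.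
    congr (_ ^+ _); have := fixfrom_porbits hm.
    by rewrite subSS subSn // => lp; rewrite subnS prednK // subn_gt0.
  move=> i im; rewrite (fixfrom_tpermM _ km im).
  rewrite ((fixfromP _ _ hm) _ _) ?km // -(inj_eq val_inj) km gtn_eqF // andbF.
  by [].
rewrite mulr0 add0r; case: ifP => [hS|hS]; last first.
  by rewrite big1 // => i im; rewrite (fixfrom_tpermM _ km im) hS.
have lt_hk : (h (inord m) < m)%N.
  rewrite ltn_neqAle; apply/andP; split.
    apply: contra hm => /eqP E; apply/fixfromP => i; rewrite leq_eqVlt.
    case/orP => [/eqP mi|mi]; last exact: (fixfromP _ _ hS).
    have -> : i = inord m by apply: val_inj; rewrite km.
    by apply: val_inj; rewrite km /= E.
  rewrite leqNgt; apply/negP => E; have := fixfromP _ _ hS _ E.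
  by move/perm_inj => E'; move: E; rewrite E' km ltnn.
rewrite (bigD1 (h (inord m))) //= (fixfrom_tpermM _ km lt_hk) hS eqxx /=.
rewrite big1 ?addr0 => [|i /andP[im ih]]; last first.
  by rewrite (fixfrom_tpermM _ km im) eq_sym (negbTE ih) andbF.
congr (_ ^+ _); rewrite (porbits_Mtperm km lt_hk (g := (h * tperm _ _)%g)).
  by rewrite -mulgA tperm2 mulg1 [(N.+1 - m)%N]subSn // !subSS.
by rewrite (fixfrom_tpermM _ km lt_hk) hS eqxx.
Qed.

(** Jucys' formula: it converts the powers of z in chi_z into contents. *)
Lemma prod_JM z : \prod_(k < N.+1) (z%:A + J k) =
  gmake (fun h => z ^+ #|porbits h|).
Proof.
apply: galgP => h; rewrite gcoef_prod_JM // fixfrom_max subnn subn0.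
by rewrite gmakeE.
Qed.

End JucysMurphyProducts.

(** * The Durfee projections *)

Lemma eq_content_count_swap (a b : nat -> int) c n i : (i.+1 < n)%N ->
  (forall k, (k < n)%N -> k != i -> k != i.+1 -> b k = a k) ->
  (b i = a i /\ b i.+1 = a i.+1) \/ (b i = a i.+1 /\ b i.+1 = a i) ->
  content_count b c n = content_count a c n.
Proof.
move=> + + ab; elim: n => // n IH; rewrite ltnS leq_eqVlt => /orP[/eqP <-|iN] E.
  have Ei : content_count b c i = content_count a c i.
    by apply: eq_bigr => k _; have ki := ltn_ord k; rewrite E //; lia.
  by rewrite !content_countS Ei; case: ab => -[-> ->] //; rewrite addnAC.
rewrite !content_countS E; [|lia|lia|lia]; rewrite IH // => k kn.
by apply: E; exact: ltnW.
Qed.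

Section Central.
Variables (K : realFieldType) (N : nat).
Local Notation A := (galg K 'S_N.+1).
Local Notation J := (JM K N).
Local Notation s_ := (adj_transp K N).
Local Notation P := (path_proj K N).
Implicit Types (a b : nat -> int) (i k m : nat).

(** s_i commutes with J_i + J_(i+1), with J_i J_(i+1) and with the other J_k; so a and b agree up to
    exchanging the entries i and i + 1. *)
Lemma path_proj_adj_count a b i c : (i < N)%N -> P b * s_ i * P a != 0 ->
  content_count b c N.+1 = content_count a c N.+1.
Proof.
move=> iN nz.
have transfer (x y : A) (u v : K) : s_ i * x = y * s_ i -> x * P a = u *: P a ->
    P b * y = v *: P b -> u = v.
  move=> xy xa yb; apply/eqP; rewrite -subr_eq0.
  have /eqP : P b * (s_ i * x) * P a = P b * (y * s_ i) * P a by rewrite xy.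
  rewrite mulrA -mulrA xa mulrA yb -scalerAr -!scalerAl -subr_eq0 -scalerBl.
  by rewrite scaler_eq0 (negbTE nz) orbF.
have kint_inj (u v : int) : kint K u = kint K v -> u = v by exact: intr_inj.
have i0 : (i <= N)%N by exact: ltnW.
have sJ1 : s_ i * J i = J i.+1 * s_ i - 1 by rewrite -(adj_JM K iN) addrK.
have sJ2 : s_ i * J i.+1 = J i * s_ i + 1 by rewrite (JM_adj K iN).
have sum : a i + a i.+1 = b i + b i.+1.
  apply: kint_inj; apply: (transfer (J i + J i.+1) (J i + J i.+1)).
  - by rewrite mulrDr sJ1 sJ2 addrACA addNr addr0 addrC -mulrDl.
  - by rewrite mulrDl !JM_path_proj // /kint intrD scalerDl.
  by rewrite mulrDr !path_proj_JM // /kint intrD scalerDl.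
have prod : a i * a i.+1 = b i * b i.+1.
  apply: kint_inj; apply: (transfer (J i * J i.+1) (J i * J i.+1)).
  - rewrite mulrA sJ1 mulrBl mul1r -mulrA sJ2 mulrDr mulr1 addrK mulrA.
    by rewrite (JMC K (j := i)).
  - by rewrite -mulrA JM_path_proj // -scalerAr JM_path_proj // scalerA mulrC
    /kint intrM.
  by rewrite mulrA path_proj_JM // -scalerAl path_proj_JM // scalerA /kint intrM.
apply: (@eq_content_count_swap _ _ _ _ i) => // [k kN ki ki1|].
  symmetry; apply: kint_inj; apply: (transfer (J k) (J k)).
  - by rewrite adj_JM_comm.
  - by rewrite JM_path_proj.
  by rewrite path_proj_JM.
have : (b i - a i) * (b i - a i.+1) = 0.
  have -> : (b i - a i) * (b i - a i.+1) =
    b i * b i - b i * (a i + a i.+1) + a i * a i.+1 by ring.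
  by rewrite sum prod; ring.
move=> /eqP; rewrite mulf_eq0 !subr_eq0 => /orP[] /eqP E; [left|right]; split=> //; lia.
Qed.

(* The number of zero contents is the size of the Durfee square. *)
Definition durfee_gt (D : nat) : A :=
  \sum_(f | (D < content_count (content_seq (N := N) f) 0 N.+1)%N) P (content_seq f).

Lemma gstar_durfee D : gstar (durfee_gt D) = durfee_gt D.
Proof. by rewrite gstar_sum; apply: eq_bigr => f _; exact: gstar_path_proj. Qed.

(** s_i connects only content vectors with equally many zeros, so s Z = Z s Z, and the right-hand
    side is self-adjoint. *)
Lemma durfee_adj D i : (i < N)%N -> s_ i * durfee_gt D = durfee_gt D * s_ i.
Proof.
move=> iN; set Z := durfee_gt D.
have sZ : s_ i * Z = Z * s_ i * Z.
  rewrite -[LHS]mul1r -(sum_path_proj K N) mulr_suml /Z {2}/durfee_gt !mulr_suml.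
  rewrite (bigID (fun f => (D < content_count (content_seq (N := N) f) 0 N.+1)%N)) /=.
  rewrite [X in _ + X]big1 ?addr0 => [|f nf]; first by apply: eq_bigr => f _;
    rewrite mulrA.
  rewrite mulrA /durfee_gt mulr_sumr big1 // => h hh; apply/eqP/negPn/negP.
  by move=> /(path_proj_adj_count 0 iN) E; rewrite E hh in nf.
rewrite sZ; apply: (can_inj (@gstarK _ _)).
by rewrite !gstarM adj_star gstar_durfee mulrA sZ.
Qed.

(** Conjugation carries the commutation from adjacent transpositions to all transpositions, and
    these generate. *)
Lemma durfee_central D g : gbasis K g * durfee_gt D = durfee_gt D * gbasis K g.
Proof.
set Z := durfee_gt D.
have CM (x y : 'S_N.+1) : gbasis K x * Z = Z * gbasis K x ->
  gbasis K y * Z = Z * gbasis K y ->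
    gbasis K (x * y)%g * Z = Z * gbasis K (x * y)%g.
  by move=> cx cy; rewrite gbasisM -mulrA cy mulrA cx -mulrA.
have C1 : gbasis K (1%g : 'S_N.+1) * Z = Z * gbasis K 1%g by rewrite gbasis1
  mul1r mulr1.
have Cadj m : (m < N)%N -> gbasis K (tperm (inord m : 'I_N.+1) (inord m.+1)) * Z =
    Z * gbasis K (tperm (inord m) (inord m.+1)) by exact: durfee_adj.
have Clt (i : nat) d : (i + d.+1 <= N)%N ->
    gbasis K (tperm (inord i : 'I_N.+1) (inord (i + d.+1))) * Z =
    Z * gbasis K (tperm (inord i) (inord (i + d.+1))).
  elim: d => [|d IH] iN; first by rewrite addn1; apply: (Cadj); lia.
  have -> : tperm (inord i : 'I_N.+1) (inord (i + d.+2)) =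
      (tperm (inord (i + d.+1)) (inord (i + d.+1).+1) * (tperm (inord i) (inord
        (i + d.+1))
       * tperm (inord (i + d.+1)) (inord (i + d.+1).+1)))%g.
    rewrite -[X in (X * _)%g]tpermV -[RHS]/(conjg _ _) tpermJ tpermL -addnS.
    by rewrite tpermD // -(inj_eq val_inj) /= !inordK //; lia.
  by apply: (CM); [apply: (Cadj); lia|apply: (CM); [apply: IH; lia|apply: (Cadj); lia]].
have Ct (i j : 'I_N.+1) : gbasis K (tperm i j) * Z = Z * gbasis K (tperm i j).
  wlog ij : i j / (i < j)%N => [W|].
    case: (ltngtP i j) => [|ji|/val_inj ->]; [exact: W|rewrite tpermC; exact: W|].
    by rewrite tperm1.
  have := @Clt i (j - i).-1; rewrite prednK ?subn_gt0 // subnKC ?(ltnW ij) //.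
  by rewrite !inord_val; apply; rewrite -ltnS.
have [ts -> _] := prod_tpermP g.
elim: ts => [|t ts IH]; first by rewrite big_nil.
by rewrite big_cons; apply: (CM).
Qed.

End Central.

(** * Words and characters of their stabilizers *)

Section PermSign.
Variable T : finType.
Implicit Types (s g : {perm T}) (B : {set T}).

Lemma porbits_partition s : finset.partition (porbits s) [set: T].
Proof.
rewrite /porbits.
have -> : [set porbit s x | x in T] = equivalence_partition (fun x y =>
  porbit s x == porbit s y) [set: T].
  apply/setP => A; apply/imsetP/imsetP => -[x _ ->]; exists x => //.
    by apply/setP => y; rewrite !inE eq_porbit_mem porbit_sym.
  by apply/setP => y; rewrite !inE eq_porbit_mem porbit_sym.
apply: equivalence_partitionP => x y z _ _ _; split=> // /eqP -> //.
Qed.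

Lemma porbits_gt0 s A : A \in porbits s -> (0 < #|A|)%N.
Proof. by move=> /imsetP[x _ ->]; rewrite lt0n card_porbit_neq0. Qed.

Lemma prod_porbits (R : comNzRingType) s (F : T -> R) :
  \prod_x F x = \prod_(A in porbits s) \prod_(x in A) F x.
Proof.
rewrite -finset.big_trivIset /=; last by case/and3P: (porbits_partition s).
rewrite (finset.cover_partition (porbits_partition s)).
by apply: eq_bigl => x; rewrite inE.
Qed.

Lemma sign_porbits (R : comNzRingType) s :
  (-1) ^+ odd_perm s = \prod_(A in porbits s) (-1) ^+ #|A|.-1 :> R.
Proof.
rewrite prodrXr -[RHS]signr_odd; congr (_ ^+ (nat_of_bool _)).
have E : (\sum_(A in porbits s) #|A|.-1 + #|porbits s|)%N = #|T|.
  rewrite -sum1_card -big_split /= -cardsT (finset.card_partition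
    (porbits_partition s)).
  by apply: eq_bigr => A As; rewrite addn1 prednK // (porbits_gt0 As).
by rewrite /odd_perm -E oddD addbK.
Qed.

Lemma restr_perm_porbit g B x : g \in 'N(B | 'P)%g -> x \in B ->
  porbit (restr_perm B g) x = porbit g x.
Proof.
move=> gB xB.
have E k : ((restr_perm B g ^+ k) x = (g ^+ k) x)%g /\ ((g ^+ k) x)%g \in B.
  elim: k => [|k [IH1 IH2]]; first by rewrite !expg0 !perm1.
  rewrite !expgSr !permM IH1 restr_permE //; split=> //.
  by rewrite -[g _]/('P%act ((g ^+ k)%g x) g) (astabs_act _ gB).
apply/setP => y; apply/porbitP/porbitP => -[k ->]; exists k; first by case: (E k).
by case: (E k) => ->.
Qed.

Lemma sign_restr_perm (R : comNzRingType) g B (c : {set T} -> bool) :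
  g \in 'N(B | 'P)%g -> (forall x, c (porbit g x) = (x \in B)) ->
  (-1) ^+ odd_perm (restr_perm B g) =
    \prod_(A in porbits g) (if c A then (-1) ^+ #|A|.-1 else 1) :> R.
Proof.
move=> gB cB; rewrite sign_porbits; set s := restr_perm B g.
rewrite (bigID (fun A : {set T} => ~~ [disjoint A & B])) /= mulrC big1 ?mul1r.
  rewrite -big_mkcondr; apply: eq_bigl => A; apply/andP/andP => -[].
    move=> /imsetP[x _ ->] /pred0Pn[y /= /andP[yx yB]].
    have <- : porbit s y = porbit s x by apply/eqP; rewrite eq_porbit_mem.
    by rewrite (restr_perm_porbit gB yB) cB imset_f.
  move=> /imsetP[x _ ->]; rewrite cB => xB; rewrite -(restr_perm_porbit gB xB).
  split; first exact: imset_f.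
  by apply/pred0Pn; exists x; rewrite /= porbit_id xB.
move=> A /andP[/imsetP[x _ ->]]; rewrite negbK => /pred0P dx.
have xB : x \notin B by have := dx x; rewrite /= porbit_id => /= ->.
suff -> : porbit s x = [set x] by rewrite cards1.
have sx : s x = x by exact: out_perm (restr_perm_on _ _) xB.
apply/setP => j; rewrite inE; apply/porbitP/eqP => [[k ->]|->].
  by elim: k => [|k IH]; rewrite ?expg0 ?perm1 // expgSr permM IH.
by exists 0%N; rewrite expg0 perm1.
Qed.

End PermSign.

Section Words.
Variables (K : realFieldType) (N : nat) (L : finType) (isb isg : pred L).
Local Notation A := (galg K 'S_N.+1).
Local Notation word := {ffun 'I_N.+1 -> L}.
Implicit Types (w : word) (g h : 'S_N.+1).

(* Letters satisfying [isb] carry the sign character, and occurrences of a   *)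
(* letter satisfying [isg] are not permuted at all.                           *)
Definition wstab w g : bool :=
  [forall i, (w (g i) == w i) && (isg (w i) ==> (g i == i))].

Lemma wstabP w g : reflect (forall i, w (g i) = w i /\ (isg (w i) ->
  g i = i)) (wstab w g).
Proof.
apply: (iffP forallP) => H i.
  by have /andP[/eqP ? /implyP E] := H i; split=> // /E/eqP.
by have [-> E] := H i; rewrite eqxx; apply/implyP => /E ->.
Qed.

Definition bset w := [set i | isb (w i)].
Definition wsign w g : K := (-1) ^+ odd_perm (restr_perm (bset w) g).
(** Up to the order of the stabilizer of w, the projection attached to its character that is the
    sign on the [isb] positions; pairing with it under [gtau] gives a multiple of an induced
    character. *)
Definition wchar w : A := gmake (fun g => if wstab w g then wsign w g else 0).

Lemma wstab1 w : wstab w 1%g.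
Proof. by apply/wstabP => i; rewrite perm1. Qed.

Lemma wstabM w g h : wstab w g -> wstab w h -> wstab w (g * h).
Proof.
move=> /wstabP Hg /wstabP Hh; apply/wstabP => i; rewrite permM.
have [g1 g2] := Hg i; have [h1 h2] := Hh (g i); rewrite h1 g1; split=> // wi.
by rewrite h2 ?g1 ?g2.
Qed.

Lemma wstabV w g : wstab w g -> wstab w g^-1.
Proof.
move=> /wstabP Hg; apply/wstabP => i; have [] := Hg (g^-1%g i); rewrite permKV => -> E.
by split=> // wi; exact: esym (E wi).
Qed.

Lemma wstab_bset w g : wstab w g -> g \in 'N(bset w | 'P)%g.
Proof.
move=> /wstabP Hg; apply/astabsP => i; rewrite !inE.
by case: (Hg i) => + _; rewrite /= apermE => ->.
Qed.

Lemma wsignM w g h : wstab w g -> wstab w h -> wsign w (g * h) = wsign w g * wsign w h.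
Proof.
move=> /wstab_bset gw /wstab_bset hw.
by rewrite /wsign (morphM (restr_perm_morphism _)) //= odd_permM signr_addb.
Qed.

Lemma wsign1 w : wsign w 1%g = 1.
Proof. by rewrite /wsign (morph1 (restr_perm_morphism _)) odd_perm1. Qed.

Lemma wsign_sqr w g : wsign w g * wsign w g = 1.
Proof. by rewrite /wsign -signr_addb addbb. Qed.

Lemma wsignV w g : wstab w g -> wsign w g^-1%g = wsign w g.
Proof.
move=> gw; rewrite -[LHS]mulr1 -(wsign_sqr w g) mulrA.
by rewrite -wsignM ?wstabV // mulVg wsign1 mul1r.
Qed.

Lemma wstab_V w g : wstab w g^-1 = wstab w g.
Proof. by apply/idP/idP => /wstabV //; rewrite invgK. Qed.

Lemma gcoef_wchar w g : gcoef (wchar w) g = if wstab w g then wsign w g else 0.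
Proof. exact: gmakeE. Qed.

Lemma gstar_wchar w : gstar (wchar w) = wchar w.
Proof.
apply: galgP => g; rewrite gcoef_star !gcoef_wchar wstab_V.
by case: ifP => // gw; rewrite wsignV.
Qed.

Lemma gbasis_wchar w g : wstab w g -> gbasis K g * wchar w = wsign w g *: wchar w.
Proof.
move=> gw; apply: galgP => h; rewrite gcoef_gbasisM gcoefZ !gcoef_wchar.
have -> : wstab w (g^-1 * h) = wstab w h.
  apply/idP/idP => hw; last by apply: wstabM => //; exact: wstabV.
  by rewrite -(mulKVg g h); exact: wstabM.
case: ifP => hw; last by rewrite mulr0.
by rewrite wsignM ?wstabV // wsignV.
Qed.

Lemma wchar_sqr w : wchar w * wchar w = #|[set g | wstab w g]|%:R *: wchar w.
Proof.
rewrite {1}(gexpand (wchar w)) mulr_suml (bigID (wstab w)) /=.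
rewrite [X in _ + X]big1 ?addr0 => [|g /negbTE gw]; last first.
  by rewrite gcoef_wchar gw scale0r mul0r.
rewrite (eq_bigr (fun=> wchar w)) => [|g gw].
  rewrite sumr_const scaler_nat; congr (_ *+ _).
  by apply: eq_card => g; rewrite !inE.
by rewrite -scalerAl gbasis_wchar // gcoef_wchar gw scalerA wsign_sqr scale1r.
Qed.

(** W = [wchar w] is self-adjoint with W W = c W and c > 0, so c times the value is the trace of the
    adjoint of y W times y W. *)
Lemma wchar_state_ge0 w (y : A) : 0 <= gtau (gstar y * y * wchar w).
Proof.
set c := #|[set g | wstab w g]|%:R : K.
have c0 : 0 < c.
  by rewrite ltr0n card_gt0; apply/set0Pn; exists 1%g; rewrite inE wstab1.
have E : c * gtau (gstar y * y * wchar w) = gtau (gstar (y * wchar w) * (y * wchar w)).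
  rewrite gstarM gstar_wchar -!mulrA [RHS]gtauC -!mulrA wchar_sqr.
  by rewrite -!scalerAr gtauZ.
by rewrite -(pmulr_rge0 _ c0) E gtau_starM_ge0.
Qed.

Section WordSum.
Variables (x : L -> K) (l0 : L).

Definition letter (k : nat) (l : L) : K :=
  if (k == 1%N) || ~~ isg l then (if isb l then (-1) ^+ k.-1 else 1) * x l ^+ k else 0.

(** Only words constant on the cycles of g contribute. They are colourings of the cycles by letters,
    and the sign and the weight multiply over cycles, so the sum factors. *)
Lemma word_sum g : \sum_(w : word) (\prod_i x (w i)) * gcoef (wchar w) g =
  \prod_(B in porbits g) \sum_l letter #|B| l.
Proof.
rewrite (big_distr_big_dep l0) /=.
pose const (w : word) := [forall i, w (g i) == w i].
rewrite (bigID const) /= [X in _ + X]big1 ?addr0 => [|w nw]; last first.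
  rewrite gcoef_wchar; case: ifP => [/wstabP gw|]; last by rewrite mulr0.
  by case/negP: nw; apply/forallP => i; case: (gw i) => ->.
(* [h] and [h'] translate between colourings of cycles and words; l0 is the default colour of sets
   that are not cycles. *)
pose h (f : {ffun {set 'I_N.+1} -> L}) : word := [ffun i => f (porbit g i)].
pose h' (w : word) : {ffun {set 'I_N.+1} -> L} := [ffun B : {set 'I_N.+1} =>
  if B \in porbits g then if [pick i in B] is Some i then w i else l0 else l0].
have constE (w : word) i k : const w -> w ((g ^+ k)%g i) = w i.
  move=> /forallP cw; elim: k => [|k IH]; first by rewrite expg0 perm1.
  by rewrite expgSr permM (eqP (cw _)).
have porbit_g i : porbit g (g i) = porbit g i by exact: (porbit_perm g 1 i).
rewrite (reindex_onto h h') => [|w cw]; last first.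
  apply/ffunP => i; rewrite !ffunE imset_f //.
  case: pickP => [j /porbitP[k ->]|/(_ i)]; first exact: constE.
  by rewrite porbit_id.
apply: eq_big => [f|f /andP[_ /eqP hf]].
  apply/andP/pfamilyP => [[cf /eqP hf]|[sf _]]; split=> //.
  - apply/fintype.subsetP => B; apply: contraR => nB; rewrite !unfold_in /= in nB *.
    by rewrite -hf ffunE; move: nB; rewrite unfold_in /= => /negbTE ->; rewrite eqxx.
  - by apply/forallP => i; rewrite !ffunE porbit_g.
  apply/eqP/ffunP => B; rewrite ffunE; case: ifPn => [|nB]; last first.
    have := fintype.subsetP sf B; rewrite !inE (negbTE nB) => /contraFF; move/(_ erefl).
    by move=> /negbFE/eqP.
  move=> /imsetP[i _ ->]; case: pickP => [j|/(_ i)]; last by rewrite porbit_id.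
  by rewrite -eq_porbit_mem ffunE => /eqP ->.
rewrite (prod_porbits g) gcoef_wchar.
have prodE : \prod_(B in porbits g) \prod_(i in B) x (h f i) =
             \prod_(B in porbits g) x (f B) ^+ #|B|.
  apply: eq_bigr => B /imsetP[j _ ->]; rewrite -prodr_const; apply: eq_bigr => i.
  by rewrite -eq_porbit_mem ffunE => /eqP ->.
have wE : wstab (h f) g = [forall B in porbits g, isg (f B) ==> (#|B| == 1%N)].
  apply/wstabP/forall_inP => H.
    move=> _ /imsetP[i _ ->]; apply/implyP => fi.
    case: (H i); rewrite !ffunE => _ /(_ fi) gi.
    by rewrite porbit_fix // cards1.
  move=> i; rewrite !ffunE porbit_g; split=> // fi.
  have /H : porbit g i \in porbits g by exact: imset_f.
  rewrite fi => /cards1P[j E].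
  have := porbit_id g i; have := mem_porbit g 1 i.
  by rewrite E !inE expg1 => /eqP -> /eqP.
rewrite wE prodE; case: ifPn => [/forall_inP H|].
  have gw : wstab (h f) g by rewrite wE; apply/forall_inP.
  rewrite /wsign (@sign_restr_perm _ _ g _ (fun B => isb (f B)) (wstab_bset gw)).
    rewrite -big_split /=; apply: eq_bigr => B Bg; rewrite /letter mulrC.
    by have /implyP := H B Bg; case: (isg (f B)) => /= [->|_]; rewrite ?orbT.
  by move=> i; rewrite inE ffunE.
rewrite negb_forall_in => /exists_inP[B Bg]; rewrite negb_imply => /andP[fB B1].
by rewrite mulr0 (bigD1 B) //= /letter (negbTE B1) fB /= mul0r.
Qed.

End WordSum.

Definition contiguous w := forall i j k : 'I_N.+1, (i <= k <= j)%N ->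
  w i = w j -> w k = w i.

Lemma word_sort w : exists h, contiguous [ffun i => w (h i)].
Proof.
pose t := [tuple (enum_rank (w i) : nat) | i < N.+1].
have /tuple_permP[h hE] : perm_eq (sort leq t) t by rewrite perm_sort.
have srt : sorted leq (sort leq t) by apply: sort_sorted; exact: leq_total.
have rk (i : 'I_N.+1) : nth 0%N (sort leq t) i = enum_rank (w (h i)).
  rewrite hE (nth_map i) ?size_enum_ord // nth_ord_enum.
  by rewrite tnth_mktuple.
have mono (i j : 'I_N.+1) : (i <= j)%N -> (enum_rank (w (h i)) <=
  enum_rank (w (h j)))%N.
  move=> ij; rewrite -!rk; apply: (sorted_leq_nth leq_trans leqnn) => //;
  by rewrite inE size_sort size_tuple.
exists h => i j k /andP[/mono ik /mono kj]; rewrite !ffunE => E.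
by apply/enum_rank_inj/val_inj/eqP; rewrite eqn_leq ik andbT E.
Qed.

Lemma wchar_perm w h : wchar [ffun i => w (h i)] =
  gbasis K h * wchar w * gbasis K h^-1%g.
Proof.
apply: galgP => g; rewrite gcoef_Mgbasis gcoef_gbasisM !gcoef_wchar invgK.
have gJ : (h^-1 * (g * h) = g ^ h)%g by [].
have stE : wstab [ffun i => w (h i)] g = wstab w (g ^ h).
  apply/wstabP/wstabP => H i.
    have := H (h^-1%g i); rewrite !ffunE permKV -[in w (h _)]permJ permKV => -[-> E].
    by split=> // wi; rewrite -{1}(permKV h i) permJ E // permKV.
  have := H (h i); rewrite !ffunE permJ => -[-> E].
  by split=> // /E/perm_inj.
rewrite gJ stE; case: ifP => // gh; rewrite /wsign -(odd_permJ (restr_perm _ g) h).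
congr (_ ^+ (nat_of_bool (odd_perm _))); apply/permP => i.
have gB := wstab_bset gh; have gB' : g \in 'N(bset [ffun i => w (h i)] | 'P)%g.
  by apply: wstab_bset; rewrite stE.
rewrite -(permKV h i) permJ; set j := h^-1%g i.
have hj : (h j \in bset w) = (j \in bset [ffun i => w (h i)]) by rewrite !inE ffunE.
have [jB|jB] := boolP (j \in bset [ffun i => w (h i)]).
  by rewrite !restr_permE ?hj // permJ.
by rewrite !(out_perm (restr_perm_on _ _)) ?hj.
Qed.

Lemma wstab_tperm w (i j : 'I_N.+1) : w i = w j -> ~~ isg (w i) -> wstab w (tperm i j).
Proof.
move=> wij nw; apply/wstabP => k; case: tpermP => [->|->|//].
  by rewrite wij; split=> // wj; rewrite wij wj in nw.
by rewrite -wij; split=> // wi; rewrite wi in nw.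
Qed.

Lemma wsign_tperm w (i j : 'I_N.+1) : i != j -> w i = w j -> ~~ isg (w i) ->
  wsign w (tperm i j) = if isb (w i) then -1 else 1.
Proof.
move=> ij wij nw; have tB := wstab_bset (wstab_tperm wij nw); rewrite /wsign.
case: ifP => wb.
  have -> : restr_perm (bset w) (tperm i j) = tperm i j.
    apply/permP => k; have [kB|kB] := boolP (k \in bset w);
      first by rewrite restr_permE.
    rewrite (out_perm (restr_perm_on _ _) kB) tpermD //; apply: contraNneq kB => <-.
      by rewrite inE wb.
    by rewrite inE -wij wb.
  by rewrite odd_tperm ij expr1.
have -> : restr_perm (bset w) (tperm i j) = 1%g; last by rewrite odd_perm1.
apply/permP => k; rewrite perm1; have [kB|kB] := boolP (k \in bset w).
  rewrite restr_permE // tpermD //; apply: contraTneq kB => <-.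
    by rewrite inE wb.
  by rewrite inE -wij wb.
by rewrite (out_perm (restr_perm_on _ _) kB).
Qed.

Section ContiguousWord.
Variable w : word.
Hypothesis wc : contiguous w.
Hypothesis wg : forall i, ~~ isg (w i).
Local Notation S := (fun a => path_proj K N a * wchar w != 0).

Lemma wchar_path_neq0 a : path_proj K N a * wchar w != 0 -> path_proj K N a != 0.
Proof. by apply: contra => /eqP ->; rewrite mul0r. Qed.

Lemma adj_wchar i (e : int) : (i < N)%N -> w (inord i) = w (inord i.+1) ->
  e = (if isb (w (inord i)) then -1 else 1) ->
    adj_transp K N i * wchar w = kint K e *: wchar w.
Proof.
move=> iN wi ->; rewrite gbasis_wchar ?wstab_tperm // wsign_tperm //.
  by case: ifP.
by rewrite -(inj_eq val_inj) /= !inordK //; [rewrite ltn_eqF|exact: ltnW].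
Qed.

(** If the swapped projection killed W = [wchar w], so would the adjoint of [twist]. But this
    product is (e - 1/d) P_a W with d = a_(i+1) - a_i, and e = 1/d fails for |d| >= 2. *)
Lemma wchar_path_swap a i (e : int) : `|e|%N = 1%N -> (i < N)%N ->
  adj_transp K N i * wchar w = kint K e *: wchar w ->
  path_proj K N a * wchar w != 0 -> (2 <= `|a i - a i.+1|)%N ->
    path_proj K N (swap i a) * wchar w != 0.
Proof.
move=> e1 iN se nz a2; have Pa := wchar_path_neq0 nz; apply: contra nz => /eqP Ps0.
have ai : a i != a i.+1 by apply/eqP => E; move: a2; rewrite E subrr.
have := twist_fix iN Pa ai; move=> /(congr1 (fun x => gstar x * wchar w)).
rewrite gstarM gstar_path_proj -[_ * _ * wchar w]mulrA Ps0 mulr0 /twist.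
rewrite gstarD gstarN gstarZ gstarM adj_star gstar_path_proj mulrBl -mulrA se -scalerAr.
rewrite -scalerAl -scalerBl => /esym/eqP; rewrite scaler_eq0 => /orP[|//].
rewrite subr_eq0 => /eqP E; exfalso.
have d0 : kint K (a i.+1 - a i) != 0 by rewrite /kint intr_eq0 subr_eq0 eq_sym.
have := mulfV d0; rewrite -E /kint -intrM -[X in _ = X]/(1%:~R) => /intr_inj; nia.
Qed.

(** Otherwise s_i would act by -e on P_a and by e on W, so P_a s_i W = 0. *)
Lemma wchar_path_step a i (e : int) : `|e|%N = 1%N -> (i < N)%N ->
  adj_transp K N i * wchar w = kint K e *: wchar w ->
  path_proj K N a * wchar w != 0 -> a i.+1 <> a i - e.
Proof.
move=> e1 iN se nz ai; have e1' : `|- e| = 1 by lia.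
have := adj_path_proj K iN ai e1' => /(congr1 (fun x => gstar x * wchar w)).
rewrite gstarM gstarZ adj_star gstar_path_proj -mulrA se -scalerAr -scalerAl => /eqP.
rewrite -subr_eq0 -scalerBl scaler_eq0 (negbTE nz) orbF /kint -intrB intr_eq0.
by move/eqP; lia.
Qed.

(** Two zero contents under the same letter lie in one block. [S_between] puts the content -e
    between them, which [block_no_step] excludes; so zeros carry distinct letters. *)
Lemma wchar_path_count a : path_proj K N a * wchar w != 0 ->
  (content_count a 0 N.+1 <= #|[set w i | i in 'I_N.+1]|)%N.
Proof.
move=> nz; have Pa := wchar_path_neq0 nz.
have -> : content_count a 0 N.+1 = #|[set i : 'I_N.+1 | a i == 0]|.
  rewrite -sum1_card /content_count big_mkcond [RHS]big_mkcond /=.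
  by apply: eq_bigr => i _; rewrite inE; case: (a i == 0).
rewrite -(card_in_imset (f := w)) => [|i j].
  by apply: subset_leq_card; apply/fintype.subsetP => _ /imsetP[i _ ->]; exact: imset_f.
rewrite !inE => /eqP ai /eqP aj wij.
wlog ij : i j ai aj wij / (i < j)%N => [W|].
  case: (ltngtP i j) => [|ji|/val_inj //]; first exact: W.
  by symmetry; apply: W.
pose e : int := if isb (w i) then -1 else 1.
have e1 : `|e|%N = 1%N by rewrite /e; case: ifP.
have se k : (i <= k)%N -> (k.+1 < j.+1)%N -> (k < N)%N /\
    adj_transp K N k * wchar w = kint K e *: wchar w.
  move=> ik kj; have kN : (k < N)%N by rewrite -ltnS (leq_trans _ (ltn_ord j)).
  have w1 : w (inord k) = w i.
    by apply: (wc (j := j)) => //; rewrite inordK ?ik /=; lia.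
  have w2 : w (inord k.+1) = w i.
    by apply: (wc (j := j)) => //; rewrite inordK; lia.
  by split=> //; apply: adj_wchar; rewrite ?w1 ?w2.
exfalso; have [|||k /andP[ik kj]] := @S_between N.+1 (fun a => path_proj K N a != 0)
  (@path_proj_neq K N) (@path_proj_swapS K N) (@path_proj_no_braid K N) a i j (- e) Pa.
- by lia.
- by rewrite ij ltn_ord.
- by rewrite ai aj.
apply: (@block_no_step i j.+1 e S e1) => //; last lia.
- move=> b l Sb il lj; have [lN _] := se l il lj.
  by apply: path_proj_neq (wchar_path_neq0 Sb) _; rewrite ltnS.
- by move=> b l Sb il lj b2; have [lN sl] := se l il lj;
  exact: (wchar_path_swap e1 lN sl Sb b2).
by move=> b l Sb il lj; have [lN sl] := se l il lj;
  exact: (wchar_path_step e1 lN sl Sb).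
Qed.

End ContiguousWord.

(** The Durfee element is central, so the trace is unchanged when the word is sorted; then
    [wchar_path_count] kills every term. *)
Lemma durfee_wchar w D : (forall i, ~~ isg (w i)) ->
  (#|[set w i | i in 'I_N.+1]| <= D)%N -> gtau (durfee_gt K N D * wchar w) = 0.
Proof.
move=> wg wD; have [h hc] := word_sort w; set w' := finfun _ in hc.
have -> : gtau (durfee_gt K N D * wchar w) = gtau (durfee_gt K N D * wchar w').
  rewrite wchar_perm !mulrA -durfee_central -!mulrA [RHS]gtauC -!mulrA -gbasisM.
  by rewrite mulVg gbasis1 mulr1.
rewrite mulr_suml gtau_sum big1 // => f fD.
suff -> : path_proj K N (content_seq f) * wchar w' = 0 by exact: gcoef0.
apply/eqP/negPn/negP => nz; have := wchar_path_count hc _ nz.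
have -> : [set w' i | i in 'I_N.+1] = [set w i | i in 'I_N.+1].
  apply/setP => l; apply/imsetP/imsetP => -[i _ ->].
    by exists (h i) => //; rewrite ffunE.
  by exists (h^-1%g i) => //; rewrite ffunE permKV.
move=> H; have : (content_count (content_seq f) 0 N.+1 <= D)%N.
  by apply: leq_trans wD; apply: H => i; rewrite ffunE.
by rewrite leqNgt fD.
Qed.

End Words.

(** * Estimates for products over contents *)

Section ContentSums.
Variable R : realType.
Implicit Types (c : int) (a : nat -> int).

Definition lorentz c : R := (1 + c%:~R ^+ 2)^-1.

Lemma lorentz_ge0 c : 0 <= lorentz c.
Proof. by rewrite invr_ge0 addr_ge0 // sqr_ge0. Qed.

(** A bounded function whose increments dominate [lorentz] up to the factor 3, so that sums of
    [lorentz] telescope. *)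
Definition slope c : R := c%:~R / (1 + `|c|%:~R).

Lemma slope_bound c : -1 <= slope c <= 1.
Proof.
have c0 : 0 <= `|c%:~R| :> R by [].
rewrite /slope intr_norm; have d0 : 0 < 1 + `|c%:~R| :> R by lra.
rewrite ler_pdivlMr // ler_pdivrMr // mulN1r mul1r.
have := ler_norm (c%:~R : R); have := ler_norm (- c%:~R : R); rewrite normrN; lra.
Qed.

Lemma lorentz_slope c : lorentz c <= 3 * (slope c - slope (c - 1)).
Proof.
have l0 (u : R) : 0 < 1 + u ^+ 2 by rewrite ltr_pwDl // sqr_ge0.
rewrite /lorentz /slope; case: (leP c 0) => c0.
  have [d ->] : exists d : nat, c = - d%:Z by exists `|c|%N; lia.
  have -> : (`|- d%:Z|%R = d%:Z) by lia.
  have -> : (`|- d%:Z - 1|%R = d%:Z + 1) by lia.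
  rewrite intrB intrD !intrN -!pmulrn; set u : R := d%:R.
  have u0 : 0 <= u by rewrite ler0n.
  (* This is (1 + u)(u + 2) <= 3 (1 + u^2), which holds at natural numbers but not strictly between
     1/2 and 1. *)
  have u1 : 0 <= (2 * u - 1) * (u - 1).
    rewrite /u; case: (d) => [|e]; first by lra.
    have : 0 <= e%:R :> R by [].
    by rewrite -natr1; nra.
  have -> : 3 * (- u / (1 + u) - (- u - 1) / (1 + (u + 1))) = 3 / ((1 + u) * (u + 2)).
    by field; apply/andP; split; apply: lt0r_neq0; rewrite -/u; lra.
  rewrite sqrrN -[X in X <= _]mul1r ler_pdivrMr // mulrAC ler_pdivlMr; last by nra.
  nra.
have [d ->] : exists d : nat, c = d%:Z + 1 by exists `|c - 1|%N; lia.
have -> : (`|d%:Z + 1|%R = d%:Z + 1) by lia.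
rewrite addrK; have -> : (`|d%:Z|%R = d%:Z) by lia.
rewrite intrD -!pmulrn; set u : R := d%:R.
have u0 : 0 <= u by rewrite ler0n.
have -> : 3 * ((u + 1) / (1 + (u + 1)) - u / (1 + u)) = 3 / ((1 + u) * (u + 2)).
  by field; apply/andP; split; apply: lt0r_neq0; rewrite -/u; lra.
rewrite -[X in X <= _]mul1r ler_pdivrMr // mulrAC ler_pdivlMr; last by nra.
nra.
Qed.

Lemma sum_lorentz n : \sum_(c <- irange n) lorentz c <= 6.
Proof.
rewrite big_map -[X in iota 0 X]subn0 -/(index_iota 0 n.*2.+1).
have le6 : 3 * (slope (n.*2.+1%:Z - n%:Z - 1) - slope (0%:Z - n%:Z - 1)) <= 6.
  have := slope_bound (n.*2.+1%:Z - n%:Z - 1); have := slope_bound (0%:Z - n%:Z - 1).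
  lra.
apply: le_trans le6.
rewrite -(telescope_sumr (fun j => slope (j%:Z - n%:Z - 1)) (leq0n _)) mulr_sumr.
apply: ler_sum => j _; have := lorentz_slope (j%:Z - n%:Z).
by rewrite -(_ : j.+1%:Z - n%:Z - 1 = j%:Z - n%:Z) //; lia.
Qed.

Lemma sum_content_count (r : seq int) (F : int -> R) a m : uniq r ->
  (forall k, (k < m)%N -> a k \in r) ->
  \sum_(k < m) F (a k) = \sum_(c <- r) (content_count a c m)%:R * F c.
Proof.
move=> ur ar; rewrite (eq_bigr (fun k : 'I_m => \sum_(c <- r) (a k == c)%:R * F c)).
  rewrite exchange_big /=; apply: eq_bigr => c _.
  by rewrite /content_count natr_sum mulr_suml.
move=> k _; rewrite (bigD1_seq (a k)) ?ar //= eqxx mul1r big1 ?addr0 // => c ca.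
by rewrite eq_sym (negbTE ca) mul0r.
Qed.

(** No content occurs more often than 0, and [lorentz] sums to at most 6 over the integers. *)
Lemma sum_lorentz_path N a : path_proj R N a != 0 ->
  \sum_(k < N.+1) lorentz (a k) <= 6 * (content_count a 0 N.+1)%:R.
Proof.
move=> Pa; rewrite (@sum_content_count (irange N)) ?irange_uniq // => [|k kN].
  have : \sum_(c <- irange N) (content_count a c N.+1)%:R * lorentz c <=
         \sum_(c <- irange N) (content_count a 0 N.+1)%:R * lorentz c.
    apply: ler_sum => c _; rewrite ler_wpM2r ?lorentz_ge0 // ler_nat.
    exact: path_count_le Pa.
  move=> /le_trans; apply; rewrite -mulr_sumr mulrC ler_wpM2r //.
  exact: sum_lorentz.
by rewrite mem_irange (path_proj_range Pa).
Qed.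

(** |z + c|^2 with x = Re z and s = (Im z)^2; [nonint] below says that z is not an integer. *)
Definition content_factor (x s : R) c : R := (c%:~R + x) ^+ 2 + s.

Definition nonint (x s : R) : Prop := 0 <= s /\ (s = 0 -> forall m : int, x <> m%:~R).

Lemma content_factor_lower x s : nonint x s ->
  exists2 k : R, 0 < k & forall c, k * (1 + c%:~R ^+ 2) <= content_factor x s c.
Proof.
move=> [s0 xZ].
have [m m0 mle] : exists2 m : R, 0 < m & forall c, m <= content_factor x s c.
  have [s00|s00] := eqVneq s 0; last first.
    by exists s; [lra|move=> c; rewrite /content_factor lerDr sqr_ge0].
  have /andP[f1 f2] := floor_itv x; set f := Num.floor x in f1 f2.
  have {}f2 : x < f%:~R + 1 by move: f2; rewrite intrD.
  have f1' : f%:~R < x by rewrite lt_neqAle f1 andbT; apply/eqP => /esym; exact: xZ.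
  pose u := x - f%:~R; have u0 : 0 < u by rewrite /u; lra.
  have u1 : 0 < 1 - u by rewrite /u; lra.
  (* For real z, the squared distance from x to the nearest integer. *)
  exists (Num.min u (1 - u) ^+ 2) => [|c].
    by rewrite exprn_gt0 // lt_min u0.
  have mu : Num.min u (1 - u) <= u /\ Num.min u (1 - u) <= 1 - u.
    by rewrite !ge_min !lexx orbT.
  have mp : 0 < Num.min u (1 - u) by rewrite lt_min u0.
  rewrite /content_factor s00 addr0; have -> : c%:~R + x =
    (c + f)%:~R + u by rewrite intrD /u; lra.
  case: (lerP 0 (c + f)) => cf.
    have : 0 <= (c + f)%:~R :> R by rewrite ler0z.
    by move: (_%:~R) => v v0; nra.
  have : (c + f)%:~R <= (-1)%:~R :> R by rewrite ler_int; lia.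
  by rewrite intrN; move: (_%:~R) => v v0; nra.
have g0 : 0 < 2 + (1 + 2 * x ^+ 2) / m.
  by rewrite ltr_pwDl // divr_ge0 ?(ltW m0) // addr_ge0 // mulr_ge0 // sqr_ge0.
(* From c^2 <= 2 (c + x)^2 + 2 x^2 and from m bounding the factor below. *)
exists (2 + (1 + 2 * x ^+ 2) / m)^-1 => [|c]; first by rewrite invr_gt0.
rewrite mulrC ler_pdivrMr // mulrDr.
have E : 1 + 2 * x ^+ 2 <= content_factor x s c * ((1 + 2 * x ^+ 2) / m).
  rewrite mulrA ler_pdivlMr // mulrC ler_wpM2r ?mle //.
  by rewrite addr_ge0 // mulr_ge0 // sqr_ge0.
set w := _ * (_ / m) in E *; have := sqr_ge0 (c%:~R + 2 * x).
by rewrite /content_factor; move: w E => w E; nra.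
Qed.

Lemma content_factor_gt0 x s c : nonint x s -> 0 < content_factor x s c.
Proof.
move=> /content_factor_lower[k k0 kle]; apply: lt_le_trans (kle c).
by rewrite mulr_gt0 // ltr_pwDl // sqr_ge0.
Qed.

Lemma content_factor_quad x s c : content_factor x s c =
  c%:~R ^+ 2 + 2 * x * c%:~R + (x ^+ 2 + s).
Proof. by rewrite /content_factor; ring. Qed.

Definition quad (p q : R) c : R := c%:~R ^+ 2 + p * c%:~R + q.

Lemma exp_lorentz_path (e : R) N a : 0 <= e -> path_proj R N a != 0 ->
  \prod_(k < N.+1) expR (e * lorentz (a k)) <= expR (6 * e) ^+ content_count a 0 N.+1.
Proof.
move=> e0 Pa; rewrite -expR_sum -expRM_natr ler_expR -mulr_sumr.
by rewrite -mulrA mulrCA ler_wpM2l // sum_lorentz_path.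
Qed.

(** Each factor exceeds Q by the constant d, while Q >= d (1 + c^2); so the ratio is at most
    exp(lorentz c), and the product at most exp(6 N_0). *)
Lemma face_estimate x s : nonint x s ->
  exists p q : R, [/\ 0 < q < x ^+ 2 + s, forall c, 0 < quad p q c &
    forall D, exists2 C : R, 0 < C & forall N a, path_proj R N a != 0 ->
      (content_count a 0 N.+1 <= D)%N ->
      \prod_(k < N.+1) content_factor x s (a k) <= C * \prod_(k < N.+1) quad p q (a k)].
Proof.
move=> xs; have [k k0 kle] := content_factor_lower xs; pose d := k / 2.
exists (2 * x), (x ^+ 2 + s - d).
have QE c : quad (2 * x) (x ^+ 2 + s - d) c = content_factor x s c - d.
  by rewrite content_factor_quad /quad; lra.
have Qle c : k / 2 * (1 + c%:~R ^+ 2) <= content_factor x s c - d.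
  have := kle c; have := sqr_ge0 (c%:~R : R); rewrite /d.
  by move: (content_factor _ _ _) (_ ^+ 2) => A v; nra.
have Qgt0 c : 0 < quad (2 * x) (x ^+ 2 + s - d) c.
  rewrite QE; apply: lt_le_trans (Qle c); rewrite mulr_gt0 ?divr_gt0 //.
  by rewrite ltr_pwDl // sqr_ge0.
split=> //.
  have := Qgt0 0; rewrite /quad expr0n mulr0 !add0r => ->; rewrite /d /=; lra.
move=> D; exists (expR 6 ^+ D) => [|N a Pa aD]; first by rewrite exprn_gt0 ?expR_gt0.
have step c : content_factor x s c <= expR (1 * lorentz c) * quad (2 * x) (x ^+ 2
  + s - d) c.
  apply: (@le_trans _ _ ((1 + lorentz c) * quad (2 * x) (x ^+ 2 + s - d) c)).
    have l0 : 0 < 1 + c%:~R ^+ 2 :> R by rewrite ltr_pwDl // sqr_ge0.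
    suff : d <= lorentz c * quad (2 * x) (x ^+ 2 + s - d) c by rewrite QE; lra.
    by rewrite [lorentz c * _]mulrC ler_pdivlMr // QE.
  by rewrite ler_wpM2r ?(ltW (Qgt0 c)) // mul1r expR_ge1Dx.
apply: (@le_trans _ _ (\prod_(i < N.+1) (expR (1 * lorentz (a i)) *
    quad (2 * x) (x ^+ 2 + s - d) (a i)))).
  by apply: ler_prod => i _; rewrite step (ltW (content_factor_gt0 _ xs)).
rewrite big_split /= ler_wpM2r ?prodr_ge0 // => [i _|]; first exact/ltW/Qgt0.
apply: le_trans (exp_lorentz_path ler01 Pa) _; rewrite mulr1.
by rewrite ler_weXn2l // -expR0 ler_expR.
Qed.

Lemma prod_indicator (rho : R) a (c1 : int) m :
  \prod_(k < m) (if a k == c1 then rho else 1) = rho ^+ content_count a c1 m.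
Proof.
by rewrite /content_count -prodrXr; apply: eq_bigr => k _; case: ifP; rewrite ?expr1.
Qed.

Lemma disjoint_estimate x s x' s' : nonint x s -> nonint x' s' -> (x, s) <> (x', s') ->
  exists p q : R, [/\ 0 < q < (x ^+ 2 + s + (x' ^+ 2 + s')) / 2, forall c,
    0 < quad p q c &
    exists2 C : R, 0 < C & forall N a, path_proj R N a != 0 ->
      (\prod_(k < N.+1) content_factor x s (a k)) * (\prod_(k < N.+1)
        content_factor x' s' (a k)) <=
      C * (\prod_(k < N.+1) quad p q (a k)) ^+ 2].
Proof.
move=> xs xs' ne; have [k k0 kle] := content_factor_lower xs;
  have [k' k0' kle'] := content_factor_lower xs'.
pose A := content_factor x s; pose B := content_factor x' s';
  pose M c := (A c + B c) / 2.
have A0 c : 0 < A c by exact: content_factor_gt0.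
have B0 c : 0 < B c by exact: content_factor_gt0.
have M0 c : 0 < M c by rewrite divr_gt0 // addr_gt0.
pose l := (k + k') / 2; have l0 : 0 < l by rewrite /l; lra.
have Mle c : l * (1 + c%:~R ^+ 2) <= M c.
  have := kle c; have := kle' c; rewrite -/(A c) -/(B c) /M /l.
  by move: (A c) (B c) (1 + _) => ? ? ?; nra.
(* Two monic quadratics equal at 0 and 1 coincide, and then so do (x, s) and (x', s'). *)
clearbody l; have [c1 c01 AB] : exists2 c1 : int, (c1 == 0) || (c1 == 1) & A c1 != B c1.
  have [E0|] := eqVneq (A 0) (B 0); last by exists 0.
  have [E1|] := eqVneq (A 1) (B 1); last by exists 1.
  case: ne; move: E0 E1; rewrite /A /B !content_factor_quad !mulr0z !mulr1z.
  move=> E0 E1; have xx : x = x' by nra.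
  by rewrite xx in E0 *; congr (_, _); lra.
pose rho := A c1 * B c1 / M c1 ^+ 2.
have rho0 : 0 < rho.
  by apply: divr_gt0; [apply: mulr_gt0 (A0 _) (B0 _)|apply: exprn_gt0 (M0 _)].
have rho1 : rho < 1.
  rewrite /rho ltr_pdivrMr ?exprn_gt0 // mul1r /M.
  have : 0 < (A c1 - B c1) ^+ 2 by rewrite exprn_even_gt0 //= subr_eq0.
  by move: (A c1) (B c1) => u v; nra.
have lnr : 0 < - ln rho by rewrite oppr_gt0 ln_lt0 // rho0.
(* The first bound keeps M - d above (l / 2)(1 + c^2). The second gives 12 e <= - ln rho for e = 2 d
   / l below: per zero content the loss exp(6 e)^2 is at most the inverse of the gain rho. *)
pose d := Num.min (l / 2) (l * (- ln rho) / 24).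
have d0 : 0 < d.
  by rewrite lt_min; apply/andP; split; apply: divr_gt0 => //; exact: mulr_gt0.
have d1 : d <= l / 2 by rewrite ge_min lexx.
have d2 : d <= l * (- ln rho) / 24 by rewrite ge_min lexx orbT.
pose p := x + x'; pose q := (x ^+ 2 + s + (x' ^+ 2 + s')) / 2 - d.
exists p, q.
have QE c : quad p q c = M c - d.
  by rewrite /M /A /B !content_factor_quad /quad /p /q; lra.
have Qle c : l / 2 * (1 + c%:~R ^+ 2) <= quad p q c.
  rewrite QE; have := Mle c; have := sqr_ge0 (c%:~R : R).
  by move: (M c) (_ ^+ 2) => m v; nra.
have Qgt0 c : 0 < quad p q c.
  apply: lt_le_trans (Qle c); rewrite mulr_gt0 ?divr_gt0 //.
  by rewrite ltr_pwDl // sqr_ge0.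
split=> //.
  have := Qgt0 0; rewrite {1}/quad expr0n mulr0 !add0r => ->; rewrite /q /=; lra.
exists rho^-1 => [|N a Pa]; first by rewrite invr_gt0.
pose e : R := 2 * d / l; have e0 : 0 <= e by rewrite divr_ge0 ?mulr_ge0 // ltW.
pose g c := if c == c1 then rho else 1.
have g0 c : 0 <= g c by rewrite /g; case: ifP => // _; exact: ltW.
have MQ c : M c <= expR (e * lorentz c) * quad p q c.
  apply: (@le_trans _ _ ((1 + e * lorentz c) * quad p q c)).
    have v0 : 0 < 1 + c%:~R ^+ 2 :> R by rewrite ltr_pwDl // sqr_ge0.
    suff : d <= e * lorentz c * quad p q c by rewrite QE; lra.
    rewrite /lorentz -mulrA [_^-1 * _]mulrC mulrA ler_pdivlMr //.
    have -> : d * (1 + c%:~R ^+ 2) = e * (l / 2 * (1 + c%:~R ^+ 2)).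
      by rewrite /e; field; exact: lt0r_neq0.
    by rewrite ler_wpM2l.
  by rewrite ler_wpM2r ?(ltW (Qgt0 c)) // expR_ge1Dx.
have step c : A c * B c <= g c * (expR (e * lorentz c) * quad p q c) ^+ 2.
  apply: (@le_trans _ _ (g c * M c ^+ 2)).
    rewrite /g; case: eqP => [->|_].
      by rewrite /rho divfK // sqrf_eq0 gt_eqF.
    have : 0 <= (A c - B c) ^+ 2 by rewrite sqr_ge0.
    by rewrite mul1r /M; move: (A c) (B c) => u v; nra.
  rewrite ler_wpM2l // lerXn2r // ?nnegrE ?(ltW (M0 c)) //.
  by rewrite mulr_ge0 ?expR_ge0 // ltW.
rewrite -big_split /=.
apply: (@le_trans _ _ (\prod_(i < N.+1) (g (a i) *
    (expR (e * lorentz (a i)) * quad p q (a i)) ^+ 2))).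
  by apply: ler_prod => i _; rewrite step mulr_ge0 ?(ltW (A0 _)) ?(ltW (B0 _)).
rewrite big_split /= prodrXl big_split /= exprMn mulrA ler_wpM2r ?sqr_ge0 //.
rewrite prod_indicator.
have E1 : (\prod_(i < N.+1) expR (e * lorentz (a i))) ^+ 2 <=
    (expR (6 * e) ^+ content_count a 0 N.+1) ^+ 2.
  apply: lerXn2r; rewrite ?nnegrE; last exact: exp_lorentz_path.
    by apply: prodr_ge0 => i _; exact: expR_ge0.
  by apply: exprn_ge0; exact: expR_ge0.
(* The gain occurs N_c1 >= N_0 - 1 times; the possible deficit of one is the constant rho^-1. *)
have E2 : rho ^+ content_count a c1 N.+1 <= rho^-1 * rho ^+ content_count a 0 N.+1.
  rewrite ler_pdivlMl // -exprS ler_wiXn2l ?(ltW rho0) ?(ltW rho1) //.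
  by case/orP: c01 => /eqP ->; [exact: leqnSn|exact: path_count01 Pa].
apply: (@le_trans _ _ ((rho^-1 * rho ^+ content_count a 0 N.+1) *
    (expR (6 * e) ^+ content_count a 0 N.+1) ^+ 2)).
  apply: ler_pM => //; first by rewrite exprn_ge0 // ltW.
  exact: sqr_ge0.
rewrite -mulrA -[X in _ <= X]mulr1 ler_wpM2l ?invr_ge0 ?(ltW rho0) //.
rewrite exprAC -exprMn exprn_ile1 //.
  by rewrite mulr_ge0 ?exprn_ge0 ?expR_ge0 // ltW.
rewrite -expRM_natr -{1}(lnK (x := rho)) ?posrE // -expRD -[X in _ <= X]expR0 ler_expR.
have : 12 * e <= - ln rho.
  rewrite /e; have := d2; rewrite ler_pdivlMr // mulrA ler_pdivrMr //; lra.
lra.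
Qed.

End ContentSums.

(** * Ratios of rising factorials *)

Section GammaRatio.
Variable R : realType.

Lemma harmonic_unbounded (M : R) : exists n, M < series (@harmonic R) n.
Proof.
have [//|H] := pselect (exists n, M < series (@harmonic R) n); exfalso.
apply: (@dvg_harmonic R); apply: nondecreasing_is_cvgn.
  apply/nondecreasing_seqP => n; rewrite /series /= big_nat_recr //= lerDl.
  exact: harmonic_ge0.
exists M => _ [n _ <-]; rewrite leNgt; apply/negP => Mn.
by apply: H; exists n.
Qed.

(** As 1 - x <= exp(-x), the partial products times exp(d H_n) do not increase from k0 on, and the
    harmonic sums H_n diverge. *)
Lemma prod_small (r : nat -> R) (d : R) k0 : 0 < d -> (forall k, 0 <= r k) ->
  (forall k, (k0 <= k)%N -> r k <= 1 - d * harmonic k) ->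
  forall e, 0 < e -> exists N, \prod_(k < N.+1) r k <= e.
Proof.
move=> d0 r0 rk e e0; pose H := series (@harmonic R); pose p n := \prod_(k < n) r k.
have HS n : H n.+1 = H n + harmonic n by rewrite /H /series /= big_nat_recr.
have p0 n : 0 <= p n by apply: prodr_ge0.
have step n : p (k0 + n)%N * expR (d * H (k0 + n)%N) <= p k0 * expR (d * H k0).
  elim: n => [|n IH]; first by rewrite addn0.
  apply: le_trans IH; rewrite addnS HS /p big_ord_recr /= -/(p _) -mulrA.
  rewrite ler_wpM2l // mulrDr expRD mulrCA -[X in _ <= X]mulr1 ler_wpM2l ?expR_ge0 //.
  have /rk rn : (k0 <= k0 + n)%N by exact: leq_addr.
  apply: (@le_trans _ _ (expR (- (d * harmonic (k0 + n)%N)) * expR (d * harmonic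
    (k0 + n)%N))).
    rewrite ler_wpM2r ?expR_ge0 //; apply: le_trans rn _.
    by have := expR_ge1Dx (- (d * harmonic (k0 + n)%N) : R).
  by rewrite -expRD addNr expR0.
pose C := p k0 * expR (d * H k0); have C0 : 0 <= C by rewrite mulr_ge0 // expR_ge0.
have [n nM] := harmonic_unbounded (Num.max (C / (e * d)) (H k0.+1)).
have Hmono i j : (i <= j)%N -> H i <= H j.
  elim: j => [|j IH]; first by rewrite leqn0 => /eqP ->.
  rewrite leq_eqVlt => /orP[/eqP -> //|]; rewrite ltnS => /IH /le_trans; apply.
  by rewrite HS lerDl harmonic_ge0.
move: nM; rewrite gt_max -/H => /andP[n1 n2].
have kn : (k0.+1 <= n)%N.
  by rewrite leqNgt; apply/negP => /ltnW /Hmono; rewrite leNgt n2.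
exists n.-1; rewrite prednK ?(leq_trans _ kn) // -/(p n).
have := step (n - k0)%N; rewrite subnKC ?(ltnW kn) // -/C => pC.
have eH : C <= e * expR (d * H n).
  apply: (@le_trans _ _ (e * (d * H n))).
    by rewrite mulrA -ler_pdivrMl ?mulr_gt0 // mulrC ltW.
  by rewrite ler_wpM2l ?(ltW e0) // (le_trans _ (expR_ge1Dx _)) // lerDr.
rewrite -(ler_pM2r (expR_gt0 (d * H n))).
exact: le_trans pC eH.
Qed.

(** With T = (t + t') / 2, the difference (t + k)(t' + k) - (b + k)^2 is 2 (T - b) k up to a
    constant, so each factor of the ratio is at most 1 - d / (k + 1) for large k. *)
Lemma gamma_ratio (b t t' : R) : 0 < b -> 0 < t -> 0 < t' -> b < (t + t') / 2 ->
  forall e, 0 < e -> exists N, (\prod_(k < N.+1) (b + k%:R)) ^+ 2 <=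
    e * ((\prod_(k < N.+1) (t + k%:R)) * \prod_(k < N.+1) (t' + k%:R)).
Proof.
move=> b0 t0 t'0 bt e e0; pose T := (t + t') / 2; pose d := (T - b) / 2.
have d0 : 0 < d by rewrite divr_gt0 // subr_gt0.
pose r k : R := (b + k%:R) ^+ 2 / ((t + k%:R) * (t' + k%:R)).
have den0 (k : nat) : 0 < (t + k%:R) * (t' + k%:R) by rewrite mulr_gt0 // ltr_pwDl.
have r0 k : 0 <= r k by rewrite divr_ge0 ?sqr_ge0 // ltW.
(* Beyond X one has b^2 < (T - b) k, leaving a gap of at least (T - b) k, and (t + k)(t' + k) <= 2 k
   (k + 1). *)
pose X := b ^+ 2 / (T - b) + (2 * T + t * t' + 1).
have X0 : 0 <= X.
  rewrite addr_ge0 // ?divr_ge0 ?sqr_ge0 ?subr_ge0 ?ltW // /T.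
  by have := mulr_gt0 t0 t'0; lra.
have rk k : (Num.Def.archi_bound X <= k)%N -> r k <= 1 - d * harmonic k.
  move=> Xk; have {}Xk : X < k%:R by apply: lt_le_trans (archi_boundP X0) _;
    rewrite ler_nat.
  rewrite /r ler_pdivrMr // /harmonic /= -natr1;
    move: (k%:R : R) (ler0n R k) Xk => u u0 Xu.
  have u1 : 0 < u + 1 by lra.
  have bT : 0 < T - b by rewrite subr_gt0.
  have X1 : b ^+ 2 < (T - b) * u.
    rewrite mulrC -ltr_pdivrMr //; apply: le_lt_trans Xu; rewrite /X lerDl.
    by have := mulr_gt0 t0 t'0; rewrite /T; lra.
  have X2 : 2 * T + t * t' + 1 < u.
    by apply: le_lt_trans Xu; rewrite /X lerDr divr_ge0 ?sqr_ge0 // ltW.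
  have tt0 := mulr_gt0 t0 t'0.
  have E : (t + u) * (t' + u) = u ^+ 2 + 2 * T * u + t * t' by rewrite /T; field.
  have T0 : 0 < T by rewrite /T; lra.
  have le2 : (t + u) * (t' + u) <= 2 * u * (u + 1) by rewrite E; nra.
  have H : d * (u + 1)^-1 * ((t + u) * (t' + u)) <= (T - b) * u.
    rewrite mulrAC ler_pdivrMr // /d.
    have -> : (T - b) * u * (u + 1) = (T - b) / 2 * (2 * u * (u + 1)) by field.
    by rewrite ler_wpM2l // divr_ge0 // ltW.
  move: E H; set v := d * _; set W := _ * (t' + u); move: v W => v W E H; nra.
have [N pN] := prod_small d0 r0 rk e0; exists N.
rewrite -prodrXl -big_split /= -ler_pdivrMr; last by apply: prodr_gt0.
by rewrite -prodf_div.
Qed.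

End GammaRatio.

Local Open Scope classical_set_scope.
Local Open Scope ring_scope.

(** * Virtual permutations and Thoma characters *)

Section Levels.
Variable n : nat.
Implicit Types (u v : 'S_n).

Definition lift_set (A : {set 'I_n}) : {set 'I_n.+1} := [set lift ord_max i | i
  in A]%SET.

Lemma lift_set_inj : injective lift_set.
Proof. exact: imset_inj (@lift_inj _ ord_max). Qed.

Lemma porbit_lift u i : porbit (lift_perm ord_max ord_max u) (lift ord_max i) =
  lift_set (porbit u i).
Proof.
have E k : ((lift_perm ord_max ord_max u ^+ k) (lift ord_max i) =
    lift ord_max ((u ^+ k) i))%g.
  elim: k => [|k IH]; first by rewrite !expg0 !perm1.
  by rewrite !expgSr !permM IH lift_perm_lift.
apply/setP => j; apply/porbitP/imsetP => [[k ->]|[l /porbitP[k ->] ->]].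
  by exists ((u ^+ k)%g i); rewrite ?mem_porbit // E.
by exists k; rewrite E.
Qed.

Lemma porbits_lift u : porbits (lift_perm ord_max ord_max u) =
  ([set (ord_max : 'I_n.+1)]%SET |: [set lift_set A | A in porbits u])%SET.
Proof.
have E0 : porbit (lift_perm ord_max ord_max u) ord_max = [set ord_max]%SET.
  apply/setP => j; rewrite inE; apply/porbitP/eqP => [[k ->]|->].
    elim: k => [|k IH]; first by rewrite expg0 perm1.
    by rewrite expgSr permM IH lift_perm_id.
  by exists 0%N; rewrite expg0 perm1.
apply/setP => A; rewrite in_setU1; apply/imsetP/orP => [[j _ ->]|].
  case: (unliftP ord_max j) => [i ->|->]; last by left; rewrite E0.
  by right; rewrite porbit_lift imset_f // imset_f.
case=> [/eqP ->|/imsetP[B /imsetP[i _ ->] ->]]; first by exists ord_max.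
by exists (lift ord_max i); rewrite ?porbit_lift.
Qed.

Lemma porbits_lift_notin u : ([set (ord_max : 'I_n.+1)] \notin [set lift_set A |
  A in porbits u])%SET.
Proof.
apply/imsetP => -[A _ /setP /(_ ord_max)]; rewrite inE eqxx => /esym/imsetP[i _].
by move=> /esym/eqP; rewrite lift_max_neq.
Qed.

Lemma ncycles_lift u : ncycles (lift_perm ord_max ord_max u) = (ncycles u).+1.
Proof.
rewrite /ncycles porbits_lift cardsU1 porbits_lift_notin add1n.
by rewrite card_imset //; exact: lift_set_inj.
Qed.

Lemma kcycles_lift u k : (2 <= k)%N ->
  kcycles (lift_perm ord_max ord_max u) k = kcycles u k.
Proof.
move=> k2; rewrite /kcycles porbits_lift -[RHS](card_imset _ lift_set_inj).
apply: eq_card => A; rewrite !inE; apply/andP/imsetP => [[/orP[/eqP ->|]]|[B]].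
- by rewrite cards1 => /eqP E; move: k2; rewrite -E.
- move=> /imsetP[B Bu ->]; rewrite card_imset; last exact: lift_inj.
  by move=> Bk; exists B; rewrite // inE Bu.
rewrite inE => /andP[Bu Bk] ->; rewrite imset_f // orbT card_imset //.
exact: lift_inj.
Qed.

Lemma kcycles_big u k : (n < k)%N -> kcycles u k = 0%N.
Proof.
move=> nk; apply: eq_card0 => A; rewrite !inE; apply/negP => /andP[_ /eqP Ak].
by have := max_card (mem A); rewrite card_ord Ak leqNgt nk.
Qed.

Lemma canproj_tperm (x : 'S_n.+1) :
  (x = lift_perm ord_max ord_max (canproj x) * tperm (x ord_max) ord_max)%g.
Proof.
apply/permP => j; rewrite permM; case: (unliftP ord_max j) => [i ->|->].
  rewrite lift_perm_lift canprojE; case: eqP => [->|xi]; first by rewrite tpermL.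
  rewrite tpermD //; apply/eqP; last by move=> E; apply: xi.
  by move=> /perm_inj/esym/eqP; rewrite lift_max_neq.
by rewrite lift_perm_id tpermR.
Qed.

Lemma ncycles_canproj (x : 'S_n.+1) :
  ncycles x = (ncycles (canproj x) + (x ord_max == ord_max))%N.
Proof.
rewrite {1}[x]canproj_tperm; set y := lift_perm _ _ _.
have := porbits_mul_tperm y^-1 (x ord_max) ord_max => /=.
have y0 : porbit y^-1 ord_max = [set ord_max]%SET.
  rewrite porbitV; apply/setP => j; rewrite inE; apply/porbitP/eqP => [[k ->]|->].
    elim: k => [|k IH]; first by rewrite expg0 perm1.
    by rewrite expgSr permM IH lift_perm_id.
  by exists 0%N; rewrite expg0 perm1.
rewrite y0 inE -{1}[tperm _ _]tpermV -invMg !porbitsV.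
rewrite -/(ncycles (y * _)) -/(ncycles y) ncycles_lift; case: eqP => /= _.
  by rewrite double0 !addn0 addn1.
by rewrite addn0 addn1 addn2 => -[].
Qed.

End Levels.

Lemma vp_canproj (x : vperm) n : canproj (vp x n.+1) = vp x n.
Proof. exact: (set_mem (valP x)). Qed.

(** One level up, both cycle counts grow by 1 exactly when x fixes the new point, a property that g
    does not alter. Hence any admissible level may replace the chosen one. *)
Lemma cocycleE x g n : inG n g ->
  cocycle x g = (ncycles (vp (vact x g) n))%:Z - (ncycles (vp x n))%:Z.
Proof.
pose f m := (ncycles (vp (vact x g) m))%:Z - (ncycles (vp x m))%:Z.
have fS m : inG m g -> f m.+1 = f m.
  move=> gm; rewrite /f !ncycles_canproj !vp_canproj (vactP x (inGS gm)).
  case: gm => g1 g2; rewrite !restrS // lift_permV !permM lift_perm_id.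
  set v := lift_perm _ _ (restr m g.2)^-1.
  have -> : (v (vp x m.+1 ord_max) == ord_max) = (vp x m.+1 ord_max == ord_max).
    by rewrite -[RHS](inj_eq (@perm_inj _ v)) lift_perm_id.
  by rewrite !PoszD opprD addrACA subrr addr0.
have fD m k : inG m g -> f (m + k)%N = f m.
  move=> gm; elim: k => [|k IH]; first by rewrite addn0.
  by rewrite addnS fS //; apply: inGW gm; exact: leq_addr.
rewrite -/(f n) /cocycle; set m := sval _ => gn; rewrite -/(f m).
have gm : inG m g by exact: (svalP (cid (inG_ex g))).
by rewrite -(fD n m gn) -(fD m n gm) addnC.
Qed.

Lemma inS_Sinf1 n : inS n Sinf1.
Proof. by exists 1%g; rewrite ?emb1. Qed.

Lemma restr_Sinf1 n : restr n Sinf1 = 1%g.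
Proof. by apply: emb_inj; rewrite emb1 restrP //; exact: inS_Sinf1. Qed.

Lemma Sinf_of_subproof n (u : 'S_n) : emb u \in \bigcup_n range (@emb n).
Proof. by apply/mem_set; exists n => //; exists u. Qed.

Definition Sinf_of n (u : 'S_n) : Sinf := exist _ (emb u) (Sinf_of_subproof u).

Lemma inS_Sinf_of n (u : 'S_n) : inS n (Sinf_of u).
Proof. by exists u. Qed.

Lemma restr_Sinf_of n (u : 'S_n) : restr n (Sinf_of u) = u.
Proof. by apply: emb_inj; rewrite restrP //; exact: inS_Sinf_of. Qed.

Section ChiOmega.
Variable R : realType.
Implicit Types (w : Omega R) (s : Sinf).

Definition psum w (k : nat) : R := limn (series (fun i => alpha w i ^+ k))
     + (-1) ^+ k.-1 * limn (series (fun j => beta w j ^+ k)).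

Lemma chi_OmegaE w s n : inS n s ->
  chi_Omega w s = \prod_(2 <= k < n.+1) psum w k ^+ kcycles (restr n s) k.
Proof.
pose f m := \prod_(2 <= k < m.+1) psum w k ^+ kcycles (restr m s) k.
have fS m : inS m s -> f m.+1 = f m.
  move=> sm; rewrite /f restrS //; have [->|m0] := posnP m; first by rewrite !big_geq.
  rewrite big_nat_recr /=; last by rewrite ltnS.
  rewrite kcycles_lift // kcycles_big // expr0 mulr1.
  by apply: eq_big_nat => k /andP[k2 _]; rewrite kcycles_lift.
have fD m k : inS m s -> f (m + k)%N = f m.
  move=> gm; elim: k => [|k IH]; first by rewrite addn0.
  by rewrite addnS fS //; apply: inSW gm; exact: leq_addr.
rewrite -/(f n) /chi_Omega; set m := sval _ => gn; rewrite -/(f m).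
have gm : inS m s by exact: (svalP (cid (inS_ex s))).
by rewrite -(fD n m gn) -(fD m n gm) addnC.
Qed.

(** A fixed point counts 1, not the sum of all alpha_i and beta_j; with this convention chi^(omega)
    is a product over all cycles. *)
Definition psum1 w k := if k == 1%N then 1 else psum w k.

Lemma prod_kcycles n (u : 'S_n) (F : nat -> R) : F 1%N = 1 ->
  \prod_(2 <= k < n.+1) F k ^+ kcycles u k = \prod_(A in porbits u) F #|A|.
Proof.
move=> F1; have -> : \prod_(A in porbits u) F #|A| =
    \prod_(A in porbits u) \prod_(0 <= k < n.+1 | k == #|A|) F k.
  apply: eq_bigr => A _; rewrite big_mkord.
  have An : (#|A| < n.+1)%N by rewrite ltnS -[X in (_ <= X)%N]card_ord max_card.
  by rewrite (big_pred1 (Ordinal An)) // => k; rewrite -(inj_eq val_inj).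
rewrite (exchange_big_dep xpredT) //=.
have E k : \prod_(A in porbits u | k == #|A|) F k = F k ^+ kcycles u k.
  rewrite big_const -[RHS]/(_ ^+ _); rewrite /kcycles.
  have -> : #|[set A in porbits u | #|A| == k]%SET| =
    #|[pred A | (A \in porbits u) && (k == #|A|)]|.
    by apply: eq_card => A; rewrite !inE eq_sym.
  by rewrite -Monoid.iteropE.
transitivity (\prod_(0 <= k < n.+1) F k ^+ kcycles u k); last first.
  by apply: eq_bigr => k _; rewrite E.
have k0 : kcycles u 0 = 0%N.
  apply: eq_card0 => A; rewrite !inE; apply/negP => /andP[/porbits_gt0].
  by rewrite lt0n => /negbTE ->.
rewrite [RHS]big_ltn // k0 expr0 mul1r; case: n u {E k0} => [|n] u.
  by rewrite !big_geq.
by rewrite [RHS]big_ltn // F1 expr1n mul1r.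
Qed.

Lemma chi_Omega_Sinf_of w n (u : 'S_n) :
  chi_Omega w (Sinf_of u) = \prod_(A in porbits u) psum1 w #|A|.
Proof.
rewrite (chi_OmegaE w (inS_Sinf_of u)) restr_Sinf_of -(@prod_kcycles n u (psum1 w)) //.
by apply: eq_big_nat => k /andP[k2 _]; rewrite /psum1 gtn_eqF.
Qed.

End ChiOmega.

(** * Measure-theoretic tools *)

Section BoundedMeasurable.
Context (d : measure_display) (T : measurableType d) (R : realType).
Variable P : probability T R.
Implicit Types (f : T -> R) (A : set T).

Definition bmeas f := measurable_fun [set: T] f /\ exists M : R, forall x, `|f x| <= M.

Lemma bmeas_integrable f : bmeas f -> P.-integrable [set: T] (EFin \o f).
Proof.
move=> [mf [M fM]]; apply: measurable_bounded_integrable => //.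
  exact: le_lt_trans (probability_le1 P measurableT) (ltry _).
exists M; split; first exact: num_real.
by move=> N MN x _; apply: le_trans (fM x) (ltW MN).
Qed.

Lemma bmeasZ c f : bmeas f -> bmeas (fun x => c * f x).
Proof.
move=> [mf [M fM]]; split; first exact: measurable_funM.
by exists (`|c| * M) => x; rewrite normrM ler_wpM2l.
Qed.

Lemma bmeasD f g : bmeas f -> bmeas g -> bmeas (fun x => f x + g x).
Proof.
move=> [mf [M fM]] [mg [L gL]]; split; first exact: measurable_funD.
by exists (M + L) => x; rewrite (le_trans (ler_normD _ _)) // lerD.
Qed.

Lemma bmeas_cst c : bmeas (fun=> c).
Proof. by split; [exact: measurable_cst|exists `|c|]. Qed.

Lemma bmeas_sum I (r : seq I) (c : I -> R) (f : I -> T -> R) :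
  (forall i, bmeas (f i)) -> bmeas (fun x => \sum_(i <- r) c i * f i x).
Proof.
move=> bf; elim: r => [|i r IH].
  by under eq_fun do rewrite big_nil; exact: bmeas_cst.
under eq_fun do rewrite big_cons; apply: bmeasD => //; exact: bmeasZ.
Qed.

Lemma Rintegral_lin I (r : seq I) (c : I -> R) (f : I -> T -> R) :
  (forall i, bmeas (f i)) ->
  \int[P]_x (\sum_(i <- r) c i * f i x) = \sum_(i <- r) c i * \int[P]_x f i x.
Proof.
move=> bf; elim: r => [|i r IH].
  under eq_Rintegral do rewrite big_nil.
  by rewrite big_nil Rintegral_cst ?mul0r.
under eq_Rintegral do rewrite big_cons.
rewrite RintegralD //; [|exact/bmeas_integrable/bmeasZ|exact/bmeas_integrable/bmeas_sum].
by rewrite RintegralZl // ?IH ?big_cons //; exact: bmeas_integrable.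
Qed.

Lemma bmeas_indic A : measurable A -> bmeas (\1_A : T -> R).
Proof.
move=> mA; split; first exact: measurable_indic.
by exists 1 => x; rewrite indicE; case: (_ \in _); rewrite ?normr1 ?normr0.
Qed.

Lemma Rintegral_indic A : measurable A -> \int[P]_x (\1_A x : R) = fine (P A).
Proof. by move=> mA; rewrite /Rintegral integral_indic // setIT. Qed.

Lemma measurable_half f : bmeas f -> measurable [set x | 2^-1 <= f x].
Proof.
move=> bf; rewrite (_ : [set x | _] = setT `&` f @^-1` `[2^-1, +oo[%classic).
  by apply: bf.1 => //; exact: measurable_itv.
by rewrite setTI; apply/seteqP; split=> x /=; rewrite in_itv /= andbT.
Qed.

Lemma markov_half f : bmeas f -> (forall x, 0 <= f x) ->
  (P [set x | (2^-1 <= f x)%R] <= (2 * \int[P]_x f x)%:E)%E.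
Proof.
move=> bf f0; have mA := measurable_half bf; set A := [set x | _] in mA *.
rewrite -[P A]fineK ?fin_num_measure // lee_fin -Rintegral_indic //.
rewrite -RintegralZl //; last exact: bmeas_integrable.
apply: le_Rintegral => //.
- exact/bmeas_integrable/bmeas_indic.
- exact/bmeas_integrable/bmeasZ.
move=> x _; rewrite indicE; have [|_] := boolP (x \in A).
  by rewrite inE /A /= => h; rewrite mulr1n; lra.
by rewrite mulr_ge0.
Qed.

End BoundedMeasurable.

Section Singular.
Context (d : measure_display) (T : measurableType d) (R : realType).
Variables P Q : probability T R.

(** Borel-Cantelli: with errors 2^-(n+1), the limsup of the separating sets is null for Q and its
    complement is null for P. *)
Lemma singular_of_separating :
  (forall e : R, 0 < e -> exists A, [/\ measurable A, (P (~` A) <=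
    e%:E)%E & (Q A <= e%:E)%E]) ->
  mutually_singular P Q.
Proof.
move=> sep.
have /choice[A AP] : forall n : nat, exists A, [/\ measurable A,
    (P (~` A) <= ((2^-1) ^+ n.+1)%:E)%E & (Q A <= ((2^-1) ^+ n.+1)%:E)%E].
  by move=> n; apply: sep; rewrite exprn_gt0 // invr_gt0.
have mA n : measurable (A n) by case: (AP n).
pose B := lim_sup_set A.
have mB : measurable B.
  by apply: bigcap_measurable => // k _; exact: bigcup_measurable.
(* The witness must be null for the first measure, hence the complement. *)
exists (~` B); split; [exact: measurableC| |]; last first.
  rewrite setCK; apply: lim_sup_set_cvg0 => //.
  apply: (@le_lt_trans _ _ (\sum_(n <oo) ((2^-1) ^+ n.+1)%:E)%E).
    by apply: lee_nneseries => [n _ _|n _]; [exact: measure_ge0|have [_ _ h] :=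
      AP n; exact: h].
  apply: (@le_lt_trans _ _ 1%:E); last by rewrite ltry.
  apply: lime_le.
    by apply: is_cvg_nneseries => n _ _; rewrite lee_fin exprn_ge0 // invr_ge0.
  apply: nearW => n; rewrite sumEFin lee_fin.
  have -> : \sum_(0 <= i < n) (2^-1 : R) ^+ i.+1 = 1 - (2^-1) ^+ n.
    elim: n => [|n IH]; first by rewrite big_geq // expr0 subrr.
    by rewrite big_nat_recr //= IH exprS; field.
  by rewrite gerBl exprn_ge0 // invr_ge0.
rewrite /B /lim_sup_set setC_bigcap.
have null m : P (~` (\bigcup_(j >= m) A j)) = 0%E.
  apply/eqP; rewrite eq_le measure_ge0 andbT; apply/lee_addgt0Pr => e e0.
  have [k mk ke] : exists2 k, (m <= k)%N & (2^-1 : R) ^+ k.+1 <= e.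
    pose k := maxn m (Num.Def.archi_bound e^-1); exists k; first exact: leq_maxl.
    have ke : e^-1 < k%:R.
      apply: lt_le_trans (archi_boundP _) _; first by rewrite invr_ge0 ltW.
      by rewrite ler_nat leq_maxr.
    rewrite exprVn invf_ple ?posrE ?exprn_gt0 //; apply: le_trans (ltW ke) _.
    by rewrite -natrX ler_nat (leq_trans (leqnSn k)) // ltnW // ltn_expl.
  rewrite add0e; apply: (@le_trans _ _ (P (~` A k))).
    apply: le_measure; rewrite ?inE.
    - by apply: measurableC; exact: bigcup_measurable.
    - exact: measurableC.
    - by apply: subsetC => x Ax; exists k.
  by case: (AP k) => _ + _ => /le_trans; apply; rewrite lee_fin.
have mC m : measurable (~` (\bigcup_(j >= m) A j)).
  by apply: measurableC; exact: bigcup_measurable.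
have mU : measurable (\bigcup_m (~` (\bigcup_(j >= m) A j))).
  exact: bigcup_measurable.
apply: (proj1 (@negligibleP _ T R P _ mU)); apply: negligible_bigcup => m.
exists (~` (\bigcup_(j >= m) A j)); split; [exact: mC|exact: null|exact: subset_refl].
Qed.

End Singular.

(** * The characters of the generalized regular representations *)

Section ComplexJM.
Variables (R : realType) (N : nat).

Lemma prod_JM_quad (K : comNzRingType) (z1 z2 : K) m : (m <= N.+1)%N ->
  (\prod_(k < m) (z1%:A + JM K N k)) * (\prod_(k < m) (z2%:A + JM K N k)) =
  \prod_(k < m) jmquad N (z1 + z2) (z1 * z2) k.
Proof.
elim: m => [|m IH] mN; first by rewrite !big_ord0 mulr1.
rewrite !big_ord_recr /= -(IH (ltnW mN)).
set X := \prod_(k < m) (z1%:A + _); set Y := \prod_(k < m) (z2%:A + _).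
have cY : (z1%:A + JM K N m) * Y = Y * (z1%:A + JM K N m).
  apply: commr_prod => i _; apply: commrD.
    by rewrite /GRing.comm -scalerAr mulr1 -scalerAl mul1r.
  apply: commr_sym; apply: commrD.
    by rewrite /GRing.comm -scalerAr mulr1 -scalerAl mul1r.
  by apply: JMC => //; rewrite -ltnS (leq_trans (ltn_ord i)) // ltnW.
rewrite -mulrA (mulrA _ Y) cY -!mulrA; congr (_ * (_ * _)).
rewrite /jmquad mulrDl !mulrDr -!scalerAl -!scalerAr !mul1r mulr1 scalerA scalerDl.
by rewrite -addrA [RHS]addrC; congr (_ + _); rewrite addrA addrC.
Qed.

Lemma gmap_jmquad (K K' : comNzRingType) (f : {rmorphism K -> K'}) p q m :
  gmap f (\prod_(k < m) jmquad N p q k) = \prod_(k < m) jmquad N (f p) (f q) k.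
Proof.
rewrite rmorph_prod; apply: eq_bigr => k _.
by rewrite /jmquad !rmorphD rmorphM /= !gmapZ rmorph1 gmap_JM.
Qed.

Lemma gstar_jmquad (K : comNzRingType) p q m : (m <= N.+1)%N ->
  gstar (\prod_(k < m) jmquad N p q k) = \prod_(k < m) jmquad N p q k :> galg K _.
Proof.
elim: m => [|m IH] mN; first by rewrite big_ord0 gstar1.
rewrite big_ord_recr /= gstarM (IH (ltnW mN)).
have -> : gstar (jmquad N p q m) = jmquad N p q m :> galg K _.
  by rewrite /jmquad !gstarD !gstarZ gstarM gstar_JM gstar1.
have cJ k : (k <= N)%N -> forall x : galg K 'S_N.+1, GRing.comm x (JM K N k) ->
    GRing.comm x (jmquad N p q k).
  move=> kN x xJ; rewrite /jmquad; apply: commrD; first apply: commrD.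
  - exact: commrM.
  - by rewrite /GRing.comm -scalerAr -scalerAl xJ.
  by rewrite /GRing.comm -scalerAr mulr1 -scalerAl mul1r.
apply: commr_prod => k _; apply: (cJ); first by rewrite -ltnS (leq_trans (ltn_ord
  k)) // ltnW.
apply: commr_sym; apply: (cJ) => //; apply: JMC => //.
by rewrite -ltnS (leq_trans (ltn_ord k)) // ltnW.
Qed.

(** The left side is a convolution of the Jucys products for z and its conjugate, which multiply to
    a product of quadratics with real coefficients. *)
Lemma jm_complex (z : R[i]) (g : 'S_N.+1) :
  \sum_(u : 'S_N.+1) (z^*)%C ^+ ncycles u * z ^+ ncycles (g * u)%g =
  ((gcoef (\prod_(k < N.+1) jmquad N (2 * complex.Re z)
      (complex.Re z ^+ 2 + complex.Im z ^+ 2) k) g)%:C)%C.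
Proof.
rewrite -(gcoef_map (real_complex R)) gmap_jmquad /=.
have -> : real_complex R (2 * complex.Re z) = z + (z^*)%C.
  by apply/eqP; rewrite eq_complex; case: z => a b /=; apply/andP; split;
    apply/eqP; ring.
have -> : real_complex R (complex.Re z ^+ 2 + complex.Im z ^+ 2) = z * (z^*)%C.
  by apply/eqP; rewrite eq_complex; case: z => a b /=; apply/andP; split;
    apply/eqP; ring.
rewrite -prod_JM_quad // !prod_JM gcoefM [RHS](reindex_inj (mulgI g)) /=.
apply: eq_bigr => u _; rewrite !gmakeE invMg mulgKV mulrC.
by rewrite /ncycles porbitsV.
Qed.

End ComplexJM.

(** * The character chi_z at a finite level *)

Section EwensIntegral.
Variable R : realType.

Lemma measurable_vp n (u : 'S_n) :
  measurable [set x : vperm_borel | vp x n = u].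
Proof.
apply: sub_sigma_algebra; rewrite /=.
pose D := fun n => discrete_topology 'S_n.
have op : open [set y : prod_topology D | (y : forall n, 'S_n) n = u].
  have := @open_comp (prod_topology D) (D n) (fun y : prod_topology D => y n) [set u].
  by apply=> [y _|]; [exact: (@proj_continuous nat D n)|exact: discrete_open].
by exists [set y : prod_topology D | (y : forall n, 'S_n) n = u].
Qed.

Variables (t : R) (mu : probability vperm_borel R).
Hypothesis mu_ewens : ewens t mu.

Definition weight n (u : 'S_n) : R := t ^+ ncycles u / \prod_(i < n) (t + i%:R).

Lemma Rintegral_vp n (G : 'S_n -> R) :
  \int[mu]_x G (vp x n) = \sum_(u : 'S_n) G u * weight u.
Proof.
have E x : G (vp x n) = \sum_(u : 'S_n) G u * \1_[set x : vperm_borel | vp x n = u] x.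
  rewrite (bigD1 (vp x n)) //= indicE mem_set // mulr1 big1 ?addr0 // => u ux.
  rewrite indicE memNset ?mulr0 // => /= xu; by rewrite xu eqxx in ux.
under eq_Rintegral do rewrite E.
rewrite Rintegral_lin => [|u]; last by apply: bmeas_indic; exact: measurable_vp.
by apply: eq_bigr => u _; rewrite Rintegral_indic ?mu_ewens //; exact: measurable_vp.
Qed.

Lemma cintegral_vp n (F : 'S_n -> R[i]) :
  cintegral mu (fun x => F (vp x n)) = \sum_(u : 'S_n) F u * ((weight u)%:C)%C.
Proof.
rewrite /cintegral (Rintegral_vp (fun u => complex.Re (F u)))
  (Rintegral_vp (fun u => complex.Im (F u))).
rewrite [RHS](_ : _ = \sum_(u : 'S_n) Complex (complex.Re (F u) * weight u)
  (complex.Im (F u) * weight u)).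
  by elim/big_rec3: _ => [|u x y w _ <-].
by apply: eq_bigr => u _; case: (F u) => a b; simpc.
Qed.

(** As t is z times its conjugate, t^[u] z^([gu] - [u]) is the product of conj(z)^[u] and z^[gu],
    and [jm_complex] sums these terms. *)
Lemma chi_Sinf_of N (z : R[i]) (g : 'S_N.+1) : t =
  complex.Re z ^+ 2 + complex.Im z ^+ 2 ->
  z != 0 ->
  chi_ mu z (Sinf_of g) = ((gcoef (\prod_(k < N.+1) jmquad N (2 * complex.Re z)
      t k) g / \prod_(i < N.+1) (t + i%:R))%:C)%C.
Proof.
move=> tE z0; rewrite /chi_ /inner /Tz.
have zc : (t%:C)%C = z * (z^*)%C.
  by rewrite tE; apply/eqP; rewrite eq_complex; case: (z) => a b /=; apply/andP;
    split; apply/eqP; ring.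
have t0 : (z^*)%C != 0 by rewrite conjc_eq0.
rewrite (_ : (fun x => _) = (fun x => (fun u : 'S_N.+1 =>
    z ^ ((ncycles (g * u)%g)%:Z - (ncycles u)%:Z)) (vp x N.+1))); last first.
  apply/funext => x; rewrite mul1r conjc1 mulr1.
  have gN : inG N.+1 (Sinf_of g, Sinf1) by split; [exact: inS_Sinf_of|exact: inS_Sinf1].
  by rewrite (cocycleE x gN) (vactP x gN) /= restr_Sinf_of restr_Sinf1 invg1 mulg1.
rewrite (@cintegral_vp N.+1 (fun u => z ^ ((ncycles (g * u)%g)%:Z - (ncycles u)%:Z))).
rewrite rmorphM /= tE -jm_complex -tE mulr_suml; apply: eq_bigr => u _.
rewrite /weight rmorphM rmorphXn /= mulrA; congr (_ * _).
rewrite zc exprMn expfzDr // -exprnN -exprnP mulrACA mulrC.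
by rewrite [_ * z ^+ ncycles u]mulrC mulrACA mulVf ?expf_neq0 // mul1r.
Qed.

End EwensIntegral.

(** * The states attached to points of the Thoma simplex *)

Section Thoma.
Variable R : realType.
Implicit Types (w : Omega R) (m k : nat).

Lemma alpha_ge0 w i : 0 <= alpha w i.
Proof.
have [H _ _] := set_mem (valP w); have /andP[h1 h2] := H i; exact: le_trans h1 h2.
Qed.

Lemma beta_ge0 w i : 0 <= beta w i.
Proof.
have [_ H _] := set_mem (valP w); have /andP[h1 h2] := H i; exact: le_trans h1 h2.
Qed.

Lemma sum_alpha_beta w m : \sum_(i < m) alpha w i + \sum_(j < m) beta w j <= 1.
Proof.
have [_ _ H] := set_mem (valP w); rewrite -lee_fin EFinD; apply: le_trans H.
rewrite -!(big_mkord xpredT) -!sumEFin; apply: leeD; apply: nneseries_lim_ge => n _ _.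
  by rewrite lee_fin; exact: alpha_ge0.
by rewrite lee_fin; exact: beta_ge0.
Qed.

Lemma sum_power_le (u : nat -> R) m k : (forall i, 0 <= u i) ->
  \sum_(i < m) u i <= 1 -> \sum_(i < m) u i ^+ k.+1 <= \sum_(i < m) u i.
Proof.
move=> u0 u1; apply: ler_sum => i _; rewrite exprS ler_piMr // exprn_ile1 //.
apply: le_trans u1; rewrite (bigD1 i) //= lerDl; exact: sumr_ge0.
Qed.

Lemma sum_alpha_le1 w m : \sum_(i < m) alpha w i <= 1.
Proof.
apply: le_trans (sum_alpha_beta w m); rewrite lerDl sumr_ge0 // => i _.
exact: beta_ge0.
Qed.

Lemma sum_beta_le1 w m : \sum_(i < m) beta w i <= 1.
Proof.
apply: le_trans (sum_alpha_beta w m); rewrite lerDr sumr_ge0 // => i _.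
exact: alpha_ge0.
Qed.

Lemma power_series_cvg (u : nat -> R) k : (forall i, 0 <= u i) ->
  (forall m, \sum_(i < m) u i <= 1) ->
  series (fun i => u i ^+ k.+1) m @[m --> \oo] --> limn (series (fun i => u i ^+ k.+1)).
Proof.
move=> u0 u1; apply: nondecreasing_is_cvgn.
  apply/nondecreasing_seqP => n; rewrite /series /= big_nat_recr //= lerDl.
  exact: exprn_ge0.
exists 1 => _ [n _ <-]; rewrite /series /= big_mkord.
exact: le_trans (sum_power_le _ _ _) _.
Qed.

Definition psumt w m k : R := \sum_(i < m) alpha w i ^+ k
     + (-1) ^+ k.-1 * \sum_(j < m) beta w j ^+ k.

Definition psumt1 w m k := if k == 1%N then 1 else psumt w m k.

Lemma psumt_cvg w k : (0 < k)%N -> psumt w m k @[m --> \oo] --> psum w k.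
Proof.
case: k => // k _; rewrite /psumt /psum.
have -> : (fun m => \sum_(i < m) alpha w i ^+ k.+1 +
    (-1) ^+ k.+1.-1 * \sum_(j < m) beta w j ^+ k.+1) =
    (fun m => series (fun i => alpha w i ^+ k.+1) m +
    (-1) ^+ k.+1.-1 * series (fun i => beta w i ^+ k.+1) m).
  by apply/funext => m; rewrite /series /= !big_mkord.
apply: cvgD.
  by apply: power_series_cvg; [exact: alpha_ge0|exact: sum_alpha_le1].
apply: cvgMr.
by apply: power_series_cvg; [exact: beta_ge0|exact: sum_beta_le1].
Qed.

Lemma psumt1_cvg w k : (0 < k)%N -> psumt1 w m k @[m --> \oo] --> psum1 w k.
Proof.
by move=> k0; rewrite /psumt1 /psum1; case: eqP => _; [exact: cvg_cst|exact: psumt_cvg].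
Qed.

Lemma psumt_le1 w m k : (0 < k)%N -> `|psumt w m k| <= 1.
Proof.
case: k => // k _; apply: le_trans (sum_alpha_beta w m).
rewrite /psumt; apply: (le_trans (ler_normD _ _)); apply: lerD.
  rewrite ger0_norm ?sumr_ge0 // => [|i _]; last by rewrite exprn_ge0 // alpha_ge0.
  by apply: sum_power_le; [exact: alpha_ge0|exact: sum_alpha_le1].
rewrite normrM normrX normrN1 expr1n mul1r.
rewrite ger0_norm ?sumr_ge0 // => [|i _]; last by rewrite exprn_ge0 // beta_ge0.
by apply: sum_power_le; [exact: beta_ge0|exact: sum_beta_le1].
Qed.

Lemma psum1_le1 w k : (0 < k)%N -> `|psum1 w k| <= 1.
Proof.
move=> k0; rewrite /psum1; case: eqP => _; first by rewrite normr1.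
have h : `|psumt w m k| @[m --> \oo] --> `|psum w k|.
  by apply: cvg_norm; exact: psumt_cvg.
by apply: (cvgr_to_le h); apply: nearW => m; exact: psumt_le1.
Qed.

Section Level.
Variable N : nat.
Local Notation A := (galg R 'S_N.+1).
Implicit Types (x y : A) (g : 'S_N.+1).

(** The linear extension of chi^(omega) to the group algebra; [trunc_state] keeps only the atoms of
    index below m. *)
Definition thoma_state w x : R := \sum_g gcoef x g * chi_Omega w (Sinf_of g).
Definition trunc_state w m x : R :=
  \sum_g gcoef x g * \prod_(B in porbits g) psumt1 w m #|B|.

Lemma trunc_state_cvg w x : trunc_state w m x @[m --> \oo] --> thoma_state w x.
Proof.
rewrite /trunc_state /thoma_state; apply: cvg_big => [|g _];
  first exact: add_continuous.
apply: cvgMr; rewrite chi_Omega_Sinf_of; apply: cvg_big => [|B Bg].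
  exact: mul_continuous.
by apply: psumt1_cvg; exact: porbits_gt0 Bg.
Qed.

(* Letters: the atoms alpha_i and beta_j with i, j < m, and one letter carrying *)
(* the remaining mass, whose occurrences in a word are deemed distinct.         *)
Definition tletter m : finType := ('I_m + 'I_m + unit)%type.
Definition is_beta m (l : tletter m) := if l is inl (inr _) then true else false.
Definition is_rest m (l : tletter m) := if l is inr _ then true else false.
Definition tweight w m (l : tletter m) : R :=
  match l with
  | inl (inl i) => alpha w i
  | inl (inr j) => beta w j
  | inr _ => 1 - (\sum_(i < m) alpha w i + \sum_(j < m) beta w j)
  end.

Lemma tweight_ge0 w m (l : tletter m) : 0 <= tweight w l.
Proof.
case: l => [[i|j]|_] /=; [exact: alpha_ge0|exact: beta_ge0|].
by rewrite subr_ge0 sum_alpha_beta.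
Qed.

(** The extra letter carries no cycle of length at least 2 and completes the total for 1-cycles to
    1. *)
Lemma sum_letter w m k : (0 < k)%N ->
  \sum_l letter (@is_beta m) (@is_rest m) (@tweight w m) k l = psumt1 w m k.
Proof.
move=> k0; rewrite !big_sumType /= /letter /= /psumt1 /psumt.
under eq_bigr do rewrite orbT mul1r.
under [X in _ + X + _]eq_bigr do rewrite orbT.
rewrite -mulr_sumr big_const card_unit /= addr0.
case: (k =P 1%N) => [->|_] /=; last by rewrite addr0.
under eq_bigr do rewrite expr1.
under [X in 1 ^+ 0 * X]eq_bigr do rewrite expr1.
by rewrite ?expr0 ?expr1 ?mul1r; ring.
Qed.

Lemma trunc_stateE w m x : trunc_state w m x = \sum_(f : {ffun 'I_N.+1 -> tletter m})
  (\prod_i tweight w (f i)) * gtau (x * wchar R (@is_beta m) (@is_rest m) f).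
Proof.
rewrite /trunc_state.
transitivity (\sum_g gcoef x g * \sum_(f : {ffun 'I_N.+1 -> tletter m})
    (\prod_i tweight w (f i)) * gcoef (wchar R (@is_beta m) (@is_rest m) f) g).
  apply: eq_bigr => g _; congr (_ * _); rewrite (word_sum _ _ _ (inr tt)).
  by apply: eq_bigr => B Bg; rewrite sum_letter // (porbits_gt0 Bg).
under eq_bigr do rewrite mulr_sumr.
rewrite exchange_big /=; apply: eq_bigr => f _.
rewrite gtauE mulr_sumr; apply: eq_bigr => g _.
by rewrite -gcoef_star gstar_wchar mulrCA.
Qed.

(** By [trunc_stateE] each truncation is a combination, with nonnegative weights, of the positive
    functionals of [wchar_state_ge0]; positivity passes to the limit. *)
Lemma thoma_state_ge0 w y : 0 <= thoma_state w (gstar y * y).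
Proof.
apply: (cvgr_to_ge (@trunc_state_cvg w (gstar y * y))); apply: nearW => m.
rewrite trunc_stateE; apply: sumr_ge0 => f _; rewrite mulr_ge0 ?wchar_state_ge0 //.
by apply: prodr_ge0 => i _; exact: tweight_ge0.
Qed.

Lemma thoma_state1 w : thoma_state w 1 = 1.
Proof.
rewrite /thoma_state (bigD1 1%g) //= gcoef1 eqxx mul1r big1 ?addr0 => [|g /negbTE g1].
  rewrite chi_Omega_Sinf_of big1 // => B /imsetP[i _ ->].
  by rewrite porbit_fix ?perm1 // cards1.
by rewrite gcoef1 g1 mul0r.
Qed.

Lemma thoma_state_sum w I (r : seq I) (Q : pred I) (F : I -> A) :
  thoma_state w (\sum_(i <- r | Q i) F i) = \sum_(i <- r | Q i) thoma_state w (F i).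
Proof.
rewrite /thoma_state exchange_big /=; apply: eq_bigr => g _.
by rewrite gcoef_sum mulr_suml.
Qed.

Lemma thoma_state_path_ge0 w a : 0 <= thoma_state w (path_proj R N a).
Proof. by rewrite -path_proj_idem -{1}gstar_path_proj thoma_state_ge0. Qed.

(** On the face the extra letter has weight 0 once m >= p and m >= q, so a word of nonzero weight
    uses at most p + q letters, none of them the extra one, and [durfee_wchar] applies. *)
Lemma thoma_state_face w p q : face p q w -> thoma_state w (durfee_gt R N (p + q)) = 0.
Proof.
move=> [ap bq s1]; have zero m : (maxn p q <= m)%N ->
  trunc_state w m (durfee_gt R N (p + q)) = 0.
  rewrite geq_max => /andP[pm qm]; rewrite trunc_stateE big1 // => f _.
  have sa : \sum_(i < m) alpha w i = \sum_(i < p) alpha w i.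
    rewrite -!(big_mkord xpredT) (big_cat_nat (n := p)) //= [X in _ + X]big_nat_cond.
    by rewrite [X in _ + X]big1 ?addr0 // => i /andP[/andP[pi _] _]; exact: ap.
  have sb : \sum_(i < m) beta w i = \sum_(i < q) beta w i.
    rewrite -!(big_mkord xpredT) (big_cat_nat (n := q)) //= [X in _ + X]big_nat_cond.
    by rewrite [X in _ + X]big1 ?addr0 // => i /andP[/andP[qi _] _]; exact: bq.
  have [/existsP[i /eqP wi]|] := boolP [exists i, tweight w (f i) == 0].
    by rewrite (bigD1 i) //= wi !mul0r.
  rewrite negb_exists => /forallP nz; rewrite durfee_wchar ?mulr0 // => [i|].
    have := nz i; case: (f i) => //= -[]; by rewrite sa sb s1 subrr eqxx.
  pose X := ([set (inl (inl (widen_ord pm i)) : tletter m) | i in 'I_p] :|: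
             [set (inl (inr (widen_ord qm j)) : tletter m) | j in 'I_q])%SET.
  apply: (@leq_trans #|X|); last first.
    apply: (leq_trans (leq_card_setU _ _)); apply: leq_add.
      by rewrite (leq_trans (leq_imset_card _ _)) // card_ord.
    by rewrite (leq_trans (leq_imset_card _ _)) // card_ord.
  apply: subset_leq_card; apply/fintype.subsetP => _ /imsetP[i _ ->]; rewrite inE.
  have := nz i; case: (f i) => [[j|j]|u] /=; last by rewrite sa sb s1 subrr eqxx.
    have [jp _|pj] := ltnP j p; last by rewrite ap // eqxx.
    by apply/orP; left; apply/imsetP; exists (Ordinal jp) => //;
      congr (inl (inl _)); exact: val_inj.
  have [jp _|pj] := ltnP j q; last by rewrite bq // eqxx.
  by apply/orP; right; apply/imsetP; exists (Ordinal jp) => //;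
    congr (inl (inr _)); exact: val_inj.
have near0 : \forall m \near \oo, trunc_state w m (durfee_gt R N (p + q)) = 0.
  by exists (maxn p q) => // m /=; exact: zero.
apply/eqP; rewrite eq_le; apply/andP; split.
  by apply: (cvgr_to_le (@trunc_state_cvg w _)); apply: filterS near0 => m ->.
by apply: (cvgr_to_ge (@trunc_state_cvg w _)); apply: filterS near0 => m ->.
Qed.

End Level.

Lemma measurable_of_continuous (f : Omega R -> R) : continuous f ->
  measurable_fun [set: Omega_borel R] (f : Omega_borel R -> R).
Proof.
move=> cf; apply: (measurability _ (RGenOInfty.measurableE R)) => //=.
move=> _ [_ [a ->] <-]; rewrite setTI; apply: sub_sigma_algebra.
by apply: open_comp => [w _|]; [exact: cf|exact: interval_open].
Qed.

Lemma alpha_measurable i :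
  measurable_fun [set: Omega_borel R] (fun w : Omega_borel R => alpha w i).
Proof.
apply: measurable_of_continuous => w.
pose X := ({ptws nat -> R} * {ptws nat -> R})%type.
have cv : {for w, continuous (fun w : Omega R => \val w : X)}.
  exact: (@initial_continuous (Omega R) X (fun w => \val w) w).
apply: (@continuous_comp _ _ _ (fun w : Omega R => \val w : X)
  (fun v : X => v.1 i) w cv).
apply: (@continuous_comp _ _ _ (fun v : X => v.1)
  (fun u : {ptws nat -> R} => u i)); first exact: cvg_fst.
exact: (@proj_continuous nat (fun=> R) i).
Qed.

Lemma beta_measurable i :
  measurable_fun [set: Omega_borel R] (fun w : Omega_borel R => beta w i).
Proof.
apply: measurable_of_continuous => w.
pose X := ({ptws nat -> R} * {ptws nat -> R})%type.
have cv : {for w, continuous (fun w : Omega R => \val w : X)}.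
  exact: (@initial_continuous (Omega R) X (fun w => \val w) w).
apply: (@continuous_comp _ _ _ (fun w : Omega R => \val w : X)
  (fun v : X => v.2 i) w cv).
apply: (@continuous_comp _ _ _ (fun v : X => v.2)
  (fun u : {ptws nat -> R} => u i)); first exact: cvg_snd.
exact: (@proj_continuous nat (fun=> R) i).
Qed.

Lemma psum1_measurable k : (0 < k)%N ->
  measurable_fun [set: Omega_borel R] (fun w : Omega_borel R => psum1 w k).
Proof.
move=> k0; apply: (@measurable_fun_cvg _ (Omega_borel R) R setT
  (fun m (w : Omega_borel R) => psumt1 w m k)) => [m|w _].
  rewrite /psumt1; case: eqP => _; first exact: measurable_cst.
  apply: measurable_funD.
    under eq_fun do rewrite -(big_mkord xpredT (fun i => alpha _ i ^+ k)).
    by apply: measurable_sum => i; apply: measurable_funX; exact: alpha_measurable.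
  apply: measurable_funM; first exact: measurable_cst.
  under eq_fun do rewrite -(big_mkord xpredT (fun i => beta _ i ^+ k)).
  by apply: measurable_sum => i; apply: measurable_funX; exact: beta_measurable.
exact: psumt1_cvg.
Qed.

Lemma bmeas_chi N (g : 'S_N.+1) :
  bmeas (fun w : Omega_borel R => chi_Omega w (Sinf_of g)).
Proof.
under eq_fun do rewrite chi_Omega_Sinf_of; split.
  under eq_fun do rewrite -big_enum.
  apply: measurable_prod => B; rewrite mem_enum => Bg.
  by apply: psum1_measurable; exact: porbits_gt0 Bg.
exists 1 => w; rewrite normr_prod; apply: prodr_ile1 => B Bg.
by rewrite normr_ge0 psum1_le1 // (porbits_gt0 Bg).
Qed.

Lemma bmeas_thoma_state N (x : galg R 'S_N.+1) : bmeas (fun w : Omega_borel R =>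
  thoma_state w x).
Proof. by apply: bmeas_sum => g; exact: bmeas_chi. Qed.

End Thoma.

(** * Spectral measures *)

Section PathWeights.
Variables (R : realType) (N : nat).
Local Notation P := (path_proj R N).

Lemma path_proj_jmquad a p q m : (m <= N.+1)%N ->
  P a * (\prod_(k < m) jmquad N p q k) = (\prod_(k < m) quad p q (a k)) *: P a.
Proof.
elim: m => [|m IH] mN; first by rewrite !big_ord0 mulr1 scale1r.
rewrite !big_ord_recr /= mulrA (IH (ltnW mN)) -scalerAl -scalerA; congr (_ *: _).
rewrite /jmquad !mulrDr mulrA path_proj_JM // -scalerAl path_proj_JM //
  -!scalerAr path_proj_JM // mulr1 !scalerA.
by rewrite -!scalerDl /quad expr2 /kint -mulrDl.
Qed.

(** The projections sum to 1 and diagonalize the product of quadratics, so this is its trace. *)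
Lemma sum_path_weights p q :
  \sum_f gtau (P (content_seq f)) * \prod_(k < N.+1) quad p q (content_seq (N :=
    N) f k) =
  \prod_(k < N.+1) (q + k%:R).
Proof.
transitivity (gtau ((\sum_f P (content_seq (N := N) f)) * \prod_(k < N.+1) jmquad
  N p q k)).
  rewrite mulr_suml gtau_sum; apply: eq_bigr => f _.
  by rewrite path_proj_jmquad // gtauZ mulrC.
by rewrite sum_path_proj mul1r gtau_jmquad.
Qed.

Lemma rising_gt0 (t : R) : 0 < t -> 0 < \prod_(k < N.+1) (t + k%:R).
Proof. by move=> t0; apply: prodr_gt0 => k _; rewrite ltr_pwDl. Qed.

End PathWeights.

Section Spectral.
Variables (R : realType) (mu : R -> probability vperm_borel R).
Hypothesis mu_ewens : forall t : R, 0 < t -> ewens t (mu t).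
Variable sigma : R[i] -> probability (Omega_borel R) R.
Hypothesis sigma_spectral : forall z : R[i], nonint_upper z ->
  is_spectral_measure (chi_ (mu (sqmod z)) z) (sigma z).

Lemma sqmodE (z : R[i]) : sqmod z = complex.Re z ^+ 2 + complex.Im z ^+ 2.
Proof.
rewrite /sqmod; case: z => a b /=; rewrite sqr_sqrtr //.
by rewrite addr_ge0 // sqr_ge0.
Qed.

Lemma nonint_of (z : R[i]) : nonint_upper z ->
  nonint (complex.Re z) (complex.Im z ^+ 2).
Proof.
move=> [zZ _]; split; first exact: sqr_ge0.
move=> /eqP; rewrite sqrf_eq0 => /eqP y0 m xm; apply: (zZ m).
rewrite -(rmorph_int (real_complex R)) /= -xm; move: y0; case: (z) => a b /= ->.
by [].
Qed.

Lemma sqmod_gt0 (z : R[i]) : nonint_upper z -> 0 < sqmod z.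
Proof.
move=> /nonint_of h; have := content_factor_gt0 0 h; rewrite sqmodE /content_factor.
by rewrite mulr0z add0r.
Qed.

(** The averaged state is the trace against the product of the |z + J_k|^2, divided by the rising
    factorial; this product acts on P_a by a scalar. *)
Lemma integral_path (z : R[i]) N a : nonint_upper z ->
  \int[sigma z]_w thoma_state w (path_proj R N a) =
    gtau (path_proj R N a) * (\prod_(k < N.+1) content_factor (complex.Re z)
      (complex.Im z ^+ 2) (a k)) /
    \prod_(k < N.+1) (sqmod z + k%:R).
Proof.
move=> nz; have z0 : z != 0.
  by apply/eqP => z0; case: nz => + _ => /(_ 0); rewrite mulr0z; apply.
have t0 := sqmod_gt0 nz.
rewrite /thoma_state Rintegral_lin => [|g]; last exact: bmeas_chi.
have E g : \int[sigma z]_w chi_Omega w (Sinf_of g) =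
    gcoef (\prod_(k < N.+1) jmquad N (2 * complex.Re z) (sqmod z) k) g /
    \prod_(k < N.+1) (sqmod z + k%:R).
  have := sigma_spectral nz (Sinf_of g).
  rewrite (chi_Sinf_of (mu_ewens t0) _ (sqmodE z) z0) => /complexI.
  by move=> <-.
under eq_bigr do rewrite E mulrA.
rewrite -mulr_suml; congr (_ / _).
transitivity (gtau (path_proj R N a * \prod_(k < N.+1) jmquad N (2 * complex.Re
  z) (sqmod z) k)).
  by rewrite gtauE; apply: eq_bigr => g _; rewrite -gcoef_star gstar_jmquad.
rewrite path_proj_jmquad // gtauZ mulrC; congr (_ * _).
by apply: eq_bigr => k _; rewrite content_factor_quad sqmodE.
Qed.

Lemma integral_paths (z : R[i]) N (Q : pred {ffun 'I_N.+1 -> 'I_N.*2.+1}) :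
  \int[sigma z]_w thoma_state w (\sum_(f | Q f) path_proj R N (content_seq f)) =
  \sum_(f | Q f) \int[sigma z]_w thoma_state w (path_proj R N (content_seq f)).
Proof.
rewrite [RHS](eq_bigr (fun f => 1 * \int[sigma z]_w thoma_state w (path_proj R N
  (content_seq f)))); last first.
  by move=> f _; rewrite mul1r.
rewrite -[RHS]big_filter -Rintegral_lin => [|f]; last exact: bmeas_thoma_state.
apply: eq_Rintegral => w _; rewrite thoma_state_sum big_filter.
by apply: eq_bigr => f _; rewrite mul1r.
Qed.

Lemma thoma_state_paths_ge0 w N (Q : pred {ffun 'I_N.+1 -> 'I_N.*2.+1}) :
  0 <= thoma_state w (\sum_(f | Q f) path_proj R N (content_seq f)).
Proof. by rewrite thoma_state_sum sumr_ge0 // => f _; exact: thoma_state_path_ge0. Qed.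

Lemma thoma_state_paths_compl w N (Q : pred {ffun 'I_N.+1 -> 'I_N.*2.+1}) :
  thoma_state w (\sum_(f | Q f) path_proj R N (content_seq f)) + thoma_state w
    (\sum_(f | ~~ Q f) path_proj R N (content_seq f)) = 1.
Proof. by rewrite -(thoma_state1 N w) -(sum_path_proj R N) !thoma_state_sum
  [RHS](bigID Q). Qed.

(** The likelihood test: with Q the set where m' < m, both errors are at most the sum of min(m, m'),
    and min(m, m')^2 <= m m' is compared with the squared weights of the quadratic. *)
Lemma separating_paths (z z' : R[i]) : nonint_upper z -> nonint_upper z' -> z <> z' ->
  forall e, 0 < e -> exists N (Q : pred {ffun 'I_N.+1 -> 'I_N.*2.+1}),
    \int[sigma z']_w thoma_state w (\sum_(f | Q f) path_proj R N (content_seq f))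
      <= e /\
    \int[sigma z]_w thoma_state w (\sum_(f | ~~ Q f) path_proj R N (content_seq
      f)) <= e.
Proof.
move=> nz nz' zz' e e0.
have ne : (complex.Re z, complex.Im z ^+ 2) <> (complex.Re z', complex.Im z' ^+ 2).
  case=> rr ii; apply: zz'; case: nz nz' => _ iz [_ iz'].
  have : complex.Im z = complex.Im z'.
    by apply/eqP; rewrite -(eqrXn2 (n := 2)) // ii.
  by move: rr; case: (z) (z') => a b [a' b'] /= -> ->.
have [p [q [/andP[q0 qt] Q0 [C C0 est]]]] :=
  disjoint_estimate (nonint_of nz) (nonint_of nz') ne.
rewrite -!sqmodE in qt.
have t0 := sqmod_gt0 nz; have t0' := sqmod_gt0 nz'.
(* The bound concerns squares and carries the constant C, whence e^2 / C. *)
have [N HN] := gamma_ratio q0 t0 t0' qt (divr_gt0 (exprn_gt0 2 e0) C0).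
pose m (f : {ffun 'I_N.+1 -> 'I_N.*2.+1}) := \int[sigma z]_w thoma_state w
  (path_proj R N (content_seq f)).
pose m' (f : {ffun 'I_N.+1 -> 'I_N.*2.+1}) := \int[sigma z']_w thoma_state w
  (path_proj R N (content_seq f)).
exists N, (fun f => m' f < m f); rewrite !integral_paths.
set T := \prod_(k < N.+1) (sqmod z + k%:R) in HN.
set T' := \prod_(k < N.+1) (sqmod z' + k%:R) in HN.
set B := \prod_(k < N.+1) (q + k%:R) in HN.
have T0 : 0 < T by exact: rising_gt0.
have T0' : 0 < T' by exact: rising_gt0.
have B0 : 0 < B by exact: rising_gt0.
pose W (f : {ffun 'I_N.+1 -> 'I_N.*2.+1}) := gtau (path_proj R N (content_seq f))
  * \prod_(k < N.+1) quad p q (content_seq f k).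
have W0 f : 0 <= W f.
  by rewrite mulr_ge0 ?gtau_path_proj_ge0 //; apply: prodr_ge0 => k _; exact/ltW/Q0.
have m0 f : 0 <= m f by apply: Rintegral_ge0 => w _; exact: thoma_state_path_ge0.
have m0' f : 0 <= m' f by apply: Rintegral_ge0 => w _; exact: thoma_state_path_ge0.
have mm f : m f * m' f <= (W f * (e / B)) ^+ 2.
  rewrite /m /m' !integral_path // -/T -/T' /W.
  have [P0|Pf] := eqVneq (path_proj R N (content_seq f)) 0.
    by rewrite P0 /gtau gcoef0 !mul0r expr0n.
  have := est N (content_seq f) Pf.
  set X := \prod_(k < N.+1) content_factor (complex.Re z) _ _.
  set X' := \prod_(k < N.+1) content_factor (complex.Re z') _ _.
  set Y := \prod_(k < N.+1) quad p q _ => XY.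
  set g := gtau _.
  have -> : g * X / T * (g * X' / T') = g ^+ 2 * (X * X' / (T * T')).
    by field; rewrite !gt_eqF.
  have -> : (g * Y * (e / B)) ^+ 2 = g ^+ 2 * (Y ^+ 2 * (e ^+ 2 / B ^+ 2)).
    by field; rewrite gt_eqF.
  rewrite ler_wpM2l ?sqr_ge0 // ler_pdivrMr ?mulr_gt0 //.
  apply: (le_trans XY); rewrite [C * _]mulrC -[X in _ <= X]mulrA ler_wpM2l ?sqr_ge0 //.
  rewrite mulrAC ler_pdivlMr ?exprn_gt0 // mulrC.
  by move: HN; rewrite mulrAC ler_pdivlMr.
have minle f u v : 0 <= u -> 0 <= v -> u <= v -> u * v <= (W f * (e / B)) ^+ 2 ->
    u <= W f * (e / B).
  move=> u0 v0 uv uvW; have : u ^+ 2 <= (W f * (e / B)) ^+ 2.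
    by apply: le_trans uvW; rewrite expr2 ler_wpM2l.
  by rewrite ler_pXn2r // nnegrE mulr_ge0 ?divr_ge0 // ltW.
have tot (S : pred {ffun 'I_N.+1 -> 'I_N.*2.+1}) (u : {ffun 'I_N.+1 ->
  'I_N.*2.+1} -> R) :
    (forall f, S f -> u f <= W f * (e / B)) -> \sum_(f | S f) u f <= e.
  move=> uS; apply: (@le_trans _ _ (\sum_f W f * (e / B))).
    rewrite [X in _ <= X](bigID S) /= -[X in X <= _]addr0; apply: lerD.
      exact: ler_sum.
    by apply: sumr_ge0 => f _; rewrite mulr_ge0 ?divr_ge0 // ltW.
  by rewrite -mulr_suml sum_path_weights mulrC divfK // gt_eqF.
split; apply: tot => f; rewrite -?leNgt => h.
  apply: (minle f (m' f) (m f)) => //; first exact: ltW.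
  by rewrite [X in X <= _]mulrC; exact: mm.
exact: (minle f (m f) (m' f)).
Qed.

(** F + G = 1, so outside the set F >= 1/2 one has G >= 1/2, and Markov's inequality bounds both
    sets; its factor 2 is offset by taking e / 2. *)
Lemma spectral_disjoint (z z' : R[i]) : nonint_upper z -> nonint_upper z' -> z <> z' ->
  mutually_singular (sigma z) (sigma z').
Proof.
move=> nz nz' zz'; apply: singular_of_separating => e e0.
have [N [Q [Q1 Q2]]] := separating_paths nz nz' zz' (divr_gt0 e0 (ltr0n R 2)).
pose F w := thoma_state w (\sum_(f | Q f) path_proj R N (content_seq f)).
pose G w := thoma_state w (\sum_(f | ~~ Q f) path_proj R N (content_seq f)).
have bF : bmeas (F : Omega_borel R -> R) by exact: bmeas_thoma_state.
have bG : bmeas (G : Omega_borel R -> R) by exact: bmeas_thoma_state.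
exists [set w : Omega_borel R | 2^-1 <= F w]; split; first exact: measurable_half.
  apply: (@le_trans _ _ (sigma z [set w : Omega_borel R | 2^-1 <= G w])).
    apply: le_measure; rewrite ?inE.
    - by apply: measurableC; exact: measurable_half.
    - exact: measurable_half.
    move=> w /= /negP; rewrite -ltNge => Fw.
    by have := thoma_state_paths_compl w Q; rewrite -/(F w) -/(G w); lra.
  apply: (le_trans (markov_half _ bG _)) => [w|]; first exact: thoma_state_paths_ge0.
  by rewrite lee_fin -ler_pdivlMl // mulrC.
apply: (le_trans (markov_half _ bF _)) => [w|]; first exact: thoma_state_paths_ge0.
by rewrite lee_fin -ler_pdivlMl // mulrC.
Qed.

(** On the face [G N] equals 1 for every N, while its average is arbitrarily small for suitable N;
    so the measurable sets [Z N] cover the face and their intersection is null. *)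
Lemma face_null (z : R[i]) p q : nonint_upper z -> (sigma z).-negligible (@face R p q).
Proof.
move=> nz; pose Q N (f : {ffun 'I_N.+1 -> 'I_N.*2.+1}) := (p + q < content_count
  (content_seq f) 0 N.+1)%N.
pose G N w := thoma_state w (\sum_(f | ~~ Q N f) path_proj R N (content_seq f)).
have bG N : bmeas (G N : Omega_borel R -> R) by exact: bmeas_thoma_state.
pose Z N := [set w : Omega_borel R | 2^-1 <= G N w].
have mZ N : measurable (Z N) by exact: measurable_half.
have mZZ : measurable (\bigcap_N Z N) by exact: bigcap_measurable.
exists (\bigcap_N Z N); split=> //; last first.
  move=> w fw N _; have := thoma_state_paths_compl w (Q N); rewrite -/(G N w) /=.
  by have := thoma_state_face N fw; rewrite /durfee_gt => ->;
    rewrite add0r /Z /= => ->; lra.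
apply/eqP; rewrite eq_le measure_ge0 andbT; apply/lee_addgt0Pr => e e0; rewrite add0e.
have [a [b [/andP[b0 bt] Q0 /(_ (p + q)%N) [C C0 est]]]] := face_estimate
  (nonint_of nz).
rewrite -sqmodE in bt; have t0 := sqmod_gt0 nz.
have [d d0 Cd] : exists2 d, 0 < d & C * d = e / 2.
  by exists (e / 2 / C); [rewrite !divr_gt0|rewrite mulrC divfK // gt_eqF].
have bt' : b < (sqmod z + sqmod z) / 2 by lra.
(* With both parameters equal to [sqmod z] the squares can be removed, leaving B <= d T. *)
have [N HN] := gamma_ratio b0 t0 t0 bt' (exprn_gt0 2 d0).
set T := \prod_(k < N.+1) (sqmod z + k%:R) in HN.
set B := \prod_(k < N.+1) (b + k%:R) in HN.
have T0 : 0 < T by exact: rising_gt0.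
have B0 : 0 < B by exact: rising_gt0.
have BT : B <= d * T.
  rewrite -(ler_pXn2r (n := 2)) ?nnegrE ?mulr_ge0 ?(ltW B0) ?(ltW d0) ?(ltW T0) //.
  by rewrite exprMn -[T ^+ 2]/(T * T).
apply: (@le_trans _ _ (sigma z (Z N))).
  by apply: le_measure; rewrite ?inE //; exact: bigcap_inf.
apply: (le_trans (markov_half _ (bG N) _)) => [w|]; first exact: thoma_state_paths_ge0.
rewrite lee_fin integral_paths.
have W0 (f : {ffun 'I_N.+1 -> 'I_N.*2.+1}) : 0 <=
  gtau (path_proj R N (content_seq f)) * \prod_(k < N.+1) quad a b (content_seq f k).
  by rewrite mulr_ge0 ?gtau_path_proj_ge0 //; apply: prodr_ge0 => k _; exact/ltW/Q0.
suff : \sum_(f | ~~ Q N f) \int[sigma z]_w thoma_state w (path_proj R N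
  (content_seq f)) <= C * d.
  by rewrite Cd; lra.
apply: (@le_trans _ _ (\sum_(f : {ffun 'I_N.+1 ->
  'I_N.*2.+1}) C / T * (gtau (path_proj R N (content_seq f)) *
    \prod_(k < N.+1) quad a b (content_seq f k)))); last first.
  rewrite -mulr_sumr sum_path_weights -/B mulrAC -mulrA ler_wpM2l ?(ltW C0) //.
  by rewrite ler_pdivrMr.
rewrite [X in _ <= X](bigID (Q N)) /= -[X in X <= _]add0r; apply: lerD.
  by apply: sumr_ge0 => f _; rewrite mulr_ge0 // divr_ge0 // ltW.
apply: ler_sum => f nQ; rewrite integral_path // -/T.
have [P0|Pf] := eqVneq (path_proj R N (content_seq f)) 0.
  by rewrite P0 /gtau gcoef0 !mul0r mulr0.
rewrite -leqNgt in nQ.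
rewrite ler_pdivrMr // mulrAC divfK ?gt_eqF // mulrCA ler_wpM2l ?gtau_path_proj_ge0 //.
exact: est.
Qed.

End Spectral.

Theorem theorem8p1p2 (R : realType)
    (mu : R -> probability vperm_borel R)
    (mu_ewens : forall t : R, 0 < t -> ewens t (mu t))
    (sigma : R[i] -> probability (Omega_borel R) R)
    (sigma_spectral : forall z : R[i], nonint_upper z ->
       is_spectral_measure (chi_ (mu (sqmod z)) z) (sigma z)) :
  (forall z z' : R[i], nonint_upper z -> nonint_upper z' -> z <> z' ->
     mutually_singular (sigma z) (sigma z'))
  /\
  (forall z : R[i], nonint_upper z ->
     forall p q : nat, (p, q) <> (0%N, 0%N) ->
       (sigma z).-negligible (@face R p q)).
Proof.
split=> [z z'|z nz p q _]; first exact: (spectral_disjoint mu_ewens sigma_spectral).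
exact: (face_null mu_ewens sigma_spectral).
Qed.
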